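(* Let $(p,q)\in\mathbb{R}^2$ be an admissible couple, i.e. $\frac1p+\frac1q=\frac12$ and $p>2$. Let $P=-\partial_x^2+\partial_y^2$ on the torus $\mathbb{T}^2=(\mathbb{R}/2\pi\mathbb{Z})^2$. Then there exists a constant $C>0$ such that for every $u_0\in H^{\frac1p}(\mathbb{T}^2)$, $$\|e^{-itP}u_0\|_{L^p_{t\in[0,1]}L^q_{xy}(\mathbb{T}^2)}\le C\|u_0\|_{H^{\frac1p}(\mathbb{T}^2)}.$$ Moreover, this estimate is sharp in the following sense: for every real $s<\frac1p$, the estimate $$\|e^{-itP}u_0\|_{L^p_{t\in[0,1]}L^q_{xy}(\mathbb{T}^2)}\le C\|u_0\|_{H^{s}(\mathbb{T}^2)}$$ fails, i.e. there is no constant $C>0$ such that it holds for every $u_0\in H^s(\mathbb{T}^2)$.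
   Context: $\mathbb{T}^2=(\mathbb{R}/2\pi\mathbb{Z})^2$ is the two-dimensional torus with coordinates $(x,y)$, and functions are complex valued. For $s\in\mathbb{R}$, $H^s(\mathbb{T}^2)$ is the usual $L^2$-based Sobolev space, with norm $\|u\|_{H^s}^2=\sum_{(m,n)\in\mathbb{Z}^2}(1+m^2+n^2)^s|\hat u(m,n)|^2$ (up to an equivalent normalization), where $\hat u(m,n)$ are the Fourier coefficients of $u$. The operator $e^{-itP}$ is the solution operator of the non elliptic Schrödinger equation $(i\partial_t+\partial_x^2-\partial_y^2)u=0$, $u(0,x,y)=u_0(x,y)$, on $\mathbb{T}^2$; equivalently, it is the Fourier multiplier $\widehat{e^{-itP}u_0}(m,n)=e^{-it(m^2-n^2)}\hat u_0(m,n)$. The mixed norm is $\|u\|_{L^p_{t\in[0,1]}L^q_{xy}(\mathbb{T}^2)}=\left(\int_0^1\|u(t,\cdot,\cdot)\|_{L^q(\mathbb{T}^2)}^p\,dt\right)^{1/p}$, understood to be $+\infty$ when $u$ does not belong to the corresponding space. *)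

(* Defs.v *)
From HB Require Import structures.
From mathcomp Require Import all_boot all_order all_algebra.
From mathcomp Require Import complex.
From mathcomp Require Import all_classical all_reals all_analysis.

Set Implicit Arguments.
Unset Strict Implicit.
Unset Printing Implicit Defensive.

Import Order.TTheory GRing.Theory Num.Theory.
Import numFieldNormedType.Exports.

Local Open Scope classical_set_scope.
Local Open Scope complex_scope.
Local Open Scope ring_scope.

Section Torus.
Context {R : realType}.

Implicit Types (f : R * R -> R[i]) (m n : int) (t p q s : R).

Definition cis (theta : R) : R[i] := cos theta +i* sin theta.

(* A function on (R / 2 pi Z)^2 is a doubly 2 pi-periodic function on R^2,
   integrated over one period square. *)
Definition torus_square : set (R * R) :=
  `[0, 2 * pi]%classic `*` `[0, 2 * pi]%classic.

Local Notation area := (@lebesgue_measure R \x @lebesgue_measure R)%E.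

Definition biperiodic f :=
  forall x y, f (x + 2 * pi, y) = f (x, y) /\ f (x, y + 2 * pi) = f (x, y).

Definition torus_integrable f :=
  [/\ biperiodic f,
      measurable_fun setT (fun z => complex.Re (f z)),
      measurable_fun setT (fun z => complex.Im (f z)) &
      (\int[area]_(z in torus_square) (Normc.normc (f z))%:E
         < +oo)%E].

Definition torus_Lnorm q f : \bar R :=
  ((\int[area]_(z in torus_square)
      ((Normc.normc (f z))%:E `^ q)) `^ q^-1)%E.

Definition integral_torus f : R[i] :=
  Rintegral area torus_square (fun z => complex.Re (f z)) +i*
  Rintegral area torus_square (fun z => complex.Im (f z)).

Definition fourier_coef f m n : R[i] :=
  ((2 * pi) ^- 2)%:C *
  integral_torus (fun z => f z * cis (- (m%:~R * z.1 + n%:~R * z.2))).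

Definition japanese2 m n : R := 1 + m%:~R ^+ 2 + n%:~R ^+ 2.

(* H^s contains non-functions when s < 0.  Distributions on the torus are
   identified with their Fourier coefficients: these range over all families
   of at most polynomial growth. *)
Record torus_distr := TorusDistr {
  hat :> int -> int -> R[i];
  hat_tempered : exists (C : R) (k : nat),
    forall m n, Normc.normc (hat m n) <= C * japanese2 m n ^+ k
}.

Implicit Types u : torus_distr.

Definition Hnorm s u : \bar R :=
  ((\esum_(k in [set: int * int])
      (japanese2 k.1 k.2 `^ s * Normc.normc (u k.1 k.2) ^+ 2)%:E) `^ 2^-1)%E.

Definition in_H s u := (Hnorm s u < +oo)%E.

(* L^q norm of a distribution.  The integrable functions with the Fourier
   coefficients of u agree almost everywhere, so the infimum is over at most
   one value; it is +oo when u is not a function in L^q. *)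
Definition distr_Lnorm q u : \bar R :=
  ereal_inf [set torus_Lnorm q f | f in
    [set f | torus_integrable f /\ forall m n, fourier_coef f m n = u m n]].

(* Symbol of P = - d_x^2 + d_y^2. *)
Definition symbolP m n : R := m%:~R ^+ 2 - n%:~R ^+ 2.

Lemma normc_cis theta : Normc.normc (cis theta) = 1.
Proof. by rewrite /Normc.normc /cis cos2Dsin2 sqrtr1. Qed.

Lemma expitP_tempered t u : exists (C : R) (k : nat), forall m n,
  Normc.normc (cis (- (t * symbolP m n)) * u m n) <= C * japanese2 m n ^+ k.
Proof.
have [C [k Ck]] := hat_tempered u.
by exists C, k => m n; rewrite Normc.normcM normc_cis mul1r.
Qed.

(* The propagator e^{-itP}. *)
Definition expitP t u : torus_distr := TorusDistr (expitP_tempered t u).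

(* Norm in L^p([0,1]; L^q(T^2)) of a time-dependent distribution. *)
Definition LpLq_norm p q (u : R -> torus_distr) : \bar R :=
  ((\int[@lebesgue_measure R]_(t in `[0%R, 1%R])
      (distr_Lnorm q (u t) `^ p)) `^ p^-1)%E.

Definition admissible p q := p^-1 + q^-1 = 2^-1 /\ 2 < p.

End Torus.

(* Main.v *)
(** If [u_0] has frequencies in a box of side [M], its evolution at times [t, s]
    with [|t - s| <= 1 / M] has as kernel a product of two Weyl sums of length
    [M], one for each variable.  By Kusmin-Landau each is [O(|t - s|^(-1/2))], so that on time
    intervals of length [1 / M] the dispersive estimate of the plane holds, as the
    sign in front of the second variable plays no role.  Interpolation with
    Parseval, Hardy-Littlewood-Sobolev in time and duality give the [L^p L^q]
    estimate without loss on such an interval; adding up the [M] intervals of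
    [[0, 1]] costs [M^(1/p)].  Using this at two admissible pairs on both sides of
    [(p, q)], the product of two dyadic blocks gains a factor exponentially small
    in the difference of their levels, so the blocks can be summed in [l^2], and
    monotone and dominated convergence pass to the limit.

    For the converse, [u_0 = \sum_(j < N) e^(i j (x + y))] is invariant under the
    flow.  Tested against the Fejer kernel in [x + y] it has [L^q] norm at least
    [c N^(1 - 1/q)], while its [H^s] norm is at most [C N^(1/2 + s)] for [s >= 0];
    and [1 - 1/q = 1/2 + 1/p]. *)

Require Import Defs.
From HB Require Import structures.
From mathcomp Require Import all_boot all_order all_algebra.
From mathcomp Require Import complex.
From mathcomp Require Import all_classical all_reals all_analysis.
From mathcomp Require Import measurable_realfun.
From mathcomp Require Import ring lra zify.

Set Implicit Arguments.
Unset Strict Implicit.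
Unset Printing Implicit Defensive.

Import Order.TTheory GRing.Theory Num.Theory.
Import numFieldNormedType.Exports.

Local Open Scope classical_set_scope.
Local Open Scope complex_scope.
Local Open Scope ring_scope.

(** * Bounded measurable functions *)

(** Before the passage to the limit, all functions are built from finite sums of plane waves and all
    constants are independent of the number of terms. It is therefore enough to integrate bounded
    measurable functions over sets of finite measure. The length [1 / M] of the time intervals comes
    from Kusmin-Landau: once [x] is reduced modulo [2 pi], the half-increments of the phase stay in
    [[- pi / 2, pi / 2 + 1]], where [sin] vanishes only at [0]. For [|t - s|] below a multiple of
    [1 / M ^ 2] the trivial bound [M ^ 2] on the kernel is the better one; capping the dispersive
    bound there keeps the kernel in time bounded, and no later constant depends on the cap.
    Interpolation is of Marcinkiewicz type and acts on the bilinear form at a fixed pair of times,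
    so that its bound [B ^ (2 / p)] is directly a kernel for Hardy-Littlewood-Sobolev. In the
    converse, the norm of a distribution is an infimum over the functions with given Fourier
    coefficients; testing against a kernel bounds all of these functions at once. *)

Section BoundedMeasurable.
Context d (T : measurableType d) (R : realType).
Implicit Types f g h : T -> R.

(** The class is closed under all the operations used below, partial integrals included, and its
    members are integrable on any set of finite measure. The bound is asked on the whole space, so
    that no domain has to be tracked. *)
Definition bmf f := measurable_fun setT f /\ exists M : R, forall x, `|f x| <= M.

Lemma bmf_bound f : bmf f -> exists M : R, 0 < M /\ forall x, `|f x| <= M.
Proof.
move=> [_ [M fM]]; exists (`|M| + 1); split; first by rewrite ltr_wpDl.
by move=> x; apply: (le_trans (fM x)); rewrite (le_trans (ler_norm _))// lerDl.
Qed.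

Lemma eq_bmf f g : f =1 g -> bmf f -> bmf g.
Proof. by move=> /funext ->. Qed.

Lemma bmf_cst (c : R) : bmf (fun=> c).
Proof. by split; [exact: measurable_cst | exists `|c|]. Qed.

Lemma bmfD f g : bmf f -> bmf g -> bmf (fun x => f x + g x).
Proof.
move=> [mf [M fM]] [mg [N gN]]; split; first exact: measurable_funD.
by exists (M + N) => x; rewrite (le_trans (ler_normD _ _))// lerD.
Qed.

Lemma bmfN f : bmf f -> bmf (fun x => - f x).
Proof.
move=> [mf [M fM]]; split; first exact: measurableT_comp.
by exists M => x; rewrite normrN.
Qed.

Lemma bmfB f g : bmf f -> bmf g -> bmf (fun x => f x - g x).
Proof. by move=> bf bg; apply: bmfD => //; exact: bmfN. Qed.

Lemma bmfM f g : bmf f -> bmf g -> bmf (fun x => f x * g x).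
Proof.
move=> [mf [M fM]] [mg [N gN]]; split; first exact: measurable_funM.
by exists (M * N) => x; rewrite normrM ler_pM.
Qed.

Lemma bmfX f n : bmf f -> bmf (fun x => f x ^+ n).
Proof.
move=> bf; elim: n => [|n ih].
  by apply: (eq_bmf _ (bmf_cst 1)) => x; rewrite expr0.
by apply: (eq_bmf _ (bmfM bf ih)) => x; rewrite exprS.
Qed.

Lemma bmf_sum (I : Type) (s : seq I) (P : pred I) (F : I -> T -> R) :
  (forall i, P i -> bmf (F i)) -> bmf (fun x => \sum_(i <- s | P i) F i x).
Proof.
move=> bF; elim: s => [|i s ih].
  by apply: (eq_bmf _ (bmf_cst 0)) => x; rewrite big_nil.
case Pi: (P i).
  by apply: (eq_bmf _ (bmfD (bF i Pi) ih)) => x; rewrite big_cons Pi.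
by apply: eq_bmf ih => x; rewrite big_cons Pi.
Qed.

Lemma bmf_norm f : bmf f -> bmf (fun x => `|f x|).
Proof.
move=> [mf [M fM]]; split; first exact: measurableT_comp.
by exists M => x; rewrite normr_id.
Qed.

Lemma bmf_ifT (b : T -> bool) f g : measurable_fun setT b ->
  bmf f -> bmf g -> bmf (fun x => if b x then f x else g x).
Proof.
move=> mb [mf [M fM]] [mg [N gN]]; split; first exact: measurable_fun_ifT.
exists (Num.max M N) => x; rewrite le_max.
by case: ifP => _; rewrite ?fM// gN orbT.
Qed.

Lemma bmf_powR f r : (forall x, 0 <= f x) -> 0 <= r -> bmf f ->
  bmf (fun x => f x `^ r).
Proof.
move=> f0 r0 [mf [M fM]]; split.
  exact: (measurableT_comp (measurable_powR r)).
exists (M `^ r) => x; rewrite ger0_norm ?powR_ge0//.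
by rewrite ge0_ler_powR ?nnegrE ?f0 ?(le_trans (normr_ge0 _) (fM x))//
  (le_trans (ler_norm _)).
Qed.

Lemma bmf_sqrt f : bmf f -> bmf (fun x => Num.sqrt (f x)).
Proof.
move=> [mf [M fM]]; split.
  apply: measurableT_comp => //; apply: continuous_measurable_fun.
  exact: sqrt_continuous.
exists (Num.sqrt M) => x; rewrite ger0_norm ?sqrtr_ge0// ler_wsqrtr//.
by rewrite (le_trans (ler_norm _)).
Qed.

End BoundedMeasurable.

Lemma bmf_comp d1 d2 (T1 : measurableType d1) (T2 : measurableType d2)
  (R : realType) (f : T2 -> R) (phi : T1 -> T2) :
  measurable_fun setT phi -> bmf f -> bmf (fun x => f (phi x)).
Proof.
move=> mphi [mf [M fM]]; split; last by exists M.
exact: (measurableT_comp mf mphi).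
Qed.

(** * Integrals of bounded functions over a set of finite measure *)

Section Expectation.
Context d (T : measurableType d) (R : realType)
  (mu : {measure set T -> \bar R}) (D : set T).
Hypotheses (mD : measurable D) (fD : (mu D < +oo)%E).
Implicit Types f g h : T -> R.

Local Notation E f := (Rintegral mu D f).

Lemma bmf_integrable f : bmf f -> mu.-integrable D (EFin \o f).
Proof.
move=> [mf [M fM]]; apply: measurable_bounded_integrable => //.
  exact: measurable_funTS.
exists M; split; first exact: num_real.
by move=> x Mx y _; exact: le_trans (fM y) (ltW Mx).
Qed.

Lemma EFin_expect f : bmf f -> (\int[mu]_(x in D) (f x)%:E)%E = (E f)%:E.
Proof.
move=> bf; rewrite /Rintegral fineK//.
exact: (integrable_fin_num mD (bmf_integrable bf)).
Qed.

Lemma expectD f g : bmf f -> bmf g -> E (fun x => f x + g x) = E f + E g.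
Proof. by move=> bf bg; rewrite RintegralD//; exact: bmf_integrable. Qed.

Lemma expectB f g : bmf f -> bmf g -> E (fun x => f x - g x) = E f - E g.
Proof. by move=> bf bg; rewrite RintegralB//; exact: bmf_integrable. Qed.

Lemma expectZl (c : R) f : bmf f -> E (fun x => c * f x) = c * E f.
Proof. by move=> bf; rewrite RintegralZl//; exact: bmf_integrable. Qed.

Lemma expectN f : bmf f -> E (fun x => - f x) = - E f.
Proof.
move=> bf; rewrite -mulN1r -expectZl//.
by congr Rintegral; apply/funext => x; rewrite mulN1r.
Qed.

Lemma expect_cst (c : R) : E (fun=> c) = c * fine (mu D).
Proof. exact: Rintegral_cst. Qed.

Lemma expect_sum (I : Type) (s : seq I) (P : pred I) (F : I -> T -> R) :
  (forall i, P i -> bmf (F i)) ->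
  E (fun x => \sum_(i <- s | P i) F i x) = \sum_(i <- s | P i) E (F i).
Proof.
move=> bF; elim: s => [|i s ih].
  rewrite big_nil; under [in LHS]eq_fun do rewrite big_nil.
  by rewrite expect_cst mul0r.
rewrite big_cons -ih; case Pi: (P i).
  under [in LHS]eq_fun do rewrite big_cons Pi.
  by rewrite expectD//; [exact: bF | exact: bmf_sum].
by under [in LHS]eq_fun do rewrite big_cons Pi.
Qed.

Lemma le_expect f g : bmf f -> bmf g -> (forall x, D x -> f x <= g x) ->
  E f <= E g.
Proof. by move=> bf bg fg; apply: le_Rintegral => //; exact: bmf_integrable. Qed.

Lemma expect_ge0 f : (forall x, D x -> 0 <= f x) -> 0 <= E f.
Proof. exact: Rintegral_ge0. Qed.

Lemma eq_expect f g : (forall x, D x -> f x = g x) -> E f = E g.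
Proof. by move=> fg; apply: eq_Rintegral => x /set_mem /fg. Qed.

Lemma norm_expect f : bmf f -> `|E f| <= E (fun x => `|f x|).
Proof. by move=> bf; apply: le_normr_Rintegral => //; exact: bmf_integrable. Qed.

End Expectation.

(** * Partial integrals and Tonelli's theorem for bounded functions *)

Section Fubini.
Context d1 d2 (T1 : measurableType d1) (T2 : measurableType d2) (R : realType)
  (m1 : {sigma_finite_measure set T1 -> \bar R})
  (m2 : {sigma_finite_measure set T2 -> \bar R})
  (D1 : set T1) (D2 : set T2).
Hypotheses (mD1 : measurable D1) (fD1 : (m1 D1 < +oo)%E).
Hypotheses (mD2 : measurable D2) (fD2 : (m2 D2 < +oo)%E).

Lemma bmf_pair1 (f : T1 * T2 -> R) x : bmf f -> bmf (fun y => f (x, y)).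
Proof. by apply: bmf_comp; exact: pair1_measurable. Qed.

Lemma bmf_pair2 (f : T1 * T2 -> R) y : bmf f -> bmf (fun x => f (x, y)).
Proof. by apply: bmf_comp; exact: pair2_measurable. Qed.

Lemma bmf_expect2 (f : T1 * T2 -> R) : bmf f ->
  bmf (fun x => Rintegral m2 D2 (fun y => f (x, y))).
Proof.
move=> bf; have [M [M0 fM]] := bmf_bound bf; split; last first.
  exists (M * fine (m2 D2)) => x; have bfx := bmf_pair1 x bf.
  rewrite (le_trans (norm_expect _ _ _))// -expect_cst//.
  by apply: le_expect => //; [exact: bmf_norm|exact: bmf_cst].
(* Adding the bound [M] makes the integrand nonnegative, so that Tonelli's theorem yields
   measurability in [x]; the added constant is subtracted afterwards. *)
have -> : (fun x => Rintegral m2 D2 (fun y => f (x, y))) =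
  fun x => fine (\int[m2]_y (((f (x, y) + M) * \1_D2 y)%:E)) - M * fine (m2 D2).
  apply/funext => x; have bfx := bmf_pair1 x bf.
  rewrite -[LHS](addrK (M * fine (m2 D2))) -expect_cst// -expectD//; last first.
    exact: bmf_cst.
  congr (_ - _); rewrite /Rintegral integral_mkcond; congr fine.
  apply: eq_integral => y _; rewrite patchE indicE.
  by case: ifP => _; rewrite ?mulr1 ?mulr0.
apply: measurable_funB; last exact: measurable_cst.
apply: (measurableT_comp (@fine_measurable R setT measurableT)) => //.
apply: (@measurable_fun_fubini_tonelli_F _ _ _ _ _ m2
  (fun z : T1 * T2 => ((f z + M) * \1_D2 z.2)%:E)).
  apply/measurable_EFinP; apply: measurable_funM.
    by apply: measurable_funD => //; exact: (proj1 bf).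
  exact: (measurableT_comp (measurable_indic mD2) measurable_snd).
move=> z; rewrite lee_fin mulr_ge0// -lerBlDr sub0r.
by have := fM z; rewrite ler_norml => /andP[].
Qed.

Lemma expect_swap (f : T1 * T2 -> R) : (forall z, 0 <= f z) -> bmf f ->
  Rintegral m1 D1 (fun x => Rintegral m2 D2 (fun y => f (x, y))) =
  Rintegral m2 D2 (fun y => Rintegral m1 D1 (fun x => f (x, y))).
Proof.
move=> f0 bf; rewrite {1 3}/Rintegral; congr fine.
pose g (z : T1 * T2) := (f z * (\1_D1 z.1 * \1_D2 z.2))%:E.
have g0 z : (0 <= g z)%E by rewrite lee_fin !mulr_ge0.
have mg : measurable_fun setT g.
  apply/measurable_EFinP/measurable_funM; first by have [] := bf.
  apply: measurable_funM.
    exact: (measurableT_comp (measurable_indic mD1) measurable_fst).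
  exact: (measurableT_comp (measurable_indic mD2) measurable_snd).
transitivity (\int[m1]_x \int[m2]_y g (x, y))%E.
  rewrite integral_mkcond; apply: eq_integral => x _; rewrite patchE.
  case: ifPn => xD; last first.
    rewrite integral0_eq// => y _.
    by rewrite /g indicE/= (negbTE xD) mul0r mulr0.
  rewrite -(@EFin_expect _ _ _ m2)//; last exact: bmf_pair1.
  rewrite integral_mkcond; apply: eq_integral => y _; rewrite patchE.
  by rewrite /g !indicE/= xD mul1r; case: ifP => _; rewrite ?mulr1 ?mulr0.
rewrite (fubini_tonelli _ mg g0).
rewrite [RHS]integral_mkcond; apply: eq_integral => y _; rewrite patchE.
case: ifPn => yD; last first.
  rewrite integral0_eq// => x _.
  by rewrite /g indicE/= indicE (negbTE yD) !mulr0.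
rewrite -(@EFin_expect _ _ _ m1)//; last exact: bmf_pair2.
rewrite [RHS]integral_mkcond; apply: eq_integral => x _; rewrite patchE.
by rewrite /g !indicE/= yD mulr1; case: ifP => _; rewrite ?mulr1 ?mulr0.
Qed.

End Fubini.

Local Notation nc := Normc.normc.

(** * The modulus of complex numbers and the Cauchy-Schwarz inequality *)

Section ComplexNorm.
Context {R : realType}.
Implicit Types (z w : R[i]) (a b : R).

Lemma nc_ge0 z : 0 <= nc z.
Proof. by case: z => a b; exact: sqrtr_ge0. Qed.

Lemma sqr_nc z : nc z ^+ 2 = complex.Re z ^+ 2 + complex.Im z ^+ 2.
Proof. by case: z => a b /=; rewrite sqr_sqrtr// addr_ge0// sqr_ge0. Qed.

Lemma mul_conjc z : z * conjc z = (nc z ^+ 2)%:C.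
Proof.
by rewrite sqr_nc; case: z => a b; apply/eqP; rewrite eq_complex /=;
  apply/andP; split; apply/eqP; ring.
Qed.

Lemma nc_conjc z : nc (conjc z) = nc z.
Proof. by case: z => a b /=; rewrite sqrrN. Qed.

Lemma nc_real a : nc a%:C = `|a|.
Proof. by rewrite /= expr0n/= addr0 sqrtr_sqr. Qed.

Lemma Re_le_nc z : `|complex.Re z| <= nc z.
Proof.
by case: z => a b /=; rewrite -sqrtr_sqr ler_wsqrtr// lerDl sqr_ge0.
Qed.

Lemma Im_le_nc z : `|complex.Im z| <= nc z.
Proof.
by case: z => a b /=; rewrite -sqrtr_sqr ler_wsqrtr// lerDr sqr_ge0.
Qed.

Lemma nc_sum (I : Type) (s : seq I) (P : pred I) (F : I -> R[i]) :
  nc (\sum_(i <- s | P i) F i) <= \sum_(i <- s | P i) nc (F i).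
Proof.
elim/big_ind2: _ => [|x1 x2 y1 y2 h1 h2|//]; first by rewrite Normc.normc0.
by rewrite (le_trans (le_normcD _ _))// lerD.
Qed.

Lemma ReD z w : complex.Re (z + w) = complex.Re z + complex.Re w.
Proof. by case: z w => [a b] [c d]. Qed.

Lemma ImD z w : complex.Im (z + w) = complex.Im z + complex.Im w.
Proof. by case: z w => [a b] [c d]. Qed.

Lemma ReM z w :
  complex.Re (z * w) = complex.Re z * complex.Re w - complex.Im z * complex.Im w.
Proof. by case: z w => [a b] [c d]. Qed.

Lemma ImM z w :
  complex.Im (z * w) = complex.Re z * complex.Im w + complex.Im z * complex.Re w.
Proof. by case: z w => [a b] [c d]. Qed.

Lemma Re_conjc z : complex.Re (conjc z) = complex.Re z.
Proof. by case: z. Qed.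

Lemma Im_conjc z : complex.Im (conjc z) = - complex.Im z.
Proof. by case: z. Qed.

Lemma conjcD z w : conjc (z + w) = conjc z + conjc w.
Proof. exact: rmorphD. Qed.

Lemma conjcM z w : conjc (z * w) = conjc z * conjc w.
Proof. exact: rmorphM. Qed.

Lemma conjc_sum (I : Type) (s : seq I) (P : pred I) (F : I -> R[i]) :
  conjc (\sum_(i <- s | P i) F i) = \sum_(i <- s | P i) conjc (F i).
Proof. exact: rmorph_sum. Qed.

Lemma realcM a b : (a * b)%:C = a%:C * b%:C.
Proof. exact: rmorphM. Qed.

Lemma complex_ext z w : complex.Re z = complex.Re w ->
  complex.Im z = complex.Im w -> z = w.
Proof. by case: z w => [a b] [c d] /= -> ->. Qed.

Lemma exists_phase z : exists c : R[i], nc c = 1 /\ c * z = (nc z)%:C.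
Proof.
have [->|z0] := eqVneq z 0.
  by exists 1; rewrite Normc.normc1 mul1r Normc.normc0.
have n0 : nc z != 0 by apply/eqP => /Normc.eq0_normc/eqP; apply/negP.
exists (conjc z * ((nc z)^-1)%:C); split.
  by rewrite Normc.normcM nc_conjc nc_real ger0_norm ?invr_ge0 ?nc_ge0// divff.
by rewrite mulrAC [_ * z]mulrC mul_conjc -rmorphM/= expr2 mulfK.
Qed.

Lemma cisD a b : cis (a + b) = cis a * cis b.
Proof.
by apply: complex_ext; rewrite ?ReM ?ImM /= ?cosD ?sinD//; ring.
Qed.

Lemma cisN a : cis (- a) = conjc (cis a).
Proof. by rewrite /cis cosN sinN. Qed.

Lemma cis0 : cis 0 = 1 :> R[i].
Proof. by rewrite /cis cos0 sin0. Qed.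

Lemma sum_sqr_nc (I : Type) (s : seq I) (F : I -> R[i]) :
  \sum_(i <- s) F i * conjc (F i) = (\sum_(i <- s) nc (F i) ^+ 2)%:C.
Proof. by rewrite rmorph_sum; apply: eq_bigr => i _; rewrite mul_conjc. Qed.

Lemma cauchy_schwarz_sum (I : Type) (s : seq I) (a b : I -> R) :
  (\sum_(i <- s) a i * b i) ^+ 2 <=
  (\sum_(i <- s) a i ^+ 2) * (\sum_(i <- s) b i ^+ 2).
Proof.
set A := \sum_(i <- s) a i ^+ 2; set B := \sum_(i <- s) b i ^+ 2.
set X := \sum_(i <- s) a i * b i.
have A0 : 0 <= A by apply: sumr_ge0 => i _; exact: sqr_ge0.
have B0 : 0 <= B by apply: sumr_ge0 => i _; exact: sqr_ge0.
have quad t : 0 <= A - 2 * t * X + t ^+ 2 * B.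
  suff <- : \sum_(i <- s) (a i - t * b i) ^+ 2 = A - 2 * t * X + t ^+ 2 * B.
    by apply: sumr_ge0 => i _; exact: sqr_ge0.
  rewrite /A /X /B !mulr_sumr -sumrN -!big_split/=.
  by apply: eq_bigr => i _; ring.
have [B_eq0|B_neq0] := eqVneq B 0.
  have [->|X0] := eqVneq X 0; first by rewrite expr0n/= mulr_ge0.
  (* With [B = 0] the quadratic is affine in [t], and at this [t] it equals [- 1]. *)
  have := quad ((A + 1) / (2 * X)).
  rewrite B_eq0 mulr0 addr0; have -> : 2 * ((A + 1) / (2 * X)) * X = A + 1.
    by field.
  by lra.
have Bp : 0 < B by rewrite lt_neqAle eq_sym B_neq0.
have := quad (X / B); have -> : A - 2 * (X / B) * X + (X / B) ^+ 2 * B =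
  (A * B - X ^+ 2) / B by field.
by rewrite pmulr_lge0 ?invr_gt0// subr_ge0.
Qed.

Lemma nc_cauchy_schwarz (I : Type) (s : seq I) (z w : I -> R[i]) :
  nc (\sum_(i <- s) z i * w i) ^+ 2 <=
  (\sum_(i <- s) nc (z i) ^+ 2) * (\sum_(i <- s) nc (w i) ^+ 2).
Proof.
apply: le_trans (cauchy_schwarz_sum _ _ _).
rewrite lerXn2r ?nnegrE ?nc_ge0//.
  by apply: sumr_ge0 => i _; rewrite mulr_ge0 ?nc_ge0.
rewrite (le_trans (nc_sum _ _ _))//.
by under eq_bigr do rewrite Normc.normcM.
Qed.

End ComplexNorm.

(** * Complex-valued bounded functions and their integrals *)

Section ComplexBounded.
Context d (T : measurableType d) (R : realType).
Implicit Types f g : T -> R[i].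

Definition cbm f :=
  bmf (fun x => complex.Re (f x)) /\ bmf (fun x => complex.Im (f x)).

Lemma eq_cbm f g : f =1 g -> cbm f -> cbm g.
Proof. by move=> /funext ->. Qed.

Lemma cbm_cst (c : R[i]) : cbm (fun=> c).
Proof. by split; exact: bmf_cst. Qed.

Lemma cbmD f g : cbm f -> cbm g -> cbm (fun x => f x + g x).
Proof.
move=> [f1 f2] [g1 g2]; split.
  by apply: (eq_bmf _ (bmfD f1 g1)) => x; rewrite ReD.
by apply: (eq_bmf _ (bmfD f2 g2)) => x; rewrite ImD.
Qed.

Lemma cbmM f g : cbm f -> cbm g -> cbm (fun x => f x * g x).
Proof.
move=> [f1 f2] [g1 g2]; split.
  by apply: (eq_bmf _ (bmfB (bmfM f1 g1) (bmfM f2 g2))) => x; rewrite ReM.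
by apply: (eq_bmf _ (bmfD (bmfM f1 g2) (bmfM f2 g1))) => x; rewrite ImM.
Qed.

Lemma cbm_conj f : cbm f -> cbm (fun x => conjc (f x)).
Proof.
move=> [f1 f2]; split; first by apply: eq_bmf f1 => x; rewrite Re_conjc.
by apply: (eq_bmf _ (bmfN f2)) => x; rewrite Im_conjc.
Qed.

Lemma cbm_real (a : T -> R) : bmf a -> cbm (fun x => (a x)%:C).
Proof. by move=> ba; split => //=; exact: bmf_cst. Qed.

Lemma cbm_sum (I : Type) (s : seq I) (P : pred I) (F : I -> T -> R[i]) :
  (forall i, P i -> cbm (F i)) -> cbm (fun x => \sum_(i <- s | P i) F i x).
Proof.
move=> bF; elim: s => [|i s ih].
  by apply: (eq_cbm _ (cbm_cst 0)) => x; rewrite big_nil.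
case Pi: (P i).
  by apply: (eq_cbm _ (cbmD (bF i Pi) ih)) => x; rewrite big_cons Pi.
by apply: eq_cbm ih => x; rewrite big_cons Pi.
Qed.

Lemma bmf_nc f : cbm f -> bmf (fun x => nc (f x)).
Proof.
move=> [f1 f2].
apply: (eq_bmf _ (bmf_sqrt (bmfD (bmfX 2 f1) (bmfX 2 f2)))) => x.
by rewrite -sqr_nc sqrtr_sqr ger0_norm ?nc_ge0.
Qed.

Lemma cbm_ifT (b : T -> bool) f g : measurable_fun setT b ->
  cbm f -> cbm g -> cbm (fun x => if b x then f x else g x).
Proof.
move=> mb [f1 f2] [g1 g2]; split.
  by apply: (eq_bmf _ (bmf_ifT mb f1 g1)) => x; case: ifP.
by apply: (eq_bmf _ (bmf_ifT mb f2 g2)) => x; case: ifP.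
Qed.

End ComplexBounded.

Lemma cbm_comp d1 d2 (T1 : measurableType d1) (T2 : measurableType d2)
  (R : realType) (f : T2 -> R[i]) (phi : T1 -> T2) :
  measurable_fun setT phi -> cbm f -> cbm (fun x => f (phi x)).
Proof. by move=> mphi [f1 f2]; split; [exact: (bmf_comp mphi f1)|exact: (bmf_comp mphi f2)]. Qed.

Lemma cbm_cis d (T : measurableType d) (R : realType) (a : T -> R) :
  measurable_fun setT a -> cbm (fun x => cis (a x)).
Proof.
move=> ma; split; split; rewrite /cis/=.
- exact: (measurableT_comp (continuous_measurable_fun (@continuous_cos R)) ma).
- exists 1 => x; rewrite ler_norml cos_le1 andbT; exact: cos_geN1.
- exact: (measurableT_comp (continuous_measurable_fun (@continuous_sin R)) ma).
- exists 1 => x; rewrite ler_norml sin_le1 andbT; exact: sin_geN1.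
Qed.

Section ComplexExpectation.
Context d (T : measurableType d) (R : realType)
  (mu : {measure set T -> \bar R}) (D : set T).
Hypotheses (mD : measurable D) (fD : (mu D < +oo)%E).
Implicit Types f g : T -> R[i].

Definition cexpect f : R[i] :=
  Complex (Rintegral mu D (fun x => complex.Re (f x)))
          (Rintegral mu D (fun x => complex.Im (f x))).

Lemma eq_cexpect f g : (forall x, D x -> f x = g x) -> cexpect f = cexpect g.
Proof.
by move=> fg; congr Complex; apply: eq_expect => x /fg ->.
Qed.

Lemma cexpectD f g : cbm f -> cbm g ->
  cexpect (fun x => f x + g x) = cexpect f + cexpect g.
Proof.
move=> [f1 f2] [g1 g2]; apply: complex_ext; rewrite ?ReD ?ImD/=.
  by rewrite -expectD//; apply: eq_expect => x _; rewrite ReD.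
by rewrite -expectD//; apply: eq_expect => x _; rewrite ImD.
Qed.

Lemma cexpectZl (c : R[i]) f : cbm f ->
  cexpect (fun x => c * f x) = c * cexpect f.
Proof.
move=> [f1 f2]; apply: complex_ext; rewrite ?ReM ?ImM/=.
  rewrite -!expectZl// -expectB//; try (apply: bmfM => //; exact: bmf_cst).
  by apply: eq_expect => x _; rewrite ReM.
rewrite -!expectZl// -expectD//; try (apply: bmfM => //; exact: bmf_cst).
by apply: eq_expect => x _; rewrite ImM.
Qed.

Lemma cexpectZr (c : R[i]) f : cbm f ->
  cexpect (fun x => f x * c) = cexpect f * c.
Proof.
move=> bf; rewrite mulrC -cexpectZl//.
by apply: eq_cexpect => x _; rewrite mulrC.
Qed.

Lemma cexpect0 : cexpect (fun=> 0) = 0.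
Proof. by apply: complex_ext; rewrite /= expect_cst// mul0r. Qed.

Lemma cexpect_sum (I : Type) (s : seq I) (P : pred I) (F : I -> T -> R[i]) :
  (forall i, P i -> cbm (F i)) ->
  cexpect (fun x => \sum_(i <- s | P i) F i x) =
  \sum_(i <- s | P i) cexpect (F i).
Proof.
move=> bF; elim: s => [|i s ih].
  by rewrite big_nil -[RHS]cexpect0; apply: eq_cexpect => x _; rewrite big_nil.
rewrite big_cons -ih; case Pi: (P i).
  rewrite -cexpectD; [|exact: bF|exact: cbm_sum].
  by apply: eq_cexpect => x _; rewrite big_cons Pi.
by apply: eq_cexpect => x _; rewrite big_cons Pi.
Qed.

Lemma cexpect_conj f : cbm f ->
  cexpect (fun x => conjc (f x)) = conjc (cexpect f).
Proof.
move=> [f1 f2]; apply: complex_ext; rewrite ?Re_conjc ?Im_conjc/=.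
  by apply: eq_expect => x _; rewrite Re_conjc.
by rewrite -expectN//; apply: eq_expect => x _; rewrite Im_conjc.
Qed.

Lemma cexpect_real (a : T -> R) :
  cexpect (fun x => (a x)%:C) = (Rintegral mu D a)%:C.
Proof. by apply: complex_ext => //=; rewrite expect_cst// mul0r. Qed.

(** Multiplying [f] by a unimodular constant makes its integral real and nonnegative, hence equal to
    the integral of a real part, which is at most the modulus. *)
Lemma nc_cexpect f : cbm f ->
  nc (cexpect f) <= Rintegral mu D (fun x => nc (f x)).
Proof.
move=> bf; have [c [c1 cE]] := exists_phase (cexpect f).
have bcf : cbm (fun x => c * f x) by apply: cbmM => //; exact: cbm_cst.
have -> : nc (cexpect f) =
    Rintegral mu D (fun x => complex.Re (c * f x)).
  by have := cexpectZl c bf; rewrite cE => /(congr1 (@complex.Re R)) /= ->.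
apply: le_expect => //; [by case: bcf|exact: bmf_nc|move=> x _].
by rewrite (le_trans (ler_norm _))// (le_trans (Re_le_nc _))// Normc.normcM c1 mul1r.
Qed.

End ComplexExpectation.

Lemma cbm_cexpect2 d1 d2 (T1 : measurableType d1) (T2 : measurableType d2)
  (R : realType) (m2 : {sigma_finite_measure set T2 -> \bar R}) (D2 : set T2)
  (f : T1 * T2 -> R[i]) : measurable D2 -> (m2 D2 < +oo)%E -> cbm f ->
  cbm (fun x => cexpect m2 D2 (fun y => f (x, y))).
Proof.
move=> mD2 fD2 [f1 f2].
by split; [exact: (bmf_expect2 mD2 fD2 f1)|exact: (bmf_expect2 mD2 fD2 f2)].
Qed.

(** * Weyl sums *)

Section WeylSum.
Context {R : realType}.
Implicit Types (t x : R).

(** This is [1 / (cis (2 psi) - 1) = - 1 / 2 - (i / 2) cot psi]. Its real part is constant, so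
    differences of two values only involve the cotangent. *)
Definition cot2 (psi : R) : R[i] :=
  Complex (- 2^-1) (- (cos psi / sin psi / 2)).

Lemma cot2_invB (psi : R) : sin psi != 0 -> (cis (2 * psi) - 1) * cot2 psi = 1.
Proof.
move=> s0; have c2 := cos2Dsin2 psi.
have cE : cos (2 * psi) = 1 - 2 * sin psi ^+ 2.
  by rewrite mulrC mulr_natr cos_mulr2n; lra.
have sE : sin (2 * psi) = 2 * (cos psi * sin psi).
  by rewrite mulrC mulr_natr sin_mulr2n mulr_natl.
apply: complex_ext; rewrite ?ReM ?ImM /= cE sE; last by field.
rewrite -[RHS]c2; by field.
Qed.

Lemma abs_cot_le (psi s : R) : 0 < s -> s <= `|sin psi| ->
  `|cos psi / sin psi| <= s^-1.
Proof.
move=> s0 sp; rewrite normrM normfV -[leRHS]mul1r.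
by rewrite ler_pM ?invr_ge0 ?cos_max// lef_pV2 ?posrE// (lt_le_trans s0).
Qed.

Lemma nc_cot2_le (psi s : R) : 0 < s -> s <= `|sin psi| ->
  nc (cot2 psi) <= s^-1 / 2.
Proof.
move=> s0 sp; have sp0 : sin psi != 0 by rewrite -normr_gt0 (lt_le_trans s0).
rewrite -(@ler_pXn2r _ 2)// ?nnegrE ?nc_ge0//; last first.
  by rewrite divr_ge0// invr_ge0 ltW.
rewrite sqr_nc/=.
have -> : (- 2^-1) ^+ 2 + (- (cos psi / sin psi / 2)) ^+ 2 =
   ((sin psi ^+ 2)^-1 / 4 : R).
  transitivity ((cos psi ^+ 2 + sin psi ^+ 2) / (4 * sin psi ^+ 2)).
    by field.
  by rewrite cos2Dsin2; field.
have -> : (s^-1 / 2) ^+ 2 = (s ^+ 2)^-1 / 4 :> R.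
  by field; rewrite gt_eqF.
rewrite ler_pM2r ?invr_gt0// lef_pV2 ?posrE; last 2 first.
- by rewrite exprn_even_gt0// sp0 orbT.
- by rewrite exprn_gt0.
by rewrite -[leRHS]real_normK ?num_real// lerXn2r// nnegrE ltW.
Qed.

Lemma cotB (a b : R) : sin a != 0 -> sin b != 0 ->
  cos a / sin a - cos b / sin b = sin (b - a) / (sin a * sin b).
Proof. by move=> a0 b0; rewrite sinB; field; apply/andP; split. Qed.

(* Kusmin-Landau: [cis (phi j) = cot2 (psi j) (cis (phi j.+1) - cis (phi j))],
   and summation by parts leaves the total variation of the monotone sequence
   [cot (psi j)]. *)
Lemma kusmin_landau (phi psi : nat -> R) (m n : nat) (s : R) : 0 < s ->
  (forall j, (m <= j < n)%N -> phi j.+1 - phi j = 2 * psi j) ->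
  (forall j, (m <= j < n)%N -> s <= `|sin (psi j)|) ->
  (forall j, (m <= j)%N -> (j.+1 < n)%N ->
     cos (psi j.+1) / sin (psi j.+1) <= cos (psi j) / sin (psi j)) ->
  nc (\sum_(m <= j < n) cis (phi j)) <= 2 / s.
Proof.
move=> s0; have s20 : 0 <= 2 / s by rewrite divr_ge0// ltW.
case: (leqP n m) => [nm _ _ _|mn].
  by rewrite big_geq// Normc.normc0.
case: n mn => // n; rewrite ltnS => mn hphi hsin hmono.
pose k j := cos (psi j) / sin (psi j).
have cisE j : (m <= j < n.+1)%N ->
    cis (phi j) = cot2 (psi j) * (cis (phi j.+1) - cis (phi j)).
  move=> jmn; have := hsin j jmn => sj.
  have sj0 : sin (psi j) != 0 by rewrite -normr_gt0 (lt_le_trans s0).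
  have -> : phi j.+1 = phi j + 2 * psi j by rewrite -hphi//; ring.
  rewrite cisD -[in X in _ = _ * (_ - X)](mulr1 (cis (phi j))) -mulrBr mulrCA.
  by rewrite [cot2 _ * _]mulrC cot2_invB// mulr1.
have inv i : (m <= i <= n)%N ->
    nc (\sum_(m <= j < i.+1) cis (phi j) - cot2 (psi i) * cis (phi i.+1)) <=
    s^-1 / 2 + (k m - k i) / 2.
  elim: i => [|i ih].
    rewrite leqn0 => /andP[/eqP m0 _]; rewrite m0 big_nat1.
    rewrite {1}cisE ?m0// subrr mul0r addr0.
    have -> : cot2 (psi 0%N) * (cis (phi 1%N) - cis (phi 0%N)) -
       cot2 (psi 0%N) * cis (phi 1%N) = - (cot2 (psi 0%N) * cis (phi 0%N)) by ring.
    rewrite normcN Normc.normcM normc_cis mulr1 nc_cot2_le// hsin// m0//.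
  move=> /andP[]; rewrite leq_eqVlt => /predU1P[mi _|].
    rewrite mi big_nat1.
    rewrite {1}cisE ?leqnn ?ltnS ?mi//; last by rewrite -mi leqnn.
    rewrite subrr mul0r addr0.
    have -> : cot2 (psi i.+1) * (cis (phi i.+2) - cis (phi i.+1)) -
       cot2 (psi i.+1) * cis (phi i.+2) = - (cot2 (psi i.+1) * cis (phi i.+1)) by ring.
    by rewrite normcN Normc.normcM normc_cis mulr1 nc_cot2_le// hsin// -mi leqnn.
  rewrite ltnS => mi iN.
  have mi1 : (m <= i.+1)%N by rewrite ltnW.
  rewrite big_nat_recr//= {1}(cisE i.+1); last by rewrite mi1 ltnS.
  have -> : \sum_(m <= j < i.+1) cis (phi j) +
      cot2 (psi i.+1) * (cis (phi i.+2) - cis (phi i.+1)) -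
      cot2 (psi i.+1) * cis (phi i.+2) =
    (\sum_(m <= j < i.+1) cis (phi j) - cot2 (psi i) * cis (phi i.+1)) +
    (cot2 (psi i) - cot2 (psi i.+1)) * cis (phi i.+1) by ring.
  rewrite (le_trans (le_normcD _ _))//.
  have -> : s^-1 / 2 + (k m - k i.+1) / 2 =
    s^-1 / 2 + (k m - k i) / 2 + (k i - k i.+1) / 2 :> R by ring.
  rewrite lerD//; first by apply: ih; rewrite mi ltnW.
  rewrite Normc.normcM normc_cis mulr1.
  have -> : cot2 (psi i) - cot2 (psi i.+1) = Complex 0 ((k i.+1 - k i) / 2).
    by apply: complex_ext => /=; rewrite /k; ring.
  rewrite /= expr0n/= add0r sqrtr_sqr ler0_norm.
    by rewrite -mulNr opprB.
  have := hmono i mi; rewrite ltnS => /(_ iN); rewrite -/(k i.+1) -/(k i); lra.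
have -> : \sum_(m <= j < n.+1) cis (phi j) =
  (\sum_(m <= j < n.+1) cis (phi j) - cot2 (psi n) * cis (phi n.+1)) +
  cot2 (psi n) * cis (phi n.+1) by rewrite subrK.
rewrite (le_trans (le_normcD _ _))// Normc.normcM normc_cis mulr1.
(* The two boundary terms cost [1 / (2 s)] each, and [|k m|, |k n| <= 1 / s] bound the variation
   [(k m - k n) / 2] by [1 / s]. *)
have hm : `|k m| <= s^-1 by apply: abs_cot_le => //; rewrite hsin// leqnn ltnS.
have hn : `|k n| <= s^-1 by apply: abs_cot_le => //; rewrite hsin// mn ltnS leqnn.
have hc : nc (cot2 (psi n)) <= s^-1 / 2.
  by apply: nc_cot2_le => //; rewrite hsin// mn ltnS leqnn.
have := inv n; rewrite mn leqnn => /(_ isT).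
move: hm hn; rewrite !ler_norml => /andP[_ h1] /andP[h2 _] h3.
rewrite (_ : 2 / s = s^-1 * 2); last by rewrite mulrC.
by lra.
Qed.

Lemma cis_2pi_nat (n : nat) : cis (2 * pi * n%:R) = 1 :> R[i].
Proof.
elim: n => [|n ih]; first by rewrite mulr0 cis0.
rewrite -[n.+1%:R]natr1 mulrDr cisD ih mul1r mulr1.
by rewrite /cis mulrC mulr_natr cos2pi sin2pi.
Qed.

Lemma cis_2pi_int (k : int) : cis (2 * pi * k%:~R) = 1 :> R[i].
Proof.
case: k => n; first exact: cis_2pi_nat.
by rewrite NegzE mulrNz mulrN cisN cis_2pi_nat conjc1.
Qed.

Lemma sin_ge_linear (y : R) : 0 <= y <= 1 -> cos 1 * y <= sin y.
Proof.
move=> /andP[y0 y1].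
have sin_cont : {within `[0, y], continuous (@sin R)}.
  by apply: continuous_subspaceT => z; exact: continuous_sin.
have [c] := @MVT_segment R (@sin R) (@cos R) 0 y y0
  (fun z _ => is_derive_sin z) sin_cont.
rewrite in_itv/= => /andP[c0 cy]; rewrite sin0 !subr0 => ->.
rewrite ler_wpM2r//; have [->|c1] := eqVneq c 1; first exact: lexx.
have pi2 := pi_ge2 R.
apply: ltW; rewrite ltr_cos ?in_itv/=; last 2 first.
- by apply/andP; split => //; lra.
- by apply/andP; split; lra.
by rewrite lt_neqAle c1; lra.
Qed.

(** Up to [pi / 2] the sine is increasing and lies above the chord bound [cos 1 * eta]; beyond it,
    [sin psi = cos (psi - pi / 2)] is still at least [cos 1]. The margin [1] past [pi / 2] is what
    the condition [t * M <= 1] will consume. *)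
Lemma sin_lower_bound (eta psi : R) : 0 < eta <= 1 -> eta <= psi ->
  psi <= pi / 2 + 1 -> cos 1 * eta <= sin psi.
Proof.
move=> /andP[e0 e1] epsi psi1.
have pi2 := pi_ge2 R.
have [hpsi|hpsi] := leP psi (pi / 2).
  rewrite (le_trans (sin_ge_linear _)) ?e1 ?(ltW e0)//.
  have [->|ne] := eqVneq eta psi; first exact: lexx.
  apply: ltW; rewrite ltr_sin ?in_itv/=; last 2 first.
  - by apply/andP; split; lra.
  - by apply/andP; split; lra.
  by rewrite lt_neqAle ne.
rewrite -cosBpihalf.
have c1 := @cos1_gt0 R; rewrite (@le_trans _ _ (cos 1))//.
  by rewrite -[leRHS]mulr1 ler_wpM2l// ltW.
have [->|ne] := eqVneq (psi - pi / 2) 1; first exact: lexx.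
apply: ltW; rewrite ltr_cos ?in_itv/=; last 2 first.
- by apply/andP; split; lra.
- by apply/andP; split; lra.
by rewrite lt_neqAle ne; lra.
Qed.

Lemma monotone_split (P : pred nat) (M : nat) :
  (forall j, P j -> P j.+1) ->
  exists2 a, (a <= M)%N & forall j, (j < M)%N -> P j = (a <= j)%N.
Proof.
move=> Pm; elim: M => [|M [a aM ih]]; first by exists 0%N.
have [PM|PM] := boolP (P M); last first.
  exists M.+1 => // j jM; rewrite leqNgt jM/=; apply/negbTE.
  apply: contra PM => Pj; rewrite ltnS in jM.
  by rewrite -(subnKC jM); elim: (M - j)%N => [|i hi]; rewrite ?addn0// addnS Pm.
exists a; first exact: leqW.
by move=> j; rewrite ltnS leq_eqVlt => /predU1P[->|/ih//]; rewrite PM aM.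
Qed.

(** Two Kusmin-Landau ranges contribute [2 / cos 1] each, the stationary range in between
    contributes [3]. *)
Definition weyl_const : R := 4 / cos 1 + 3.

Lemma weyl_const_ge0 : 0 <= weyl_const.
Proof. by rewrite addr_ge0// divr_ge0// ltW// cos1_gt0. Qed.

Lemma weyl_sum_reduced t x (M : nat) : 0 < t -> t * M%:R <= 1 ->
  - pi <= x <= pi ->
  nc (\sum_(0 <= j < M) cis (j%:R * x + t * j%:R ^+ 2)) <=
  weyl_const / Num.sqrt t.
Proof.
move=> t0 tM /andP[x1 x2].
have eta0 : 0 < Num.sqrt t by rewrite sqrtr_gt0.
case: M tM => [|M] tM.
  by rewrite big_geq// Normc.normc0 divr_ge0// ?weyl_const_ge0// ltW.
have t1 : t <= 1.
  by apply: le_trans tM; rewrite -[leLHS]mulr1 ler_wpM2l// ?ler1n// ltW.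
set eta := Num.sqrt t in eta0 *.
have tE : t = eta ^+ 2 by rewrite sqr_sqrtr// ltW.
have eta1 : eta <= 1 by rewrite -sqrtr1 ler_wsqrtr.
pose psi (j : nat) := x / 2 + t * (j%:R + 2^-1).
pose phi (j : nat) := j%:R * x + t * j%:R ^+ 2.
have psiS j : psi j.+1 = psi j + t by rewrite /psi -natr1; ring.
have phiE j : phi j.+1 - phi j = 2 * psi j.
  by rewrite /phi /psi -natr1; field.
have psilt i j : (i <= j)%N -> psi i <= psi j.
  by move=> ij; rewrite lerD2l ler_wpM2l ?(ltW t0)// lerD2r ler_nat.
have psi_lb j : - (pi / 2) <= psi j.
  have : 0 <= t * (j%:R + 2^-1) by rewrite mulr_ge0 ?addr_ge0// ltW.
  by rewrite /psi; lra.
have psi_ub j : (j < M.+1)%N -> psi j <= pi / 2 + 1.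
  move=> jM; have : t * (j%:R + 2^-1) <= 1.
    apply: le_trans tM; rewrite ler_wpM2l ?(ltW t0)//.
    have : (j%:R + 1 <= M.+1%:R :> R) by rewrite natr1 ler_nat.
    lra.
  by rewrite /psi; lra.
have [a aM ha] := @monotone_split (fun j => - eta < psi j) M.+1
  (fun j h => lt_le_trans h (psilt _ _ (leqnSn j))).
have [b bM hb] := @monotone_split (fun j => eta <= psi j) M.+1
  (fun j h => le_trans h (psilt _ _ (leqnSn j))).
have ab : (a <= b)%N.
  rewrite leqNgt; apply/negP => ba; have bM' := leq_trans ba aM.
  have /esym := hb b bM'; rewrite leqnn => eb.
  have := ha b bM'; rewrite leqNgt ba/= => /negbT; rewrite -leNgt => eb'.
  by move: eb; lra.
rewrite (@big_cat_nat _ _ _ a)//= (@big_cat_nat _ _ _ b a)//=.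
have c1 := @cos1_gt0 R; have sig0 : 0 < cos 1 * eta by rewrite mulr_gt0.
have cot_mono i : 0 < sin (psi i) * sin (psi i.+1) ->
    cos (psi i.+1) / sin (psi i.+1) <= cos (psi i) / sin (psi i).
  move=> sp; have := sp; rewrite lt0r mulf_eq0 negb_or => /andP[/andP[s1 s2] _].
  rewrite -subr_ge0 cotB// psiS addrAC subrr add0r divr_ge0 ?(ltW sp)//.
    by rewrite sin_ge0_pi// ltW//= (le_trans t1)// (le_trans _ (pi_ge2 R))// ler1n.
  by move: sp; rewrite psiS => /ltW.
have S1 : nc (\sum_(0 <= j < a) cis (phi j)) <= 2 / (cos 1 * eta).
  have neg j : (j < a)%N -> cos 1 * eta <= - sin (psi j).
    move=> ja; have := ha j (leq_trans ja aM); rewrite leqNgt ja/= => /negbT.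
    rewrite -leNgt => pj; rewrite -sinN; apply: sin_lower_bound.
    - by rewrite eta0.
    - lra.
    - have := psi_lb j; lra.
  apply: (@kusmin_landau _ psi) => // j.
  - by move=> /= ja; rewrite -normrN (le_trans (neg j ja))// ler_norm.
  - move=> _ ja; apply: cot_mono.
    rewrite -mulrNN mulr_gt0// (lt_le_trans sig0)// neg//.
    exact: ltnW.
have S3 : nc (\sum_(b <= j < M.+1) cis (phi j)) <= 2 / (cos 1 * eta).
  have pos j : (b <= j)%N -> (j < M.+1)%N -> cos 1 * eta <= sin (psi j).
    move=> bj jM; apply: sin_lower_bound; first by rewrite eta0.
      by rewrite hb.
    exact: psi_ub.
  apply: (@kusmin_landau _ psi) => // j.
  - by move=> /andP[bj jM]; rewrite (le_trans (pos j bj jM))// ler_norm.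
  - move=> bj jM; apply: cot_mono.
    by rewrite mulr_gt0// (lt_le_trans sig0)// pos// ltnW.
(* The values [psi a] and [psi b.-1] differ by less than [2 eta], that is [t (b - a) - t < 2 eta];
   with [t <= eta] this leaves at most [3 / eta] terms. *)
have S2 : nc (\sum_(a <= j < b) cis (phi j)) <= 3 / eta.
  rewrite (le_trans (nc_sum _ _ _))//.
  under eq_bigr do rewrite normc_cis.
  rewrite sumr_const_nat.
  case: (ltnP a b) => [lab|]; last first.
    by rewrite -subn_eq0 => /eqP ->; rewrite mulr0n divr_ge0// ltW.
  have aM1 : (a < M.+1)%N := leq_trans lab bM.
  have pa : - eta < psi a by rewrite ha.
  have pb : psi b.-1 < eta.
    have bb : (b.-1 < b)%N by rewrite prednK// (leq_ltn_trans _ lab).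
    by rewrite ltNge hb ?(leq_trans bb)// -ltnNge.
  have dE : psi b.-1 - psi a = t * (b - a)%:R - t.
    rewrite /psi natrB// -{2}(prednK (leq_ltn_trans (leq0n a) lab)) -natr1; ring.
  have : t * (b - a)%:R <= 3 * eta.
    have : t <= eta by rewrite tE expr2 -[leRHS]mulr1 ler_wpM2l// ltW.
    lra.
  rewrite {1}tE ler_pdivlMr//.
  rewrite expr2 -mulrA mulrC ler_pM2r// [eta * _]mulrC.
  by [].
have -> : weyl_const / eta = 2 / (cos 1 * eta) + (3 / eta + 2 / (cos 1 * eta)).
  by rewrite /weyl_const; field; rewrite !gt_eqF.
by rewrite (le_trans (le_normcD _ _))// lerD// (le_trans (le_normcD _ _))// lerD.
Qed.

(** The frequencies [j] are integers, so [x] only matters modulo [2 pi]. *)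
Lemma weyl_sum_pos t x (M : nat) : 0 < t -> t * M%:R <= 1 ->
  nc (\sum_(0 <= j < M) cis (j%:R * x + t * j%:R ^+ 2)) <=
  weyl_const / Num.sqrt t.
Proof.
move=> t0 tM; have pi0 := pi_gt0 R.
pose k : int := Num.floor ((x + pi) / (2 * pi)).
pose y := x - 2 * pi * k%:~R.
have -> : \sum_(0 <= j < M) cis (j%:R * x + t * j%:R ^+ 2) =
          \sum_(0 <= j < M) cis (j%:R * y + t * j%:R ^+ 2).
  apply: eq_bigr => j _.
  rewrite -[RHS]mulr1 -(cis_2pi_int (k * j%:Z)) -cisD; congr cis.
  by rewrite /y intrM; ring.
apply: weyl_sum_reduced => //.
have := floor_le_tmp ((x + pi) / (2 * pi)); rewrite -/k.
have := floorD1_gt ((x + pi) / (2 * pi)); rewrite -/k.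
have p20 : 0 < 2 * pi :> R by rewrite mulr_gt0.
rewrite ltr_pdivrMr// ler_pdivlMr// intrD mulrDl mul1r => h1 h2.
by rewrite /y; apply/andP; split; lra.
Qed.

(** Complex conjugation exchanges the two signs of [t]. *)
Lemma weyl_sum t x (M : nat) : t != 0 -> `|t| * M%:R <= 1 ->
  nc (\sum_(0 <= j < M) cis (j%:R * x + t * j%:R ^+ 2)) <=
  weyl_const / Num.sqrt `|t|.
Proof.
move=> t0 tM; have [tp|tn] := ltP 0 t.
  by rewrite gtr0_norm// in tM *; exact: weyl_sum_pos.
have {}tn : t < 0 by rewrite lt_neqAle t0.
rewrite ltr0_norm// in tM *.
have := @weyl_sum_pos (- t) (- x) M _ tM; rewrite oppr_gt0 => /(_ tn).
apply: le_trans; rewrite -nc_conjc rmorph_sum.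
rewrite le_eqVlt; apply/orP; left; apply/eqP; congr nc; apply: eq_bigr => j _.
transitivity (conjc (cis (j%:R * x + t * j%:R ^+ 2))) => //.
by rewrite -cisN; congr cis; ring.
Qed.

End WeylSum.

(** * Bilinear interpolation *)

Section Truncation.
Context d (T : measurableType d) (R : realType).
Implicit Types (f : T -> R[i]) (y : R).

Definition lo f y x := if nc (f x) <= y then f x else 0.
Definition hi f y x := if nc (f x) <= y then 0 else f x.

Lemma lo_hi f y x : f x = lo f y x + hi f y x.
Proof. by rewrite /lo /hi; case: ifP => _; rewrite ?addr0 ?add0r. Qed.

Lemma measurable_nc_le f y : cbm f -> measurable_fun setT (fun x => nc (f x) <= y).
Proof.
move=> bf; apply: measurable_fun_ler; last exact: measurable_cst.
by have [] := bmf_nc bf.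
Qed.

Lemma cbm_lo f y : cbm f -> cbm (lo f y).
Proof.
by move=> bf; apply: cbm_ifT => //; [exact: measurable_nc_le|exact: cbm_cst].
Qed.

Lemma cbm_hi f y : cbm f -> cbm (hi f y).
Proof.
by move=> bf; apply: cbm_ifT => //; [exact: measurable_nc_le|exact: cbm_cst].
Qed.

Lemma bmf_nc_powR f r : 0 <= r -> cbm f -> bmf (fun x => nc (f x) `^ r).
Proof. by move=> r0 bf; apply: bmf_powR => //; [move=> x; exact: nc_ge0|exact: bmf_nc]. Qed.

Lemma nc_lo_le f y x : 0 <= y -> nc (lo f y x) <= y.
Proof. by move=> y0; rewrite /lo; case: ifP => //; rewrite Normc.normc0. Qed.

Lemma lo_lo f y z : 0 <= z -> z <= y -> lo (lo f y) z = lo f z.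
Proof.
move=> z0 zy; apply/funext => x; rewrite /lo.
have [fz|fz] := leP (nc (f x)) z; first by rewrite (le_trans fz zy) fz.
case: (leP (nc (f x)) y) => fy; first by rewrite leNgt fz.
by rewrite Normc.normc0 z0.
Qed.

Lemma lo_id f y : (forall x, nc (f x) <= y) -> lo f y = f.
Proof. by move=> fy; apply/funext => x; rewrite /lo fy. Qed.

End Truncation.

Section PowerInequalities.
Context {R : realType}.
Implicit Types a y r s : R.

Lemma powR_split a r s : 0 <= a -> r + s != 0 -> a `^ (r + s) = a `^ r * a `^ s.
Proof. by move=> a0 rs; rewrite powRD// (negbTE rs). Qed.

(** Above the height [y] the power [r] controls the first power, and below it, by the next lemma,
    the square. These are the two halves of real interpolation between [L^1] and [L^2]. *)
Lemma le_powR_above a y r : 1 <= r -> 0 < y -> y <= a -> a <= y `^ (1 - r) * a `^ r.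
Proof.
move=> r1 y0 ya; have a0 : 0 < a by exact: lt_le_trans ya.
have -> : y `^ (1 - r) = (y `^ (r - 1))^-1 by rewrite -powRN opprB.
rewrite mulrC ler_pdivlMr ?powR_gt0// -{1}(powRr1 (ltW a0)).
have -> : a `^ r = a `^ 1 * a `^ (r - 1) by rewrite -powRD ?subrKC// (gt_eqF a0) implybT.
rewrite ler_pM2l ?powR_gt0//.
by rewrite ge0_ler_powR// ?nnegrE ?subr_ge0// ltW.
Qed.

Lemma sqr_le_powR_below a y r : 0 < r <= 2 -> 0 <= a -> a <= y ->
  a ^+ 2 <= y `^ (2 - r) * a `^ r.
Proof.
move=> /andP[r0 r2] a0 ay; have y0 := le_trans a0 ay.
have -> : a ^+ 2 = a `^ (2 - r) * a `^ r.
  by rewrite -powR_split ?subrK ?pnatr_eq0// powR_mulrn.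
rewrite ler_wpM2r ?powR_ge0//.
by rewrite ge0_ler_powR// ?nnegrE ?subr_ge0.
Qed.

(** The levels [Lam / 2 ^ k] not exceeding [y] form a geometric progression of ratio [2 ^ (- s)]
    after taking powers, dominated by its largest term. The bound depends neither on the starting
    level nor on the number of levels; levels above [y] are skipped by replacing [Lam] with
    [Lam / 2]. *)
Lemma dyadic_geometric_le s y (Lam : R) n : 0 < s -> 0 <= Lam -> 0 <= y ->
  \sum_(0 <= k < n) (if Lam / 2 ^+ k <= y then (Lam / 2 ^+ k) `^ s else 0)
  <= y `^ s / (1 - 2 `^ (- s)).
Proof.
move=> s0; set rho := 2 `^ (- s); move=> L0 y0.
have rho1 : rho < 1.
  rewrite /rho powRN invf_lt1 ?powR_gt0//.
  by rewrite -[ltLHS](powRr0 2) /powR gt_eqF// ltr_expR mul0r mulr_gt0// ln_gt0 ?ltr1n.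
have d0 : 0 < 1 - rho by rewrite subr_gt0.
have shift m (L : R) : \sum_(0 <= k < m.+1)
    (if L / 2 ^+ k <= y then (L / 2 ^+ k) `^ s else 0) =
  (if L <= y then L `^ s else 0) + \sum_(0 <= k < m)
    (if (L / 2) / 2 ^+ k <= y then ((L / 2) / 2 ^+ k) `^ s else 0).
  rewrite big_nat_recl// expr0 divr1; congr (_ + _).
  by apply: eq_bigr => k _; rewrite exprS invfM mulrA.
have first m (L : R) : 0 <= L -> \sum_(0 <= k < m)
    (if L / 2 ^+ k <= y then (L / 2 ^+ k) `^ s else 0) <= L `^ s / (1 - rho).
  elim: m L => [|m ih] L hL.
    by rewrite big_geq// divr_ge0 ?powR_ge0// ltW.
  rewrite shift; have := ih (L / 2) (divr_ge0 hL (ler0n _ 2)).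
  rewrite powRM// ?invr_ge0// -(powR_inv1 (ler0n R 2)) -powRrM mulN1r -/rho => h.
  have -> : L `^ s / (1 - rho) = L `^ s + L `^ s * rho / (1 - rho).
    by field; rewrite gt_eqF.
  by rewrite lerD//; case: ifP => // _; rewrite powR_ge0.
elim: n Lam L0 => [|n ih] L L0.
  by rewrite big_geq// divr_ge0 ?powR_ge0// ltW.
have [Ly|yL] := leP L y.
  rewrite (le_trans (first _ _ L0))// ler_pM2r ?invr_gt0//.
  by rewrite ge0_ler_powR// ?nnegrE// ltW.
by rewrite shift (leNgt L) yL add0r ih// divr_ge0.
Qed.

(** The [L^2] bound is a geometric mean; it has to be made linear before it can be added over
    levels, and the free weight [e] is adapted to each level. *)
Lemma le_amgm (x a b e : R) : 0 < e -> 0 <= x -> 0 <= a -> 0 <= b ->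
  x ^+ 2 <= a * b -> x <= e * a + e^-1 * b.
Proof.
move=> e0 x0 a0 b0 xab.
have eb0 : 0 <= e^-1 * b by rewrite mulr_ge0// invr_ge0 ltW.
have ea0 : 0 <= e * a by rewrite mulr_ge0// ltW.
rewrite -(@ler_pXn2r _ 2)// ?nnegrE ?addr_ge0//.
apply: (le_trans xab); rewrite sqrrD.
have -> : e * a * (e^-1 * b) = a * b by field; rewrite gt_eqF.
have ab0 : 0 <= a * b by rewrite mulr_ge0.
have := sqr_ge0 (e * a); have := sqr_ge0 (e^-1 * b); lra.
Qed.

End PowerInequalities.

(** * Marcinkiewicz interpolation of a bilinear form *)

Section Interpolation.
Context d (T : measurableType d) (R : realType)
  (mu : {measure set T -> \bar R}) (D : set T).
Hypotheses (mD : measurable D) (fD : (mu D < +oo)%E).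
Variables (J : (T -> R[i]) -> (T -> R[i]) -> R[i]) (V B r : R).
Hypotheses (V0 : 0 <= V) (B0 : 0 < B) (r12 : 1 < r < 2).

Local Notation E f := (Rintegral mu D f).
Local Notation e f := (E (fun x => nc (f x) `^ r)).

Hypothesis JDl : forall g1 g2 h, cbm g1 -> cbm g2 -> cbm h ->
  J (fun x => g1 x + g2 x) h = J g1 h + J g2 h.
Hypothesis JDr : forall g h1 h2, cbm g -> cbm h1 -> cbm h2 ->
  J g (fun x => h1 x + h2 x) = J g h1 + J g h2.
Hypothesis J2 : forall g h, cbm g -> cbm h ->
  nc (J g h) ^+ 2 <= (V * E (fun x => nc (g x) ^+ 2)) * (V * E (fun x => nc (h x) ^+ 2)).
Hypothesis J1 : forall g h, cbm g -> cbm h ->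
  nc (J g h) <= B * (E (fun x => nc (g x)) * E (fun x => nc (h x))).

Let r0 : 0 < r. Proof. by case/andP: r12 => r1 _; exact: lt_trans r1. Qed.

(** The two parameters are chosen so that the three quantities that arise, [eps * c ^ (2 - r)],
    [1 / eps] and [B * c ^ (1 - r)], all equal [B ^ (2 / r - 1)]. *)
Let c := B `^ (2 / r).
Let eps := c `^ (- ((2 - r) / 2)).

Let c0 : 0 < c. Proof. exact: powR_gt0. Qed.
Let eps0 : 0 < eps. Proof. exact: powR_gt0. Qed.

Let amgm g h k : 0 < k -> cbm g -> cbm h -> nc (J g h) <=
  V * (k * E (fun x => nc (g x) ^+ 2) + k^-1 * E (fun x => nc (h x) ^+ 2)).
Proof.
move=> k0 bg bh; apply: le_trans (le_amgm k0 _ _ _ (J2 bg bh)) _.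
- exact: nc_ge0.
- by rewrite mulr_ge0// expect_ge0// => x _; exact: sqr_ge0.
- by rewrite mulr_ge0// expect_ge0// => x _; exact: sqr_ge0.
- by rewrite mulrDr [leLHS]addrC [_ * (V * _)]mulrCA addrC [_ * (V * _)]mulrCA.
Qed.

Let e_ge0 f : 0 <= e f.
Proof. by apply: expect_ge0 => x _; exact: powR_ge0. Qed.

Let bmf_e (f : T -> R[i]) : cbm f -> bmf (fun x => nc (f x) `^ r).
Proof. by apply: bmf_nc_powR; exact: ltW. Qed.

Let e_split f y : cbm f -> e f = e (lo f y) + e (hi f y).
Proof.
move=> bf; rewrite -expectD//; last 2 first.
- exact/bmf_e/cbm_lo.
- exact/bmf_e/cbm_hi.
apply: eq_expect => x _; rewrite /lo /hi; case: ifP => _;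
  by rewrite Normc.normc0 powR0 ?gt_eqF// ?addr0 ?add0r.
Qed.

Let level g k H (lam : R) : 0 < k -> 0 < lam -> cbm g -> cbm H ->
  (forall x, nc (H x) <= lam) ->
  nc (J g H) <= V * (k * E (fun x => nc (g x) ^+ 2) + k^-1 * lam `^ (2 - r) * e H).
Proof.
move=> k0 lam0 bg bH Hlam; apply: (le_trans (amgm k0 bg bH)).
rewrite ler_wpM2l// lerD2l -mulrA ler_wpM2l ?invr_ge0 ?(ltW k0)// -expectZl//; last exact: bmf_e.
apply: le_expect => //.
- exact/bmfX/bmf_nc.
- by apply: bmfM; [exact: bmf_cst|exact: bmf_e].
- by move=> x _; apply: sqr_le_powR_below; rewrite ?nc_ge0// r0 ltW//; case/andP: r12.
Qed.

(** The layer [lam / 2 < |H| <= lam] is peeled off. The part of [g] below [c / lam] meets it through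
    [J2], with the weight [eps * lam ^ (2 - r)] that turns the contribution of the layer into
    [V / eps] times its [L^r] mass; the part above goes through [J1]. The mass of the layer is
    written as a difference so that it telescopes. *)
Let step g H (lam : R) : 0 < lam -> cbm g -> cbm H -> e g <= 1 ->
  (forall x, nc (H x) <= lam) ->
  nc (J g H) <= nc (J g (lo H (lam / 2))) +
    V * eps * (lam `^ (2 - r) * E (fun x => nc (lo g (c / lam) x) ^+ 2)) +
    (V / eps + 2 * (B * c `^ (1 - r))) * (e H - e (lo H (lam / 2))).
Proof.
move=> lam0 bg bH eg Hlam; have /andP[r1 r2] := r12.
pose h := hi H (lam / 2); have bh : cbm h by exact: cbm_hi.
have bl : cbm (lo H (lam / 2)) by exact: cbm_lo.
pose y := c / lam; have y0 : 0 < y by rewrite divr_gt0.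
have bgl : cbm (lo g y) by exact: cbm_lo.
have bgh : cbm (hi g y) by exact: cbm_hi.
have -> : e H - e (lo H (lam / 2)) = e h by rewrite (e_split (lam / 2) bH) addrAC subrr add0r.
have HE : H = (fun x => lo H (lam / 2) x + h x).
  by apply/funext => x; rewrite -lo_hi.
have gE : g = (fun x => lo g y x + hi g y x).
  by apply/funext => x; rewrite -lo_hi.
rewrite {1}HE JDr// (le_trans (le_normcD _ _))// -addrA lerD2l.
rewrite {1}gE JDl// (le_trans (le_normcD _ _))//.
have h1 : nc (J (lo g y) h) <=
    V * eps * (lam `^ (2 - r) * E (fun x => nc (lo g y x) ^+ 2)) + V / eps * e h.
  have k0 : 0 < eps * lam `^ (2 - r) by rewrite mulr_gt0// powR_gt0.
  have hl x : nc (h x) <= lam.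
    by rewrite /h /hi; case: ifP => _ //; rewrite Normc.normc0 ltW.
  apply: (le_trans (level k0 lam0 bgl bh hl)).
  rewrite le_eqVlt; apply/orP; left; apply/eqP.
  by field; rewrite !gt_eqF// powR_gt0.
have h2 : nc (J (hi g y) h) <= 2 * (B * c `^ (1 - r)) * e h.
  apply: (le_trans (J1 bgh bh)).
  have k1 : E (fun x => nc (hi g y x)) <= y `^ (1 - r).
    rewrite -[leRHS]mulr1 (le_trans _ (ler_wpM2l (powR_ge0 _ _) eg))// -expectZl//; last exact: bmf_e.
    apply: le_expect => //; [exact: bmf_nc|by apply: bmfM; [exact: bmf_cst|exact: bmf_e]|].
    move=> x _; rewrite /hi; case: ifPn => [_|].
      by rewrite Normc.normc0 mulr_ge0 ?powR_ge0.
    by rewrite -ltNge => gy; apply: le_powR_above => //; exact: ltW.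
  have k2 : E (fun x => nc (h x)) <= (lam / 2) `^ (1 - r) * e h.
    rewrite -expectZl//; last exact: bmf_e.
    apply: le_expect => //; [exact: bmf_nc|by apply: bmfM; [exact: bmf_cst|exact: bmf_e]|].
    move=> x _; rewrite /h /hi; case: ifPn => [_|].
      by rewrite Normc.normc0 mulr_ge0 ?powR_ge0.
    by rewrite -ltNge => gy; apply: le_powR_above; rewrite ?divr_gt0//; exact: ltW.
  have E0 f : 0 <= E (fun x => nc (f x)) by apply: expect_ge0 => x _; exact: nc_ge0.
  have := ler_pM (E0 _) (E0 _) k1 k2 => k3.
  apply: (le_trans (ler_wpM2l (ltW B0) k3)).
  rewrite [2 * _]mulrCA -!mulrA ler_pM2l// !mulrA ler_wpM2r//.
  have -> : y `^ (1 - r) * (lam / 2) `^ (1 - r) = 2 `^ (r - 1) * c `^ (1 - r).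
    rewrite -powRM ?divr_ge0// 1?ltW// /y.
    have -> : c / lam * (lam / 2) = 2^-1 * c by field; rewrite gt_eqF.
    by rewrite powRM ?invr_ge0// 1?ltW// -powR_inv1// -powRrM mulN1r opprB.
  rewrite ler_wpM2r ?powR_ge0// -[leRHS](powRr1 (ler0n R 2)).
  by rewrite ler_powR ?ler1n// lerBlDr -(natrD _ 1 1) ltW.
by rewrite mulrDl addrA lerD.
Qed.

Let telescoping_le (u0 u v W S x K p q q' : R) :
  u0 <= u + W * S + K * (p - q) -> u <= v + W * x + K * (q - q') ->
  u0 <= v + W * (S + x) + K * (p - q').
Proof. by move=> h1 h2; nra. Qed.

Let collect_le (u W S x K p q k t : R) : u <= W * x + k * q ->
  W * (S + x) <= W * t -> 0 <= K * (1 - p) -> 0 <= (K - k) * q ->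
  u + W * S + K * (p - q) <= W * t + K.
Proof. by move=> h1 h2 h3 h4; nra. Qed.

(* Marcinkiewicz interpolation between the [L^2] bound [J2] and the [L^1] bound
   [J1]: [h] is cut into dyadic level sets and, on the level [|h| ~ lam], [g] is
   split at height [c / lam]. *)
Lemma interpolation g h : cbm g -> cbm h -> e g <= 1 -> e h <= 1 ->
  nc (J g h) <= (V * (1 + (1 - 2 `^ (r - 2))^-1) + 2) * B `^ (2 / r - 1).
Proof.
move=> bg bh eg eh; have /andP[r1 r2] := r12.
have [Lam [L0 hL]] := bmf_bound (bmf_nc bh).
have [Mg [Mg0 gM]] := bmf_bound (bmf_nc bg).
pose lam k := Lam / 2 ^+ k.
have lam0 k : 0 < lam k by rewrite divr_gt0// exprn_gt0.
pose a k := lam k `^ (2 - r) * E (fun x => nc (lo g (c / lam k) x) ^+ 2).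
pose K := V / eps + 2 * (B * c `^ (1 - r)).
have lamS k : lam k.+1 = lam k / 2.
  by rewrite /lam exprSr invfM mulrA.
have iter n : nc (J g h) <= nc (J g (lo h (lam n))) + V * eps * \sum_(0 <= k < n) a k +
    K * (e h - e (lo h (lam n))).
  elim: n => [|n ih].
    rewrite big_geq// lo_id ?subrr ?mulr0 ?addr0//.
    by move=> x; rewrite /lam expr0 divr1 (le_trans _ (hL x))// ler_norm.
  have sumS : \sum_(0 <= k < n.+1) a k = \sum_(0 <= k < n) a k + a n.
    by rewrite big_nat_recr.
  have lamSn : lam n.+1 <= lam n.
    by rewrite lamS ler_pdivrMr// mulr_natr mulr2n lerDl ltW.
  have := step (lam0 n) bg (cbm_lo _ bh) eg (fun x => nc_lo_le h x (ltW (lam0 n))).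
  rewrite -lamS (lo_lo _ (ltW (lam0 _)) lamSn) sumS.
  exact: telescoping_le ih.
(* Once [c / lam n] exceeds the bound of [g], truncating [g] has no effect and what remains of [h]
   is handled by [J2] alone; its [g] term is the summand of index [n]. *)
have [n hn] : exists n, Mg <= c / lam n.
  pose N := Num.bound (Mg * Lam / c); exists N.
  have := archi_boundP (divr_ge0 (mulr_ge0 (ltW Mg0) (ltW L0)) (ltW c0)).
  rewrite -/N => hN.
  have N2 : N%:R <= 2 ^+ N :> R by rewrite -natrX ler_nat ltnW// ltn_expl.
  rewrite /lam invf_div mulrA ler_pdivlMr// mulrC -ler_pdivrMl//.
  rewrite (mulrC c^-1) [Lam * _]mulrC.
  exact: (le_trans (ltW hN)).
have glo : lo g (c / lam n) = g.
  by apply: lo_id => x; rewrite (le_trans _ hn)// (le_trans _ (gM x))// ler_norm.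
have last : nc (J g (lo h (lam n))) <= V * eps * a n + V / eps * e (lo h (lam n)).
  have k0 : 0 < eps * lam n `^ (2 - r) by rewrite mulr_gt0// powR_gt0.
  apply: (le_trans (level k0 (lam0 n) bg (cbm_lo _ bh) (fun x => nc_lo_le h x (ltW (lam0 n))))).
  rewrite /a glo le_eqVlt; apply/orP; left; apply/eqP.
  by field; rewrite !gt_eqF// powR_gt0.
(* Sum and integral are exchanged. At a given point only the levels [lam k <= c / |g|] count; their
   powers [2 - r] add up to a multiple of [(c / |g|) ^ (2 - r)], and multiplying by [|g| ^ 2] leaves
   [c ^ (2 - r) |g| ^ r]. *)
have suma : \sum_(0 <= k < n.+1) a k <= c `^ (2 - r) / (1 - 2 `^ (r - 2)).
  have bl k : bmf (fun x => nc (lo g (c / lam k) x) ^+ 2).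
    exact/bmfX/bmf_nc/cbm_lo.
  rewrite /a; under eq_bigr do rewrite -expectZl//.
  rewrite -expect_sum//; last by move=> k _; apply: bmfM => //; exact: bmf_cst.
  rewrite -[leRHS]mulr1 (le_trans _ (ler_wpM2l _ eg))//; last first.
    rewrite divr_ge0 ?powR_ge0// subr_ge0.
    by rewrite -[leRHS](powRr0 2) ler_powR ?ler1n// subr_le0 ltW.
  rewrite -expectZl//; last exact: bmf_e.
  apply: le_expect => //.
  - by apply: bmf_sum => k _; apply: bmfM => //; exact: bmf_cst.
  - by apply: bmfM; [exact: bmf_cst|exact: bmf_e].
  move=> x _; have [g0|g0] := eqVneq (nc (g x)) 0.
    rewrite big1 ?g0 ?powR0 ?gt_eqF ?mulr0// => k _.
    by rewrite /lo; case: ifP => _; rewrite ?g0 ?Normc.normc0 expr0n mulr0.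
  have gp : 0 < nc (g x) by rewrite lt_neqAle eq_sym g0 nc_ge0.
  have := @dyadic_geometric_le R (2 - r) (c / nc (g x)) Lam n.+1.
  rewrite subr_gt0 => /(_ r2 (ltW L0) (divr_ge0 (ltW c0) (ltW gp))).
  rewrite opprB => geo.
  have -> : \sum_(0 <= k < n.+1) lam k `^ (2 - r) * nc (lo g (c / lam k) x) ^+ 2 =
     (\sum_(0 <= k < n.+1) (if Lam / 2 ^+ k <= c / nc (g x)
       then (Lam / 2 ^+ k) `^ (2 - r) else 0)) * nc (g x) ^+ 2.
    rewrite mulr_suml; apply: eq_bigr => k _; rewrite -/(lam k) /lo.
    have -> : (nc (g x) <= c / lam k) = (lam k <= c / nc (g x)).
      by rewrite !ler_pdivlMr// mulrC.
    by case: ifP => _ //; rewrite Normc.normc0 expr0n/= mulr0 mul0r.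
  apply: (le_trans (ler_wpM2r (sqr_ge0 _) geo)).
  rewrite le_eqVlt; apply/orP; left; apply/eqP.
  rewrite powRM ?invr_ge0 ?nc_ge0//; last exact: ltW.
  rewrite -(powR_inv1 (nc_ge0 _)) -powRrM mulN1r.
  have -> : nc (g x) `^ r = nc (g x) `^ (- (2 - r)) * nc (g x) ^+ 2.
    rewrite -powR_mulrn ?nc_ge0// -powRD ?g0 ?implybT//; congr (_ `^ _); ring.
  by ring.
have := iter n; set u := nc _ in last *; move: last => last h1.
have ecE : eps * c `^ (2 - r) = B `^ (2 / r - 1).
  rewrite /eps -powRD ?(gt_eqF c0) ?implybT// /c -powRrM; congr (_ `^ _).
  by field; rewrite gt_eqF.
have eiE : eps^-1 = B `^ (2 / r - 1).
  rewrite /eps -powRN opprK /c -powRrM; congr (_ `^ _).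
  by field; rewrite gt_eqF.
have bcE : B * c `^ (1 - r) = B `^ (2 / r - 1).
  rewrite /c -powRrM -{1}(powRr1 (ltW B0)) -powRD ?(gt_eqF B0) ?implybT//; congr (_ `^ _).
  by field; rewrite gt_eqF.
rewrite big_nat_recr// in suma.
have Be0 : 0 <= B `^ (2 / r - 1) by exact: powR_ge0.
have K0 : 0 <= K by rewrite addr_ge0 ?mulr_ge0 ?invr_ge0 ?powR_ge0// ltW.
have el0 := e_ge0 (lo h (lam n)).
apply: (le_trans h1).
apply: (@le_trans _ _ (V * eps * (c `^ (2 - r) / (1 - 2 `^ (r - 2))) + K)).
  apply: (collect_le last (ler_wpM2l (mulr_ge0 V0 (ltW eps0)) suma)).
    by rewrite mulr_ge0// subr_ge0.
  rewrite mulr_ge0// /K addrAC subrr add0r mulr_ge0// mulr_ge0 ?powR_ge0//.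
  exact: ltW.
rewrite /K bcE eiE le_eqVlt; apply/orP; left; apply/eqP.
by rewrite -[V * eps]/(V * eps) -mulrA [eps * _]mulrA ecE; ring.
Qed.

End Interpolation.

(** * The Hardy-Littlewood-Sobolev inequality *)

Section Hoelder.
Context d (T : measurableType d) (R : realType)
  (mu : {measure set T -> \bar R}) (D : set T).
Hypotheses (mD : measurable D) (fD : (mu D < +oo)%E).
Local Notation E f := (Rintegral mu D f).

(** Young's inequality is integrated after dividing [f] and [g] by [A] and [B]. Positive upper
    bounds stand in for the norms, which avoids the case of a zero norm. *)
Lemma hoelder_le (f g : T -> R) (p q A B : R) :
  (forall x, 0 <= f x) -> (forall x, 0 <= g x) -> bmf f -> bmf g ->
  0 < p -> 0 < q -> p^-1 + q^-1 = 1 -> 0 < A -> 0 < B ->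
  E (fun x => f x `^ p) <= A `^ p -> E (fun x => g x `^ q) <= B `^ q ->
  E (fun x => f x * g x) <= A * B.
Proof.
move=> f0 g0 bf bg p0 q0 pq A0 B0 hf hg.
have bfp : bmf (fun x => f x `^ p) by apply: bmf_powR => //; exact: ltW.
have bgq : bmf (fun x => g x `^ q) by apply: bmf_powR => //; exact: ltW.
pose a := A * B * (A `^ (- p) / p); pose b := A * B * (B `^ (- q) / q).
have a0 : 0 <= a by rewrite /a !mulr_ge0 ?powR_ge0 ?invr_ge0// ltW.
have b0 : 0 <= b by rewrite /b !mulr_ge0 ?powR_ge0 ?invr_ge0// ltW.
apply: (@le_trans _ _ (E (fun x => a * f x `^ p + b * g x `^ q))).
  apply: le_expect => //; [exact: bmfM| |].
    by apply: bmfD; apply: bmfM => //; exact: bmf_cst.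
  move=> x _.
  have := conjugate_powR (divr_ge0 (f0 x) (ltW A0)) (divr_ge0 (g0 x) (ltW B0)) p0 q0 pq.
  rewrite -(ler_pM2l (mulr_gt0 A0 B0)).
  have -> : A * B * (f x / A * (g x / B)) = f x * g x.
    by field; rewrite !gt_eqF.
  rewrite !powRM ?f0 ?g0 ?invr_ge0 ?(ltW A0) ?(ltW B0)//.
  rewrite -(powR_inv1 (ltW A0)) -(powR_inv1 (ltW B0)) -!powRrM !mulN1r.
  by move=> /le_trans; apply; rewrite /a /b le_eqVlt; apply/orP; left; apply/eqP; ring.
rewrite expectD//; try (by apply: bmfM => //; exact: bmf_cst).
rewrite !expectZl//.
apply: (@le_trans _ _ (a * A `^ p + b * B `^ q)).
  by apply: lerD; exact: ler_wpM2l.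
rewrite /a /b !powRN le_eqVlt; apply/orP; left; apply/eqP.
have -> : A * B * ((A `^ p)^-1 / p) * A `^ p + A * B * ((B `^ q)^-1 / q) * B `^ q =
  A * B * (p^-1 + q^-1).
  by field; rewrite !gt_eqF ?powR_gt0.
by rewrite pq mulr1.
Qed.

End Hoelder.

Section Symmetrize.
Context d (T : measurableType d) (R : realType)
  (mu : {sigma_finite_measure set T -> \bar R}) (D : set T).
Hypotheses (mD : measurable D) (fD : (mu D < +oo)%E).
Local Notation E f := (Rintegral mu D f).

(** Each pair satisfies [b y <= b x] or [b x <= b y], and Tonelli's theorem with the symmetry of [K]
    gives both halves the same integral. Ties are counted twice, hence an inequality. *)
Lemma expect_symmetrize (K : T * T -> R) (b : T -> R) : bmf K -> bmf b ->
  (forall z, 0 <= K z) -> (forall x y, K (x, y) = K (y, x)) ->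
  E (fun x => E (fun y => K (x, y))) <=
  2 * E (fun x => E (fun y => if b y <= b x then K (x, y) else 0)).
Proof.
move=> bK bb K0 Ksym.
pose F (z : T * T) := if b z.2 <= b z.1 then K z else 0.
pose F' (z : T * T) := F (z.2, z.1).
have bF : bmf F.
  apply: bmf_ifT => //; last exact: bmf_cst.
  apply: measurable_fun_ler.
    exact: (proj1 (bmf_comp measurable_snd bb)).
  exact: (proj1 (bmf_comp measurable_fst bb)).
have bF' : bmf F'.
  by apply: (bmf_comp _ bF); exact: measurable_fun_pair.
have F0 z : 0 <= F z by rewrite /F; case: ifP.
have sw : E (fun x => E (fun y => F (x, y))) = E (fun x => E (fun y => F' (x, y))).
  by rewrite (expect_swap mD fD mD fD F0 bF).
rewrite mulr_natl mulr2n -[X in X + _]/(E (fun x => E (fun y => F (x, y)))).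
rewrite -[X in _ + X]/(E (fun x => E (fun y => F (x, y)))) {2}sw.
have bE := bmf_expect2 mD fD bF; have bE' := bmf_expect2 mD fD bF'.
rewrite -(expectD mD fD bE bE').
apply: (le_expect mD fD (bmf_expect2 mD fD bK) (bmfD bE bE')).
move=> x _; have bx := bmf_pair1 x bF; have bx' := bmf_pair1 x bF'.
rewrite -(expectD mD fD bx bx').
apply: (le_expect mD fD (bmf_pair1 x bK) (bmfD bx bx')).
move=> y _; rewrite /F' /F/=.
case: (leP (b y) (b x)) => h; first by rewrite lerDl; case: ifP.
by rewrite (ltW h) add0r Ksym.
Qed.

End Symmetrize.

Section TimeInterval.
Context {R : realType}.
Local Notation RT := (measurableTypeR R).

(* [lebesgue_measure] lives on [measurableTypeR R], whose sigma-algebra is not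
   convertible to the canonical one of [R] although both are the Borel sets. *)
Lemma measurable_idR : @measurable_fun _ _ RT R setT (fun x => x).
Proof. exact: (@measurable_id _ RT setT). Qed.

Lemma measurable_idRT : @measurable_fun _ _ R RT setT (fun x => x).
Proof. exact: (@measurable_id _ RT setT). Qed.

Lemma lebesgue_segment (a b : R) : a <= b ->
  @lebesgue_measure R `[a, b]%classic = (b - a)%:E.
Proof.
move=> ab; rewrite lebesgue_measure_itv/= lte_fin.
have [->|ne] := eqVneq a b; first by rewrite ltxx subrr.
by rewrite lt_neqAle ne ab -EFinB.
Qed.

End TimeInterval.

(** * The kernel [|t - s| ^ (- 2 / p)] on a time interval *)

Section HardyLittlewoodSobolev.
Context {R : realType}.
Variables (p a b del : R).
Hypotheses (p2 : 2 < p) (ab : a <= b) (del0 : 0 < del).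

Local Notation mu := (@lebesgue_measure R).
Local Notation RT := (measurableTypeR R).
Let I : set RT := `[a, b]%classic.
Local Notation E f := (Rintegral mu I f).

Lemma measurable_timeI : measurable I. Proof. exact: measurable_itv. Qed.

Lemma finite_timeI : (mu I < +oo)%E.
Proof.
by rewrite lebesgue_segment// ltry.
Qed.

Let mI := measurable_timeI.
Let fI := finite_timeI.

Let r := p / (p - 1).
Let al := 2 / p.

Let p0 : 0 < p. Proof. by apply: lt_trans p2. Qed.
Let p1 : 0 < p - 1. Proof. by move: p2; lra. Qed.
Let r0 : 0 < r. Proof. exact: divr_gt0. Qed.
Let al0 : 0 < al. Proof. exact: divr_gt0. Qed.
Let al1 : al < 1. Proof. by rewrite ltr_pdivrMr ?mul1r. Qed.

(** The singular kernel is capped at distance [del] so as to remain bounded. The final constant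
    depends only on [p], neither on [del] nor on the interval. *)
Definition hls_kernel (tau : R) : R := Num.max `|tau| del `^ (- (2 / p)).
Local Notation k := hls_kernel.

Lemma hls_kernel_ge0 tau : 0 <= k tau. Proof. exact: powR_ge0. Qed.

Lemma hls_kernelN tau : k (- tau) = k tau. Proof. by rewrite /k normrN. Qed.

Let powRN_le (x y s : R) : 0 < x -> x <= y -> 0 <= s -> y `^ (- s) <= x `^ (- s).
Proof.
move=> x0 xy s0; rewrite !powRN lef_pV2 ?posrE ?powR_gt0//; last exact: lt_le_trans xy.
by rewrite ge0_ler_powR ?nnegrE ?(ltW x0) ?(le_trans (ltW x0) xy).
Qed.

Lemma bmf_hls_kernel : @bmf _ R R k.
Proof.
split.
  apply: (measurableT_comp (measurable_powR _)).
  by apply: measurable_funTS; apply: measurable_maxr; [exact: normr_measurable|exact: measurable_cst].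
exists (del `^ (- al)) => tau; rewrite ger0_norm ?hls_kernel_ge0//.
by apply: powRN_le; rewrite ?(ltW al0)// le_max lexx orbT.
Qed.

Let msub (t : R) : @measurable_fun _ _ RT R setT (fun s : R => t - s).
Proof. by apply: measurable_funB; [exact: measurable_cst|exact: measurable_idR]. Qed.

Let mdist (t y : R) : @measurable_fun _ _ RT _ setT (fun s : R => `|t - s| <= y).
Proof.
apply: measurable_fun_ler; last exact: measurable_cst.
by apply: measurableT_comp => //; exact: msub.
Qed.

Let bmf_ksub (t : R) : @bmf _ RT R (fun s : R => k (t - s)).
Proof. exact: (bmf_comp (msub t) bmf_hls_kernel). Qed.

Lemma ball_measure_le (t y : R) : 0 <= y ->
  E (fun s => if `|t - s| <= y then 1 else 0) <= 2 * y.
Proof.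
move=> y0; pose J : set R := `[t - y, t + y]%classic.
have -> : E (fun s => if `|t - s| <= y then 1 else 0) = fine (mu (J `&` I)).
  have mJ : measurable J by exact: measurable_itv.
  rewrite -integral_indic//; congr fine.
  apply: eq_integral => s _; rewrite indicE /J mem_setE in_itv/=.
  rewrite ler_norml; congr (_%:E).
  have -> : (- y <= t - s <= y) = (t - y <= s <= t + y).
    by apply/idP/idP => /andP[h1 h2]; apply/andP; split; lra.
  by case: ifP.
have muJ : mu J = (2 * y)%:E.
  by rewrite /J lebesgue_segment; [congr (_%:E); ring|lra].
have mJ : measurable J by exact: measurable_itv.
have h : (mu (J `&` I) <= (2 * y)%:E)%E.
  by rewrite -muJ; apply: le_measure; rewrite ?inE//; exact: measurableI.
rewrite -lee_fin fineK// ge0_fin_numE//.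
by rewrite (le_lt_trans h)// ltry.
Qed.

(** The fraction solves [K = 2 ^ (1 + al) + K * 2 ^ (al - 1)], the recursion of one halving of the
    radius; the summand [2] covers radii below [del]. *)
Definition hls_near_const : R := 2 `^ (1 + 2 / p) / (1 - 2 `^ (2 / p - 1)) + 2.
Local Notation Kn := hls_near_const.

Let rho1 : 0 < 1 - 2 `^ (al - 1).
Proof.
rewrite subr_gt0 -[ltRHS](powRr0 2) /powR gt_eqF// ltr_expR mul0r.
by rewrite nmulr_rlt0 ?subr_lt0// ln_gt0 ?ltr1n.
Qed.

Lemma hls_near_const_ge2 : 2 <= Kn.
Proof. by rewrite lerDr divr_ge0 ?powR_ge0// ltW. Qed.

(** Induction on the number of halvings that bring [rho] down to [del]. The annulus between
    [rho / 2] and [rho] costs at most [(rho / 2) ^ (- al) * (2 rho)], and the rest contracts because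
    [al < 1]. *)
Lemma hls_near (t rho : R) : 0 < rho ->
  E (fun s => if `|t - s| <= rho then k (t - s) else 0) <= Kn * rho `^ (1 - al).
Proof.
move=> rho0.
have bk y : @bmf _ RT R (fun s : R => if `|t - s| <= y then k (t - s) else 0).
  by apply: bmf_ifT => //; exact: bmf_cst.
have b1 y (c : R) : @bmf _ RT R (fun s : R => if `|t - s| <= y then c else 0).
  by apply: bmf_ifT => //; exact: bmf_cst.
have Ec y (c : R) : 0 <= c -> 0 <= y ->
    E (fun s => if `|t - s| <= y then c else 0) <= c * (2 * y).
  move=> c0 y0; rewrite (le_trans _ (ler_wpM2l c0 (ball_measure_le t y0)))//.
  rewrite -expectZl//; apply: le_expect => //.
    by apply: bmfM => //; exact: bmf_cst.
  by move=> s _; case: ifP => _; rewrite ?mulr1 ?mulr0.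
have [n] : exists n, rho <= del * 2 ^+ n.
  pose N := Num.bound (rho / del); exists N.
  have := archi_boundP (divr_ge0 (ltW rho0) (ltW del0)); rewrite -/N => hN.
  rewrite mulrC -ler_pdivrMr// (le_trans (ltW hN))//.
  by rewrite -natrX ler_nat ltnW// ltn_expl.
elim: n rho rho0 => [|n ih] rho rho0.
  rewrite expr0 mulr1 => rd.
  apply: (@le_trans _ _ (rho `^ (- al) * (2 * rho))).
    apply: le_trans (Ec _ _ (powR_ge0 _ _) (ltW rho0)).
    apply: (le_expect mI fI (bk _) (b1 _ _)) => s _; case: ifP => // _.
    by apply: powRN_le; rewrite ?(ltW al0)// le_max rd orbT.
  have -> : rho `^ (1 - al) = rho `^ (- al) * rho.
    by rewrite -{3}(powRr1 (ltW rho0)) -powRD ?(gt_eqF rho0) ?implybT// addrC.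
  rewrite mulrCA ler_wpM2r ?hls_near_const_ge2//.
  by rewrite mulr_ge0 ?powR_ge0// ltW.
move=> rd; have h0 : 0 < rho / 2 by rewrite divr_gt0.
have := ih (rho / 2) h0; rewrite ler_pdivrMr// -mulrA -exprSr => /(_ rd) {}ih.
apply: (@le_trans _ _ ((rho / 2) `^ (- al) * (2 * rho) + Kn * (rho / 2) `^ (1 - al))).
  apply: le_trans (lerD (Ec _ _ (powR_ge0 _ _) (ltW rho0)) ih).
  rewrite -(expectD mI fI (b1 _ _) (bk _)).
  apply: (le_expect mI fI (bk _) (bmfD (b1 _ _) (bk _))).
  move=> s _; have [hs|hs] := leP `|t - s| (rho / 2).
    have hr : rho / 2 <= rho by rewrite ler_pdivrMr// mulr_natr mulr2n lerDl ltW.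
    by rewrite (le_trans hs hr) lerDr powR_ge0.
  rewrite addr0; case: ifP => // _.
  by apply: powRN_le; rewrite ?(ltW al0)// le_max (ltW hs).
have rE : rho `^ (1 - al) = rho `^ (- al) * rho.
  by rewrite -{3}(powRr1 (ltW rho0)) -powRD ?(gt_eqF rho0) ?implybT// addrC.
rewrite !powRM ?invr_ge0 ?(ltW rho0)// -(powR_inv1 (ler0n R 2)) -!powRrM !mulN1r opprK opprB.
set X := rho `^ (1 - al); have X0 : 0 <= X by exact: powR_ge0.
have -> : rho `^ (- al) * 2 `^ al * (2 * rho) = 2 `^ (1 + al) * X.
  rewrite /X rE powR_split//; last by rewrite gt_eqF// addr_gt0.
  by rewrite powRr1//; ring.
rewrite [X * _]mulrC mulrA -mulrDl ler_wpM2r//.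
rewrite /Kn -/al.
have : 2 `^ (1 + al) / (1 - 2 `^ (al - 1)) * (1 - 2 `^ (al - 1)) = 2 `^ (1 + al) :> R.
  by rewrite mulfVK// gt_eqF.
have := rho1; nra.
Qed.

(** The power [p] of the kernel decays like the inverse square. The induction doubles [rho] until it
    exceeds the length of the interval; the annulus between [rho] and [2 rho] costs [4 / rho], and
    [4 / rho + 8 / (2 rho) = 8 / rho]. *)
Lemma hls_far (t rho : R) : I t -> 0 < rho ->
  E (fun s => if `|t - s| <= rho then 0 else k (t - s) `^ p) <= 8 / rho.
Proof.
move=> tI rho0.
have kp tau : k tau `^ p = Num.max `|tau| del `^ (- 2).
  by rewrite /k -powRrM mulNr divfK// gt_eqF.
have bkp : @bmf _ RT R (fun s : R => k (t - s) `^ p).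
  by apply: bmf_powR; rewrite ?ltW// => s; exact: hls_kernel_ge0.
have bk y : @bmf _ RT R (fun s : R => if `|t - s| <= y then 0 else k (t - s) `^ p).
  by apply: bmf_ifT => //; exact: bmf_cst.
have b1 y (c : R) : @bmf _ RT R (fun s : R => if `|t - s| <= y then c else 0).
  by apply: bmf_ifT => //; exact: bmf_cst.
have Ec y (c : R) : 0 <= c -> 0 <= y ->
    E (fun s => if `|t - s| <= y then c else 0) <= c * (2 * y).
  move=> c0 y0; rewrite (le_trans _ (ler_wpM2l c0 (ball_measure_le t y0)))//.
  rewrite -expectZl//; apply: le_expect => //.
    by apply: bmfM => //; exact: bmf_cst.
  by move=> s _; case: ifP => _; rewrite ?mulr1 ?mulr0.
have [n] : exists n, b - a <= rho * 2 ^+ n.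
  pose N := Num.bound ((b - a) / rho); exists N.
  have ba : 0 <= b - a by rewrite subr_ge0.
  have := archi_boundP (divr_ge0 ba (ltW rho0)); rewrite -/N => hN.
  rewrite mulrC -ler_pdivrMr// (le_trans (ltW hN))//.
  by rewrite -natrX ler_nat ltnW// ltn_expl.
elim: n rho rho0 => [|n ih] rho rho0.
  rewrite expr0 mulr1 => rd.
  have -> : E (fun s => if `|t - s| <= rho then 0 else k (t - s) `^ p) = E (fun=> 0).
    apply: eq_expect => s; move: tI; rewrite /I/= !in_itv/= => /andP[t1 t2] /andP[s1 s2].
    by rewrite ifT// ler_norml; apply/andP; split; lra.
  by rewrite expect_cst// mul0r divr_ge0// ltW.
move=> rd; have h0 : 0 < rho * 2 by rewrite mulr_gt0.
have := ih (rho * 2) h0; rewrite -mulrA -exprS => /(_ rd) {}ih.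
apply: (@le_trans _ _ (rho `^ (- 2) * (2 * (rho * 2)) + 8 / (rho * 2))).
  apply: le_trans (lerD (Ec _ _ (powR_ge0 _ _) (ltW h0)) ih).
  rewrite -(expectD mI fI (b1 _ _) (bk _)).
  apply: (le_expect mI fI (bk _) (bmfD (b1 _ _) (bk _))).
  move=> s _; have [hs|hs] := leP `|t - s| rho.
    by rewrite addr_ge0//; case: ifP => // _; exact: powR_ge0.
  case: ifP => _; rewrite ?add0r// addr0 kp.
  by apply: powRN_le => //; rewrite le_max (ltW hs).
rewrite powRN powR_mulrn ?(ltW rho0)// le_eqVlt; apply/orP; left; apply/eqP.
by field; rewrite gt_eqF.
Qed.

Definition hls_const : R := 2 * (Kn + 8 `^ p^-1).

Lemma hls_const_ge0 : 0 <= hls_const.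
Proof.
by rewrite mulr_ge0// addr_ge0 ?powR_ge0// (le_trans _ hls_near_const_ge2).
Qed.

Let half (phi : R -> R) (N t : R) : (forall t, 0 <= phi t) -> @bmf _ RT R phi ->
  0 < N -> E (fun s => phi s `^ r) <= N `^ r -> I t ->
  phi t * E (fun s => if phi s <= phi t then k (t - s) * phi s else 0) <=
  (Kn + 8 `^ p^-1) * N `^ (2 - r) * phi t `^ r.
Proof.
move=> phi0 bphi N0 hN tI.
have [->|ft] := eqVneq (phi t) 0.
  by rewrite mul0r mulr_ge0 ?powR_ge0// mulr_ge0 ?powR_ge0// addr_ge0 ?powR_ge0//
     (le_trans _ hls_near_const_ge2).
have {}ft : 0 < phi t by rewrite lt_neqAle eq_sym ft phi0.
(* This radius balances the two parts: after multiplication by [phi t], the ball and its complement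
   both give a constant times [N ^ (2 - r) * phi t ^ r], whose integral is at most a constant times
   [N ^ 2]. *)
pose rho := (N / phi t) `^ r.
have rho0 : 0 < rho by rewrite powR_gt0// divr_gt0.
have brho : @bmf _ RT R (fun s : R => if `|t - s| <= rho then k (t - s) else 0).
  by apply: bmf_ifT => //; exact: bmf_cst.
pose kf s := if `|t - s| <= rho then 0 else k (t - s).
have bkf : @bmf _ RT R kf by apply: bmf_ifT => //; exact: bmf_cst.
have kf0 s : 0 <= kf s by rewrite /kf; case: ifP => // _; exact: powR_ge0.
have mphi : measurable_fun setT (fun s => phi s <= phi t).
  by apply: measurable_fun_ler; [case: bphi|exact: measurable_cst].
have far : E (fun s => kf s * phi s) <= (8 / rho) `^ p^-1 * N.
  apply: (@hoelder_le _ _ _ mu I mI fI kf phi p r) => //.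
  - by rewrite /r; field; rewrite !gt_eqF.
  - by rewrite powR_gt0// divr_gt0.
  - rewrite -powRrM mulVf ?gt_eqF// powRr1; last by rewrite divr_ge0// ltW.
    apply: le_trans (hls_far tI rho0).
    apply: le_expect => //.
    + by apply: bmf_powR => //; exact: ltW.
    + apply: bmf_ifT => //; first exact: bmf_cst.
      by apply: bmf_powR; rewrite ?ltW// => s; exact: hls_kernel_ge0.
    + by move=> s _; rewrite /kf; case: ifP => // _; rewrite powR0 ?gt_eqF.
have split : E (fun s => if phi s <= phi t then k (t - s) * phi s else 0) <=
    phi t * (Kn * rho `^ (1 - al)) + (8 / rho) `^ p^-1 * N.
  apply: le_trans (lerD (ler_wpM2l (ltW ft) (hls_near t rho0)) far).
  rewrite -expectZl// -expectD//; last 2 first.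
  - by apply: bmfM => //; exact: bmf_cst.
  - exact: bmfM.
  apply: le_expect => //.
  - apply: bmf_ifT => //; last exact: bmf_cst.
    exact: bmfM.
  - by apply: bmfD; apply: bmfM => //; exact: bmf_cst.
  move=> s _; have [fs|fs] := leP (phi s) (phi t); last first.
    rewrite addr_ge0 ?(mulr_ge0 (kf0 s) (phi0 s))// mulr_ge0 ?(ltW ft)//.
    by case: ifP => // _; exact: powR_ge0.
  rewrite /kf; case: ifP => _; last by rewrite mulr0 add0r.
  by rewrite mul0r addr0 mulrC ler_wpM2r// hls_kernel_ge0.
apply: (le_trans (ler_wpM2l (ltW ft) split)).
have rr : 1 + (r - 1) = r by ring.
have e1 : rho `^ (1 - al) = N `^ (2 - r) * phi t `^ (r - 2).
  rewrite /rho -powRrM.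
  have -> : r * (1 - al) = 2 - r by rewrite /r /al; field; rewrite !gt_eqF.
  rewrite powRM ?invr_ge0 ?ltW// -(powR_inv1 (ltW ft)) -powRrM; congr (_ * _ `^ _); ring.
have e2 : (8 / rho) `^ p^-1 = 8 `^ p^-1 * (N `^ (1 - r) * phi t `^ (r - 1)).
  rewrite powRM ?invr_ge0 ?(ltW rho0)//; congr (_ * _).
  rewrite -(powR_inv1 (ltW rho0)) /rho -!powRrM.
  have -> : r * (-1 / p) = 1 - r by rewrite /r; field; rewrite !gt_eqF.
  rewrite powRM ?invr_ge0 ?ltW// -(powR_inv1 (ltW ft)) -powRrM; congr (_ * _ `^ _); ring.
have e3 : phi t `^ r = phi t * (phi t * phi t `^ (r - 2)).
  rewrite -{2 3}(powRr1 (ltW ft)) -!powRD ?(gt_eqF ft) ?implybT//; congr (_ `^ _); ring.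
have e4 : phi t `^ r = phi t * phi t `^ (r - 1).
  rewrite -{2}(powRr1 (ltW ft)) -!powRD ?(gt_eqF ft) ?implybT//; congr (_ `^ _); ring.
have e5 : N `^ (2 - r) = N `^ (1 - r) * N.
  rewrite -{3}(powRr1 (ltW N0)) -!powRD ?(gt_eqF N0) ?implybT//; congr (_ `^ _); ring.
have -> : (Kn + 8 `^ p^-1) * N `^ (2 - r) * phi t `^ r =
  Kn * N `^ (2 - r) * phi t `^ r + 8 `^ p^-1 * N `^ (2 - r) * phi t `^ r by ring.
rewrite mulrDr lerD//.
  by rewrite e1 e3 le_eqVlt; apply/orP; left; apply/eqP; ring.
by rewrite e2 e4 e5 le_eqVlt; apply/orP; left; apply/eqP; ring.
Qed.

(* By symmetry one may assume [phi s <= phi t].  Then [phi s] is replaced by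
   [phi t] on the ball [|t - s| <= rho] and Hoelder is used outside, with
   [rho = (N / phi t)^r]. *)
Lemma hardy_littlewood_sobolev (phi : R -> R) (N : R) :
  (forall t, 0 <= phi t) -> @bmf _ RT R phi ->
  0 < N -> E (fun s => phi s `^ (p / (p - 1))) <= N `^ (p / (p - 1)) ->
  E (fun t => phi t * E (fun s => k (t - s) * phi s)) <= hls_const * N ^+ 2.
Proof.
rewrite -/r => phi0 bphi N0 hN.
pose F (z : R * R) := if phi z.2 <= phi z.1
  then phi z.1 * (k (z.1 - z.2) * phi z.2) else 0.
have mfst : @measurable_fun _ _ (RT * RT)%type RT setT fst by exact: measurable_fst.
have msnd : @measurable_fun _ _ (RT * RT)%type RT setT snd by exact: measurable_snd.
have bphi1 : @bmf _ (RT * RT)%type R (fun z : R * R => phi z.1) by exact: (bmf_comp mfst bphi).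
have bphi2 : @bmf _ (RT * RT)%type R (fun z : R * R => phi z.2) by exact: (bmf_comp msnd bphi).
have bk : @bmf _ (RT * RT)%type R (fun z : R * R => k (z.1 - z.2)).
  apply: (bmf_comp _ bmf_hls_kernel).
  by apply: measurable_funB; apply: (measurableT_comp measurable_idR).
have bF0 : @bmf _ (RT * RT)%type R (fun z : R * R => phi z.1 * (k (z.1 - z.2) * phi z.2)).
  by apply: bmfM => //; exact: bmfM.
have bF : @bmf _ (RT * RT)%type R F.
  apply: bmf_ifT => //; last exact: bmf_cst.
  by apply: measurable_fun_ler; [case: bphi2|case: bphi1].
have EF : E (fun t => E (fun s => F (t, s))) <= (Kn + 8 `^ p^-1) * N ^+ 2.
  apply: (@le_trans _ _ (E (fun t => (Kn + 8 `^ p^-1) * N `^ (2 - r) * phi t `^ r))).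
    apply: le_expect => //.
    - exact: (bmf_expect2 mI fI bF).
    - apply: bmfM; first exact: bmf_cst.
      by apply: bmf_powR => //; exact: ltW.
    move=> t tI; apply: le_trans (half phi0 bphi N0 hN tI).
    rewrite -expectZl//; last first.
      apply: bmf_ifT; last exact: bmf_cst.
        by apply: measurable_fun_ler; [case: bphi|exact: measurable_cst].
      by apply: bmfM.
    rewrite le_eqVlt; apply/orP; left; apply/eqP; apply: eq_expect => s _.
    by rewrite /F/=; case: ifP => _; rewrite ?mulr0.
  rewrite expectZl//; last by apply: bmf_powR => //; exact: ltW.
  have c0 : 0 <= (Kn + 8 `^ p^-1) * N `^ (2 - r).
    by rewrite mulr_ge0 ?powR_ge0// addr_ge0 ?powR_ge0// (le_trans _ hls_near_const_ge2).
  apply: (le_trans (ler_wpM2l c0 hN)).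
  rewrite -mulrA -powRD ?(gt_eqF N0) ?implybT// subrK powR_mulrn//.
  exact: ltW.
have sym (x y : R) : phi x * (k (x - y) * phi y) = phi y * (k (y - x) * phi x).
  by rewrite -[y - x]opprB hls_kernelN; ring.
have ge0 (z : R * R) : 0 <= phi z.1 * (k (z.1 - z.2) * phi z.2).
  by rewrite mulr_ge0// mulr_ge0// hls_kernel_ge0.
have := @expect_symmetrize _ RT R mu I mI fI (fun z : R * R => phi z.1 * (k (z.1 - z.2) * phi z.2))
  phi bF0 bphi ge0 sym.
have -> : E (fun t => phi t * E (fun s => k (t - s) * phi s)) =
    E (fun t => E (fun s => phi t * (k (t - s) * phi s))).
  by apply: eq_expect => t _; rewrite (expectZl _ _ _ (bmfM (bmf_ksub t) bphi)).
move=> /le_trans; apply.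
have -> : hls_const * N ^+ 2 = 2 * ((Kn + 8 `^ p^-1) * N ^+ 2).
  by rewrite /hls_const mulrA.
exact: (ler_wpM2l (ler0n R 2) EF).
Qed.

End HardyLittlewoodSobolev.

(** * Duality *)

(** The duality argument is run for an abstract superposition: the torus and the equation enter only
    through a Bessel inequality for the [e k], unimodular phases [a k], and a kernel bound. *)
Definition evol (S T X : Type) (R : realType) (ks : seq X) (e : X -> T -> R[i])
  (a : X -> S -> R[i]) (c : X -> R[i]) (z : S * T) : R[i] :=
  \sum_(k <- ks) c k * a k z.1 * e k z.2.

Section TTstar.
Context dS (S : measurableType dS) dT (T : measurableType dT) (R : realType)
  (nu : {sigma_finite_measure set S -> \bar R}) (I : set S)
  (mu : {sigma_finite_measure set T -> \bar R}) (D : set T).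
Hypotheses (mI : measurable I) (fI : (nu I < +oo)%E).
Hypotheses (mD : measurable D) (fD : (mu D < +oo)%E).
Context (X : Type) (ks : seq X) (e : X -> T -> R[i]) (a : X -> S -> R[i]).
Variables (p q V H : R) (b : S * S -> R).
Hypotheses (pq : p^-1 + q^-1 = 2^-1) (p2 : 2 < p) (V0 : 0 <= V) (H0 : 0 <= H).
Hypotheses (ce : forall k, cbm (e k)) (ca : forall k, cbm (a k)).
Hypothesis a1 : forall k t, nc (a k t) = 1.

Local Notation Et f := (Rintegral nu I f).
Local Notation Ex f := (Rintegral mu D f).
Local Notation CEt f := (cexpect nu I f).
Local Notation CEx f := (cexpect mu D f).

Definition coef (g : T -> R[i]) (k : X) : R[i] := CEx (fun x => g x * conjc (e k x)).

Hypothesis bessel : forall g, cbm g ->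
  \sum_(k <- ks) nc (coef g k) ^+ 2 <= V * Ex (fun x => nc (g x) ^+ 2).
Hypothesis b0 : forall z, 0 < b z.
Hypothesis bb : bmf (fun z => b z `^ (2 / p)).
Hypothesis dispersive : forall t s x y, I t -> I s ->
  nc (\sum_(k <- ks) a k t * conjc (a k s) * e k x * conjc (e k y)) <= b (t, s).
Hypothesis hls : forall (phi : S -> R) (N : R), (forall t, 0 <= phi t) -> bmf phi ->
  0 < N -> Et (fun s => phi s `^ (p / (p - 1))) <= N `^ (p / (p - 1)) ->
  Et (fun t => phi t * Et (fun s => b (t, s) `^ (2 / p) * phi s)) <= H * N ^+ 2.

Let p0 : 0 < p. Proof. by apply: lt_trans p2. Qed.
Let pn0 : p != 0. Proof. by rewrite gt_eqF. Qed.
Let qV : q^-1 = 2^-1 - p^-1. Proof. by rewrite -pq; ring. Qed.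
Let pV : p^-1 < 2^-1. Proof. by rewrite ltf_pV2 ?posrE. Qed.
Let q0 : 0 < q. Proof. by rewrite -invr_gt0 qV subr_gt0. Qed.
Let qn0 : q != 0. Proof. by rewrite gt_eqF. Qed.
Let q2 : 2 < q.
Proof. by rewrite -ltf_pV2 ?posrE// qV gtrBl invr_gt0. Qed.
Let r := q / (q - 1).
Let qm1 : 0 < q - 1. Proof. by move: q2; lra. Qed.
Let r12 : 1 < r < 2.
Proof.
apply/andP; split; rewrite /r; first by rewrite ltr_pdivlMr// mul1r gtrBl.
by rewrite ltr_pdivrMr// mulrBr mulr1; move: q2; lra.
Qed.
Let qm1n : q - 1 != 0. Proof. by rewrite gt_eqF. Qed.
Let rE : 2 / r - 1 = 2 / p.
Proof.
have -> : 2 / p = 1 - 2 / q by rewrite qV; field.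
by rewrite /r; field; rewrite ?qn0 ?qm1n.
Qed.

(** This is the kernel of [T T*] at the times [t] and [s], applied to [g] and paired with [h]. *)
Definition form (t s : S) (g h : T -> R[i]) : R[i] :=
  \sum_(k <- ks) a k t * conjc (a k s) * (coef g k * conjc (coef h k)).

Let cge g k : cbm g -> cbm (fun x => g x * conjc (e k x)).
Proof. by move=> cg; apply: cbmM => //; exact: cbm_conj. Qed.

Let coefD g1 g2 k : cbm g1 -> cbm g2 ->
  coef (fun x => g1 x + g2 x) k = coef g1 k + coef g2 k.
Proof.
move=> c1 c2; rewrite /coef -(cexpectD mD fD (cge k c1) (cge k c2)).
by apply: eq_cexpect => x _; rewrite mulrDl.
Qed.

Let formDl t s g1 g2 h : cbm g1 -> cbm g2 -> cbm h ->
  form t s (fun x => g1 x + g2 x) h = form t s g1 h + form t s g2 h.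
Proof.
move=> c1 c2 ch; rewrite /form -big_split; apply: eq_bigr => k _.
by rewrite (coefD k c1 c2) mulrDl mulrDr.
Qed.

Let formDr t s g h1 h2 : cbm g -> cbm h1 -> cbm h2 ->
  form t s g (fun x => h1 x + h2 x) = form t s g h1 + form t s g h2.
Proof.
move=> cg c1 c2; rewrite /form -big_split; apply: eq_bigr => k _.
by rewrite (coefD k c1 c2) conjcD mulrDr mulrDr.
Qed.

(** The phases are unimodular, so Cauchy-Schwarz in [k] leaves two sums to which Bessel's inequality
    applies. *)
Let form2 t s g h : cbm g -> cbm h ->
  nc (form t s g h) ^+ 2 <=
  (V * Ex (fun x => nc (g x) ^+ 2)) * (V * Ex (fun x => nc (h x) ^+ 2)).
Proof.
move=> cg ch.
have -> : form t s g h = \sum_(k <- ks) (a k t * conjc (a k s) * coef g k) * conjc (coef h k).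
  by apply: eq_bigr => k _; rewrite mulrA.
apply: (le_trans (nc_cauchy_schwarz _ _ _)).
apply: ler_pM.
- by apply: sumr_ge0 => k _; exact: sqr_ge0.
- by apply: sumr_ge0 => k _; exact: sqr_ge0.
- apply: le_trans (bessel cg); rewrite le_eqVlt; apply/orP; left; apply/eqP.
  by apply: eq_bigr => k _; rewrite !Normc.normcM nc_conjc !a1 !mul1r.
- apply: le_trans (bessel ch); rewrite le_eqVlt; apply/orP; left; apply/eqP.
  by apply: eq_bigr => k _; rewrite nc_conjc.
Qed.

(** Exchanging sum and integrals displays the space kernel of the form, which the dispersive
    hypothesis bounds uniformly. *)
Let form1 t s g h : I t -> I s -> cbm g -> cbm h ->
  nc (form t s g h) <= b (t, s) * (Ex (fun x => nc (g x)) * Ex (fun x => nc (h x))).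
Proof.
move=> It Is cg ch.
pose inner x := \sum_(k <- ks) a k t * conjc (a k s) * e k x * coef g k.
have cinner : cbm inner.
  by apply: cbm_sum => k _; apply: cbmM; [apply: cbmM => //|]; exact: cbm_cst.
have formE : form t s g h = CEx (fun x => inner x * conjc (h x)).
  transitivity (CEx (fun x => \sum_(k <- ks)
      a k t * conjc (a k s) * coef g k * conjc (h x * conjc (e k x)))).
    rewrite (cexpect_sum mD fD); last first.
      by move=> k _; apply: cbmM; [exact: cbm_cst|exact/cbm_conj/cge].
    apply: eq_bigr => k _; rewrite (cexpectZl mD fD); last exact/cbm_conj/cge.
    by rewrite (cexpect_conj mD fD (cge k ch)) -/(coef h k) mulrA.
  apply: eq_cexpect => x _; rewrite /inner mulr_suml; apply: eq_bigr => k _.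
  by rewrite conjcM conjcK; ring.
have inner_le x : nc (inner x) <= b (t, s) * Ex (fun y => nc (g y)).
  have -> : inner x = CEx (fun y => g y *
      \sum_(k <- ks) a k t * conjc (a k s) * e k x * conjc (e k y)).
    transitivity (CEx (fun y => \sum_(k <- ks)
        a k t * conjc (a k s) * e k x * (g y * conjc (e k y)))).
      rewrite (cexpect_sum mD fD); last first.
        by move=> k _; apply: cbmM; [exact: cbm_cst|exact/cge].
      by apply: eq_bigr => k _; rewrite (cexpectZl mD fD)//; exact/cge.
    apply: eq_cexpect => y _; rewrite mulr_sumr; apply: eq_bigr => k _; ring.
  have cin : cbm (fun y => g y *
      \sum_(k <- ks) a k t * conjc (a k s) * e k x * conjc (e k y)).
    apply: cbmM => //; apply: cbm_sum => k _.
    by apply: cbmM; [exact: cbm_cst|exact: cbm_conj].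
  apply: (le_trans (nc_cexpect mD fD cin)).
  rewrite -(expectZl mD fD _ (bmf_nc cg)).
  apply: (le_expect mD fD (bmf_nc cin) (bmfM (bmf_cst _ _) (bmf_nc cg))) => y _.
  by rewrite Normc.normcM mulrC ler_wpM2r ?nc_ge0// dispersive.
rewrite formE; have cih := cbmM cinner (cbm_conj ch).
apply: (le_trans (nc_cexpect mD fD cih)).
rewrite mulrA -(expectZl mD fD _ (bmf_nc ch)).
apply: (le_expect mD fD (bmf_nc cih) (bmfM (bmf_cst _ _) (bmf_nc ch))) => x _.
by rewrite Normc.normcM nc_conjc ler_wpM2r ?nc_ge0.
Qed.

Definition interp_const : R := V * (1 + (1 - 2 `^ (q / (q - 1) - 2))^-1) + 2.

Lemma interp_const_ge0 : 0 <= interp_const.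
Proof.
have /andP[_ r2] := r12.
rewrite addr_ge0// mulr_ge0// addr_ge0// invr_ge0 subr_ge0 -/r.
by rewrite -[leRHS](powRr0 2) ler_powR ?ler1n// subr_le0 ltW.
Qed.

(** Interpolation at the exponent [r] conjugate to [q]; its power of the dispersive constant is
    [2 / r - 1 = 1 - 2 / q = 2 / p], by admissibility. *)
Let form_le t s g h : I t -> I s -> cbm g -> cbm h ->
  Ex (fun x => nc (g x) `^ r) <= 1 -> Ex (fun x => nc (h x) `^ r) <= 1 ->
  nc (form t s g h) <= interp_const * b (t, s) `^ (2 / p).
Proof.
move=> It Is cg ch eg eh; rewrite -rE.
apply: (@interpolation _ T R mu D mD fD (form t s) V (b (t, s)) r) => //.
- by move=> g1 g2 h'; exact: formDl.
- by move=> g' h1 h2; exact: formDr.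
- by move=> g' h'; exact: form2.
- by move=> g' h'; exact: form1.
Qed.

Variable c : X -> R[i].

Local Notation evol := (evol ks e a c).

Lemma cbm_evol : cbm evol.
Proof.
apply: cbm_sum => k _; apply: cbmM; first (apply: cbmM; first exact: cbm_cst).
  exact: (cbm_comp measurable_fst (ca k)).
exact: (cbm_comp measurable_snd (ce k)).
Qed.

Definition evolQ (t : S) : R := Ex (fun x => nc (evol (t, x)) `^ q).
Local Notation Q := evolQ.

Let bnq : bmf (fun z => nc (evol z) `^ q).
Proof. exact: (bmf_nc_powR (ltW q0) cbm_evol). Qed.

Lemma bmf_evolQ : bmf Q.
Proof. exact: (bmf_expect2 mD fD bnq). Qed.

Lemma evolQ_ge0 t : 0 <= Q t.
Proof. by apply: expect_ge0 => x _; exact: powR_ge0. Qed.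

Section Cutoff.
Variable eta : R.
Hypothesis eta0 : 0 < eta.

(* The dual function of the [T T*] argument contains a negative power of [Q], so
   the times at which [Q < eta] are discarded first. *)
Let Qcut s (t : S) : R := if eta <= Q t then Q t `^ s else 0.

Let meta : measurable_fun setT (fun t => eta <= Q t).
Proof. by apply: measurable_fun_ler; [exact: measurable_cst|exact: (proj1 bmf_evolQ)]. Qed.

Let Qcut_ge0 s t : 0 <= Qcut s t.
Proof. by rewrite /Qcut; case: ifP => // _; exact: powR_ge0. Qed.

Let bmf_Qcut s : bmf (Qcut s).
Proof.
have mQ : measurable_fun setT (Qcut s).
  apply: measurable_fun_ifT => //.
  exact: (measurableT_comp (measurable_powR s) (proj1 bmf_evolQ)).
have [M [M0 QM]] := bmf_bound bmf_evolQ.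
split=> //; exists (eta `^ s + M `^ s) => t; rewrite ger0_norm//.
have QMt : Q t <= M by rewrite (le_trans _ (QM t))// ler_norm.
rewrite /Qcut; case: ifP => [eQ|_]; last by rewrite addr_ge0 ?powR_ge0.
have Qp : 0 < Q t := lt_le_trans eta0 eQ.
have [s0|s0] := leP 0 s.
  rewrite ler_wpDl ?powR_ge0//.
  by apply: ge0_ler_powR; rewrite ?nnegrE// ltW.
rewrite ler_wpDr ?powR_ge0// -[s]opprK !(powRN _ (- s)) lef_pV2 ?posrE ?powR_gt0//.
by apply: ge0_ler_powR; rewrite ?nnegrE ?oppr_ge0// ltW.
Qed.

(** [G = w * evol] is the extremal function of [L^q] duality at each retained time: its [L^r] norm
    is at most [1] and its pairing with the evolution is [Q ^ (1 / q)]. *)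
Let w (z : S * T) : R := nc (evol z) `^ (q - 2) * Qcut (- (1 - q^-1)) z.1.

Let bw : bmf w.
Proof.
apply: bmfM; last exact: (bmf_comp measurable_fst (bmf_Qcut _)).
by apply: (bmf_nc_powR _ cbm_evol); rewrite subr_ge0 ltW.
Qed.

Let G (z : S * T) : R[i] := (w z)%:C * evol z.

Let cG : cbm G. Proof. exact: (cbmM (cbm_real bw) cbm_evol). Qed.

Let cGt t : cbm (fun x => G (t, x)).
Proof. exact: (cbm_comp (pair1_measurable t) cG). Qed.

Let ncG z : nc (G z) = nc (evol z) `^ (q - 1) * Qcut (- (1 - q^-1)) z.1.
Proof.
rewrite /G Normc.normcM nc_real ger0_norm; last first.
  by rewrite mulr_ge0 ?powR_ge0.
have := @mulr_powRB1 R (nc (evol z)) (q - 1) (nc_ge0 _) qm1.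
have -> : q - 1 - 1 = q - 2 :> R by ring.
by move=> <-; rewrite /w; ring.
Qed.

Let G_norm t : Ex (fun x => nc (G (t, x)) `^ r) <= 1.
Proof.
have -> : Ex (fun x => nc (G (t, x)) `^ r) =
    Qcut (- (1 - q^-1)) t `^ r * Q t.
  rewrite -(expectZl mD fD _ (bmf_pair1 t bnq)); apply: eq_expect => x _.
  rewrite ncG powRM ?powR_ge0// -powRrM.
  have -> : (q - 1) * r = q by rewrite /r; field.
  exact: mulrC.
rewrite /Qcut; case: ifP => [eQ|_]; last first.
  by rewrite powR0 ?mul0r//; case/andP: r12 => r1 _; rewrite gt_eqF// (lt_trans _ r1).
have Qp : 0 < Q t := lt_le_trans eta0 eQ.
rewrite -powRrM.
have -> : - (1 - q^-1) * r = -1 by rewrite /r; field; rewrite ?qn0 ?qm1n.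
by rewrite powR_inv1 ?mulVf ?gt_eqF// ltW.
Qed.

(** The extremal weight for duality in time, namely the power [p - 1] of the spatial norm
    [Q ^ (1 / q)]. The integrals in time of the [beta k] are the conjugates of the coefficients of
    [T*] applied to [phi * G]. *)
Let phi := Qcut ((p - 1) / q).
Let beta k t := (phi t)%:C * a k t * conjc (coef (fun x => G (t, x)) k).

Let cbeta k : cbm (beta k).
Proof.
apply: cbmM; first by apply: cbmM => //; exact: (cbm_real (bmf_Qcut _)).
apply: cbm_conj.
apply: (@cbm_cexpect2 _ _ S T R mu D (fun z => G z * conjc (e k z.2)) mD fD).
by apply: cbmM => //; apply: cbm_conj; exact: (cbm_comp measurable_snd (ce k)).
Qed.

Let Y := Et (Qcut (p / q)).

Let Y_ge0 : 0 <= Y. Proof. by apply: expect_ge0 => t _. Qed.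

Let sum_beta t : \sum_(k <- ks) c k * beta k t = (Qcut (p / q) t)%:C.
Proof.
have dual : \sum_(k <- ks) c k * a k t * conjc (coef (fun x => G (t, x)) k) =
    (Qcut (- (1 - q^-1)) t * Q t)%:C.
  have -> : \sum_(k <- ks) c k * a k t * conjc (coef (fun x => G (t, x)) k) =
      CEx (fun x => evol (t, x) * conjc (G (t, x))).
    transitivity (CEx (fun x => \sum_(k <- ks)
        c k * a k t * conjc (G (t, x) * conjc (e k x)))).
      rewrite (cexpect_sum mD fD); last first.
        by move=> k _; apply: cbmM; [exact: cbm_cst|exact: (cbm_conj (cge k (cGt t)))].
      apply: eq_bigr => k _; rewrite (cexpectZl mD fD); last exact: (cbm_conj (cge k (cGt t))).
      by rewrite (cexpect_conj mD fD (cge k (cGt t))).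
    apply: eq_cexpect => x _; rewrite /evol mulr_suml; apply: eq_bigr => k _.
    by rewrite conjcM conjcK; ring.
  transitivity (CEx (fun x => (Qcut (- (1 - q^-1)) t * nc (evol (t, x)) `^ q)%:C)).
    apply: eq_cexpect => x _; rewrite /G conjcM conjc_real mulrCA mul_conjc.
    rewrite -realcM; congr (_%:C); rewrite /w/=.
    have -> : nc (evol (t, x)) `^ q = nc (evol (t, x)) `^ (q - 2) * nc (evol (t, x)) ^+ 2.
      rewrite -powR_mulrn ?nc_ge0// -powR_split ?nc_ge0//.
        by rewrite subrK.
      by rewrite subrK.
    by ring.
  rewrite cexpect_real// (expectZl mD fD)//; exact: (bmf_pair1 t bnq).
have -> : \sum_(k <- ks) c k * beta k t =
    (phi t)%:C * \sum_(k <- ks) c k * a k t * conjc (coef (fun x => G (t, x)) k).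
  by rewrite mulr_sumr; apply: eq_bigr => k _; rewrite /beta; ring.
rewrite dual -realcM; congr (_%:C); rewrite /phi /Qcut.
case: ifP => [eQ|_]; last by rewrite mul0r.
have Qp : 0 < Q t := lt_le_trans eta0 eQ.
rewrite -{3}(powRr1 (ltW Qp)) -!powRD ?(gt_eqF Qp) ?implybT//; congr (_ `^ _).
by field.
Qed.

Let bk k := CEt (beta k).

Let Y_sqr : Y ^+ 2 <= (\sum_(k <- ks) nc (c k) ^+ 2) * (\sum_(k <- ks) nc (bk k) ^+ 2).
Proof.
apply: le_trans (nc_cauchy_schwarz _ _ _).
have -> : \sum_(k <- ks) c k * bk k = Y%:C.
  rewrite -(cexpect_real nu mI).
  transitivity (CEt (fun t => \sum_(k <- ks) c k * beta k t)).
    rewrite (cexpect_sum mI fI); last first.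
      by move=> k _; exact: (cbmM (cbm_cst _ _) (cbeta k)).
    by apply: eq_bigr => k _; rewrite (cexpectZl mI fI _ (cbeta k)).
  by apply: eq_cexpect => t _; rewrite sum_beta.
by rewrite nc_real ger0_norm.
Qed.

Let mul_pairing (x A u y B v : R[i]) :
  x * A * u * (y * B * v) = x * y * (A * B * (v * u)).
Proof. ring. Qed.

Let mul_interleave (x y A B : R) : x * y * (A * B) = A * x * (B * y).
Proof. ring. Qed.

(** The [T T*] step: the square of the dual coefficients unfolds into a double time integral of
    [phi t * phi s] against [form t s], which [form_le] bounds pointwise in the two times. *)
Let sum_bk : \sum_(k <- ks) nc (bk k) ^+ 2 <=
  interp_const * Et (fun t => phi t * Et (fun s => b (t, s) `^ (2 / p) * phi s)).
Proof.
have bphi : bmf phi by exact: bmf_Qcut.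
have bkp : bmf (fun z : S * S => b z `^ (2 / p) * phi z.2).
  exact: (bmfM bb (bmf_comp measurable_snd bphi)).
have bin : bmf (fun t => Et (fun s => b (t, s) `^ (2 / p) * phi s)).
  exact: (bmf_expect2 mI fI bkp).
have bout : bmf (fun t => interp_const * (phi t * Et (fun s => b (t, s) `^ (2 / p) * phi s))).
  exact: (bmfM (bmf_cst _ _) (bmfM bphi bin)).
have -> : \sum_(k <- ks) nc (bk k) ^+ 2 =
    nc (\sum_(k <- ks) bk k * conjc (bk k)).
  rewrite sum_sqr_nc nc_real ger0_norm//.
  by apply: sumr_ge0 => k _; exact: sqr_ge0.
have -> : \sum_(k <- ks) bk k * conjc (bk k) =
    CEt (fun t => \sum_(k <- ks) beta k t * conjc (bk k)).
  rewrite (cexpect_sum mI fI); last by move=> k _; exact: (cbmM (cbeta k) (cbm_cst _ _)).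
  by apply: eq_bigr => k _; rewrite (cexpectZr mI fI _ (cbeta k)).
have cs : cbm (fun t => \sum_(k <- ks) beta k t * conjc (bk k)).
  by apply: cbm_sum => k _; exact: (cbmM (cbeta k) (cbm_cst _ _)).
apply: (le_trans (nc_cexpect mI fI cs)).
rewrite -(expectZl mI fI _ (bmfM bphi bin)).
apply: (le_expect mI fI (bmf_nc cs) bout) => t It.
have -> : \sum_(k <- ks) beta k t * conjc (bk k) =
    CEt (fun s => \sum_(k <- ks) beta k t * conjc (beta k s)).
  rewrite (cexpect_sum mI fI); last first.
    by move=> k _; exact: (cbmM (cbm_cst _ _) (cbm_conj (cbeta k))).
  apply: eq_bigr => k _; rewrite (cexpectZl mI fI _ (cbm_conj (cbeta k))).
  by rewrite (cexpect_conj mI fI (cbeta k)).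
have cs' : cbm (fun s => \sum_(k <- ks) beta k t * conjc (beta k s)).
  by apply: cbm_sum => k _; exact: (cbmM (cbm_cst _ _) (cbm_conj (cbeta k))).
apply: (le_trans (nc_cexpect mI fI cs')).
rewrite mulrA -(expectZl mI fI _ (bmf_pair1 t bkp)).
apply: (le_expect mI fI (bmf_nc cs') (bmfM (bmf_cst _ _) (bmf_pair1 t bkp))) => s Is.
have -> : \sum_(k <- ks) beta k t * conjc (beta k s) =
    (phi t * phi s)%:C * form t s (fun x => G (s, x)) (fun x => G (t, x)).
  rewrite /form mulr_sumr; apply: eq_bigr => k _.
  rewrite /beta !conjcM conjcK conjc_real realcM; exact: mul_pairing.
have pp : 0 <= phi t * phi s by exact: (mulr_ge0 (Qcut_ge0 _ _) (Qcut_ge0 _ _)).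
rewrite Normc.normcM nc_real ger0_norm//.
have := ler_wpM2l pp (form_le It Is (cGt s) (cGt t) (G_norm s) (G_norm t)).
move=> /le_trans; apply; rewrite le_eqVlt; apply/orP; left; apply/eqP.
exact: mul_interleave.
Qed.

Lemma cutoff_strichartz :
  Y <= (interp_const * H * \sum_(k <- ks) nc (c k) ^+ 2) `^ (p / 2).
Proof.
have [->|Yn0] := eqVneq Y 0; first exact: powR_ge0.
have Yp : 0 < Y by rewrite lt_neqAle eq_sym Yn0.
have pm1 : 0 < p - 1 by move: p2; lra.
have pm1n : p - 1 != 0 by rewrite gt_eqF.
(* This is the norm of [phi] in the exponent conjugate to [p], because that power of [phi] is the
   integrand of [Y]. The outcome [Y ^ 2 <= const * Y ^ (2 - 2 / p)] is then divided by [N ^ 2],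
   which is legitimate as [Y] is finite and positive. *)
pose N := Y `^ ((p - 1) / p).
have N0 : 0 < N by exact: powR_gt0.
have bphi : bmf phi by exact: bmf_Qcut.
have hN : Et (fun s => phi s `^ (p / (p - 1))) <= N `^ (p / (p - 1)).
  rewrite /N -powRrM (_ : (p - 1) / p * (p / (p - 1)) = 1); last by field; rewrite ?pn0 ?pm1n.
  rewrite powRr1// le_eqVlt; apply/orP; left; apply/eqP.
  apply: eq_expect => t _; rewrite /phi /Qcut; case: ifP => _; last first.
    by rewrite powR0// mulf_neq0// invr_neq0.
  by rewrite -powRrM; congr (_ `^ _); field; rewrite pm1n qn0.
have h := hls (Qcut_ge0 _) bphi N0 hN.
have := Y_sqr; set Sc := \sum_(k <- ks) nc (c k) ^+ 2 => Y_Sc.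
have Sc0 : 0 <= Sc by apply: sumr_ge0 => k _; exact: sqr_ge0.
have Y2 : Y ^+ 2 <= interp_const * H * Sc * N ^+ 2.
  apply: (le_trans Y_Sc).
  rewrite (_ : interp_const * H * Sc * N ^+ 2 = Sc * (interp_const * (H * N ^+ 2))); last by ring.
  by rewrite ler_wpM2l// (le_trans sum_bk)// ler_wpM2l// interp_const_ge0.
have N2 : N ^+ 2 = Y `^ (2 - 2 / p).
  by rewrite /N -powR_mulrn ?powR_ge0// -powRrM; congr (_ `^ _); field.
have Y2E : Y ^+ 2 = Y `^ (2 / p) * N ^+ 2.
  rewrite N2 -powRD ?(gt_eqF Yp) ?implybT// -powR_mulrn ?(ltW Yp)//.
  by congr (_ `^ _); field.
move: Y2; rewrite Y2E ler_pM2r ?exprn_gt0// => Y2.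
have -> : Y = (Y `^ (2 / p)) `^ (p / 2).
  rewrite -powRrM (_ : 2 / p * (p / 2) = 1) ?powRr1 ?(ltW Yp)//; field.
  by rewrite pn0.
apply: ge0_ler_powR; rewrite ?nnegrE ?powR_ge0 ?divr_ge0 ?(ltW p0)//.
by rewrite (le_trans _ Y2)// powR_ge0.
Qed.

End Cutoff.

(** The times discarded by the cutoff contribute at most [eta ^ (p / q)] times the length of [I],
    which is made arbitrarily small. *)
Theorem abstract_strichartz :
  Et (fun t => Q t `^ (p / q)) <=
  (interp_const * H * \sum_(k <- ks) nc (c k) ^+ 2) `^ (p / 2).
Proof.
set L := Et _; set M := _ `^ _.
have pq0 : 0 < p / q by rewrite divr_gt0.
have bQ : bmf (fun t => Q t `^ (p / q)).
  exact: (bmf_powR evolQ_ge0 (ltW pq0) bmf_evolQ).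
have step eta : 0 < eta -> L <= M + eta `^ (p / q) * fine (nu I).
  move=> eta0; rewrite -(expect_cst nu mI).
  have mc : measurable_fun setT (fun t => eta <= Q t).
    by apply: measurable_fun_ler; [exact: measurable_cst|exact: (proj1 bmf_evolQ)].
  have bc : bmf (fun t => if eta <= Q t then Q t `^ (p / q) else 0).
    by apply: bmf_ifT => //; exact: bmf_cst.
  apply: le_trans (lerD (cutoff_strichartz eta0) (lexx _)).
  rewrite -(expectD mI fI bc (bmf_cst _ _)).
  apply: (le_expect mI fI bQ (bmfD bc (bmf_cst _ _))) => t _.
  case: ifPn => [_|]; first by rewrite lerDl powR_ge0.
  rewrite -ltNge add0r => /ltW h.
  by apply: ge0_ler_powR; rewrite ?nnegrE ?evolQ_ge0// ltW.
apply/ler_addgt0Pl => d d0.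
have m0 : 0 <= fine (nu I) by exact: fine_ge0.
have m1 : 0 < fine (nu I) + 1 by rewrite ltr_wpDl.
pose eta := (d / (fine (nu I) + 1)) `^ (q / p).
have eta0 : 0 < eta by rewrite powR_gt0// divr_gt0.
rewrite addrC; apply: (le_trans (step eta eta0)); rewrite lerD2l.
have -> : eta `^ (p / q) = d / (fine (nu I) + 1).
  rewrite /eta -powRrM (_ : q / p * (p / q) = 1) ?powRr1 ?divr_ge0 ?(ltW d0) ?(ltW m1)//.
  by field; rewrite pn0 qn0.
by rewrite mulrAC ler_pdivrMr// ler_pM2l// lerDl.
Qed.

End TTstar.

(** * Plane waves on the torus *)

Section ProductExpectation.
Context d1 d2 (T1 : measurableType d1) (T2 : measurableType d2) (R : realType)
  (m1 : {sigma_finite_measure set T1 -> \bar R})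
  (m2 : {sigma_finite_measure set T2 -> \bar R})
  (D1 : set T1) (D2 : set T2).
Hypotheses (mD1 : measurable D1) (fD1 : (m1 D1 < +oo)%E).
Hypotheses (mD2 : measurable D2) (fD2 : (m2 D2 < +oo)%E).

Lemma product_measure_rectangle : (m1 \x m2)%E (D1 `*` D2) = (m1 D1 * m2 D2)%E.
Proof. exact: product_measure1E. Qed.

Lemma product_measure_finite : ((m1 \x m2)%E (D1 `*` D2) < +oo)%E.
Proof. by rewrite product_measure_rectangle lte_mul_pinfty// ge0_fin_numE. Qed.

Let expect_product_ge0 (f : T1 * T2 -> R) : bmf f -> (forall z, 0 <= f z) ->
  Rintegral (m1 \x m2)%E (D1 `*` D2) f =
  Rintegral m1 D1 (fun x => Rintegral m2 D2 (fun y => f (x, y))).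
Proof.
move=> bf f0; rewrite {1 2}/Rintegral; congr fine.
pose g (z : T1 * T2) := (f z * (\1_D1 z.1 * \1_D2 z.2))%:E.
have g0 z : (0 <= g z)%E by rewrite lee_fin !mulr_ge0.
have mg : measurable_fun setT g.
  apply/measurable_EFinP/measurable_funM; first by have [] := bf.
  apply: measurable_funM.
    exact: (measurableT_comp (measurable_indic mD1) measurable_fst).
  exact: (measurableT_comp (measurable_indic mD2) measurable_snd).
transitivity (\int[m1 \x m2]_z g z)%E.
  rewrite integral_mkcond; apply: eq_integral => -[x y] _; rewrite patchE.
  rewrite in_setX /g !indicE/=.
  by case: (x \in D1); case: (y \in D2); rewrite /= ?mulr1 ?mulr0.
rewrite (fubini_tonelli1 _ mg g0) [RHS]integral_mkcond.
apply: eq_integral => x _; rewrite patchE /fubini_F.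
case: ifPn => xD; last first.
  rewrite integral0_eq// => y _.
  by rewrite /g indicE/= (negbTE xD) mul0r mulr0.
rewrite -(EFin_expect mD2 fD2 (bmf_pair1 x bf)).
rewrite [RHS]integral_mkcond; apply: eq_integral => y _; rewrite patchE.
by rewrite /g !indicE/= xD mul1r; case: ifP => _; rewrite ?mulr1 ?mulr0.
Qed.

(** Reduced to the nonnegative case by adding a bound of [f] and subtracting its integral on both
    sides. *)
Lemma expect_product (f : T1 * T2 -> R) : bmf f ->
  Rintegral (m1 \x m2)%E (D1 `*` D2) f =
  Rintegral m1 D1 (fun x => Rintegral m2 D2 (fun y => f (x, y))).
Proof.
move=> bf; have [M [M0 fM]] := bmf_bound bf.
have mD : measurable (D1 `*` D2) by exact: measurableX.
have bfM : bmf (fun z => f z + M) by exact: (bmfD bf (bmf_cst _ _)).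
have fM0 z : 0 <= f z + M.
  by have := fM z; rewrite ler_norml => /andP[h _]; rewrite -lerBlDr sub0r.
have := expect_product_ge0 bfM fM0.
rewrite (expectD mD product_measure_finite bf (bmf_cst _ _)).
have -> : Rintegral m1 D1 (fun x => Rintegral m2 D2 (fun y => f (x, y) + M)) =
    Rintegral m1 D1 (fun x => Rintegral m2 D2 (fun y => f (x, y))) +
    Rintegral (m1 \x m2)%E (D1 `*` D2) (fun=> M).
  rewrite (expect_product_ge0 (bmf_cst _ M) (fun=> ltW M0)).
  rewrite -(expectD mD1 fD1 (bmf_expect2 mD2 fD2 bf) (bmf_expect2 mD2 fD2 (bmf_cst _ _))).
  apply: eq_expect => x _.
  by rewrite (expectD mD2 fD2 (bmf_pair1 x bf) (bmf_cst _ _)).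
by move/addIr.
Qed.

Lemma cexpect_product (f : T1 * T2 -> R[i]) : cbm f ->
  cexpect (m1 \x m2)%E (D1 `*` D2) f =
  cexpect m1 D1 (fun x => cexpect m2 D2 (fun y => f (x, y))).
Proof.
move=> [b1 b2]; apply: complex_ext => /=; first exact: (expect_product b1).
exact: (expect_product b2).
Qed.

End ProductExpectation.

Section TorusMeasure.
Context (R : realType).
Local Notation RT := (measurableTypeR R).
Local Notation leb := (@lebesgue_measure R).

Let sigma_finite_area : sigma_finite [set: (RT * RT)%type] (leb \x leb)%E.
Proof.
have /sigma_finiteP[F [TF ndF Foo]] := sigma_finiteT leb.
exists (fun n => F n `*` F n).
  rewrite -setXTT {1}TF {1}TF predeqE => -[x y]; split.
    move=> [/= [n _ Fnx] [k _ Gky]]; exists (maxn n k) => //; split.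
    - by move: x Fnx; exact/subsetPset/ndF/leq_maxl.
    - by move: y Gky; exact/subsetPset/ndF/leq_maxr.
  by move=> [n _ []/= ? ?]; split; exists n.
move=> k; have [? ?] := Foo k.
split; first exact: measurableX.
by rewrite (product_measure1E leb leb)// lte_mul_pinfty// ge0_fin_numE.
Qed.

(** The same product measure, carrying the proof of sigma-finiteness that Fubini's theorem in time
    and space asks for. *)
Definition torus_measure : {sigma_finite_measure set (RT * RT)%type -> \bar R} :=
  HB.pack_for {sigma_finite_measure set (RT * RT)%type -> \bar R} (leb \x leb)%E
    (Measure_isSigmaFinite.Build _ _ _ (leb \x leb)%E sigma_finite_area).

End TorusMeasure.

Section Torus.
Context {R : realType}.
Local Notation RT := (measurableTypeR R).
Local Notation leb := (@lebesgue_measure R).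
Local Notation area := (torus_measure R).
Local Notation period := (`[0%R, 2 * pi]%classic : set RT).

Definition torus_area : R := (2 * pi) ^+ 2.

Let pi20 : 0 < 2 * pi :> R. Proof. by rewrite mulr_gt0// pi_gt0. Qed.

Lemma torus_area_gt0 : 0 < torus_area. Proof. by rewrite exprn_gt0. Qed.

Lemma leb_period : leb period = (2 * pi)%:E.
Proof. by rewrite lebesgue_segment ?subr0// ltW. Qed.

Let mP : measurable period. Proof. exact: (@measurable_timeI R 0 (2 * pi)). Qed.
Let fP : (leb period < +oo)%E. Proof. by rewrite leb_period ltry. Qed.

Lemma measurable_torus_square : @measurable _ (RT * RT)%type (torus_square (R:=R)).
Proof. exact: (measurableX mP mP). Qed.

Lemma area_torus_square : area torus_square = torus_area%:E.
Proof.
transitivity ((2 * pi)%:E * (2 * pi)%:E : \bar R)%E; last by rewrite -EFinM -expr2.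
transitivity (leb period * leb period)%E; last by congr (_ * _)%E; exact: leb_period.
exact: (product_measure_rectangle _ _ mP mP).
Qed.

Lemma finite_torus_square : (area torus_square < +oo)%E.
Proof. by rewrite area_torus_square ltry. Qed.

Lemma int_cos_sin (m : int) : m != 0 ->
  Rintegral leb period (fun x : R => cos (m%:~R * x)) = 0 /\
  Rintegral leb period (fun x : R => sin (m%:~R * x)) = 0.
Proof.
move=> m0; set a : R := m%:~R; have a0 : a != 0 by rewrite intr_eq0.
have caff (x : R) : {for x, continuous (fun x : R => a * x)}.
  by apply: cvgM; [exact: cvg_cst|exact: cvg_id].
have dsin (x : R) : is_derive x 1 (fun x : R => a^-1 * sin (a * x)) (cos (a * x)).
  apply: is_derive_eq; rewrite /GRing.scale/= mulr1; field.
  exact: a0.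
have dcos (x : R) : is_derive x 1 (fun x : R => - a^-1 * cos (a * x)) (sin (a * x)).
  apply: is_derive_eq; rewrite /GRing.scale/= mulr1; field.
  exact: a0.
have ccos (x : R) : {for x, continuous (fun x : R => cos (a * x))}.
  exact: (@continuous_comp _ _ _ (fun x : R => a * x) cos x (caff x) (@continuous_cos R _)).
have csin (x : R) : {for x, continuous (fun x : R => sin (a * x))}.
  exact: (@continuous_comp _ _ _ (fun x : R => a * x) sin x (caff x) (@continuous_sin R _)).
have LR (F f : R -> R) : (forall x : R, is_derive x 1 F (f x)) ->
    derivable_oo_LRcontinuous F 0 (2 * pi) /\ {in `]0, 2 * pi[, F^`()%classic =1 f}.
  move=> dF; have cF x : {for x, continuous F}.
    by apply: differentiable_continuous; apply/derivable1_diffP; exact: ex_derive.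
  split; first split.
  - by move=> x _; exact: ex_derive.
  - by apply: cvg_at_right_filter; exact: cF.
  - by apply: cvg_at_left_filter; exact: cF.
  - by move=> x _; rewrite derive1E; exact: derive_val.
have e2pi (F : R -> R) : F (a * (2 * pi)) = F (2 * pi * m%:~R) by rewrite mulrC.
have c2pi : cos (a * (2 * pi)) = 1 /\ sin (a * (2 * pi)) = 0.
  have := @cis_2pi_int R m; rewrite mulrC -/a => h; split.
    by have := congr1 (@complex.Re R) h.
  by have := congr1 (@complex.Im R) h.
split; rewrite /Rintegral.
- have [h1 h2] := LR _ _ dsin.
  rewrite (continuous_FTC2 pi20 _ h1 h2).
    by rewrite c2pi.2 !mulr0 sin0 mulr0 /= subrr.
  by apply: continuous_subspaceT => x; exact: ccos.
- have [h1 h2] := LR _ _ dcos.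
  rewrite (continuous_FTC2 pi20 _ h1 h2).
    by rewrite c2pi.1 mulr0 cos0 /= subrr.
  by apply: continuous_subspaceT => x; exact: csin.
Qed.

Lemma measurable_mulR (a : R) : @measurable_fun _ _ RT R setT (fun x : R => a * x).
Proof. by apply: measurable_funM; [exact: measurable_cst|exact: measurable_idR]. Qed.

Lemma cexpect_cis (m : int) :
  cexpect leb period (fun x : R => cis (m%:~R * x)) = if m == 0 then (2 * pi)%:C else 0.
Proof.
have [->|m0] := eqVneq m 0; last first.
  have [h1 h2] := int_cos_sin m0.
  by apply: complex_ext => /=.
transitivity (cexpect leb period (fun=> (1 : R)%:C)).
  by apply: eq_cexpect => x _; rewrite mul0r cis0.
rewrite (cexpect_real _ mP) (expect_cst _ mP) mul1r; congr (_%:C).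
by have := leb_period => /(congr1 fine).
Qed.

Definition wave (k : int * int) (z : R * R) : R[i] :=
  cis (k.1%:~R * z.1 + k.2%:~R * z.2).

Lemma cbm_wave k : @cbm _ (RT * RT)%type R (wave k).
Proof.
apply: cbm_cis; apply: measurable_funD.
  exact: (measurableT_comp (measurable_mulR _) measurable_fst).
exact: (measurableT_comp (measurable_mulR _) measurable_snd).
Qed.

Lemma nc_wave k z : nc (wave k z) = 1. Proof. exact: normc_cis. Qed.

Lemma wave_conjM k l z : wave k z * conjc (wave l z) = wave (k.1 - l.1, k.2 - l.2) z.
Proof.
by rewrite /wave -cisN -cisD; congr cis; rewrite /= !intrD !intrN; ring.
Qed.

Lemma cexpect_wave k :
  cexpect area torus_square (wave k) = if k == 0 then (torus_area)%:C else 0.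
Proof.
rewrite (cexpect_product mP fP mP fP (cbm_wave k)).
have c1 (m : int) : @cbm _ RT R (fun x => cis (m%:~R * x)).
  by apply: cbm_cis; exact: measurable_mulR.
transitivity (cexpect leb period (fun x : R => cis (k.1%:~R * x)) *
              cexpect leb period (fun x : R => cis (k.2%:~R * x))).
  rewrite -(cexpectZr mP fP _ (c1 k.1)); apply: eq_cexpect => x _.
  rewrite -(cexpectZl mP fP _ (c1 k.2)); apply: eq_cexpect => y _.
  by rewrite /wave cisD.
rewrite !cexpect_cis; case: k => m n /=.
have -> : ((m, n) == 0) = (m == 0) && (n == 0) by [].
case: (m == 0); case: (n == 0); rewrite ?mul0r ?mulr0//=.
by rewrite -realcM /torus_area expr2.
Qed.

Local Notation Ex f := (Rintegral area torus_square f).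
Local Notation CEx f := (cexpect area torus_square f).
Local Notation fcoef := (coef area torus_square wave).

Let mD := measurable_torus_square.
Let fD := finite_torus_square.

Lemma cexpect_wave2 k l :
  CEx (fun z => wave k z * conjc (wave l z)) = if k == l then (torus_area)%:C else 0.
Proof.
transitivity (CEx (wave (k.1 - l.1, k.2 - l.2))).
  by apply: eq_cexpect => z _; exact: wave_conjM.
rewrite cexpect_wave; case: k l => [k1 k2] [l1 l2] /=.
have -> : ((k1 - l1, k2 - l2) == 0) = (k1 - l1 == 0) && (k2 - l2 == 0) by [].
by rewrite !subr_eq0 xpair_eqE.
Qed.

(** The coefficients are not divided by the area [W], so the partial Fourier sum [S] is compared
    with [W g]. Expanding the integral of [|W g - S| ^ 2 >= 0], orthogonality turns the cross terms
    and the square of [S] into multiples of the same sum. *)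
Lemma bessel_torus (ks : seq (int * int)) (g : R * R -> R[i]) : uniq ks ->
  @cbm _ (RT * RT)%type R g ->
  \sum_(k <- ks) nc (fcoef g k) ^+ 2 <= torus_area * Ex (fun x => nc (g x) ^+ 2).
Proof.
move=> uks cg; set W := torus_area; have W0 := torus_area_gt0.
pose S z := \sum_(k <- ks) fcoef g k * wave k z.
have cS : @cbm _ (RT * RT)%type R S.
  by apply: cbm_sum => k _; exact: (cbmM (cbm_cst _ _) (cbm_wave k)).
have cSc := cbm_conj cS; have cgc := cbm_conj cg.
have cgw k := cbmM cg (cbm_conj (cbm_wave k)).
set B := \sum_(k <- ks) nc (fcoef g k) ^+ 2.
have gS : CEx (fun z => g z * conjc (S z)) = B%:C.
  transitivity (CEx (fun z => \sum_(k <- ks) conjc (fcoef g k) * (g z * conjc (wave k z)))).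
    apply: eq_cexpect => z _; rewrite /S conjc_sum mulr_sumr; apply: eq_bigr => k _.
    by rewrite conjcM mulrCA.
  rewrite (cexpect_sum mD fD); last by move=> k _; exact: (cbmM (cbm_cst _ _) (cgw k)).
  rewrite /B -sum_sqr_nc; apply: eq_bigr => k _.
  by rewrite (cexpectZl mD fD _ (cgw k)) mulrC.
have SS : CEx (fun z => S z * conjc (S z)) = (W * B)%:C.
  transitivity (CEx (fun z => \sum_(k <- ks) fcoef g k * \sum_(l <- ks)
      conjc (fcoef g l) * (wave k z * conjc (wave l z)))).
    apply: eq_cexpect => z _; rewrite {1}/S mulr_suml; apply: eq_bigr => k _.
    rewrite -mulrA; congr (_ * _); rewrite /S conjc_sum mulr_sumr; apply: eq_bigr => l _.
    by rewrite conjcM mulrCA.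
  have cww k l := cbmM (cbm_wave k) (cbm_conj (cbm_wave l)).
  have cin k : @cbm _ (RT * RT)%type R (fun z => \sum_(l <- ks)
      conjc (fcoef g l) * (wave k z * conjc (wave l z))).
    by apply: cbm_sum => l _; exact: (cbmM (cbm_cst _ _) (cww k l)).
  rewrite (cexpect_sum mD fD); last by move=> k _; exact: (cbmM (cbm_cst _ _) (cin k)).
  rewrite mulrC realcM /B -sum_sqr_nc mulr_suml; apply: eq_big_seq => k kks.
  rewrite (cexpectZl mD fD _ (cin k)) -mulrA; congr (_ * _).
  rewrite (cexpect_sum mD fD); last by move=> l _; exact: (cbmM (cbm_cst _ _) (cww k l)).
  rewrite (bigD1_seq k)//= big1_seq ?addr0.
    by rewrite (cexpectZl mD fD _ (cww k k)) cexpect_wave2 eqxx.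
  move=> l /andP[lk _]; rewrite (cexpectZl mD fD _ (cww k l)) cexpect_wave2.
  by rewrite eq_sym (negbTE lk) mulr0.
have sq (f : R * R -> R[i]) : @cbm _ (RT * RT)%type R f ->
    CEx (fun z => f z * conjc (f z)) = (Ex (fun z => nc (f z) ^+ 2))%:C.
  move=> cf; rewrite -(cexpect_real _ mD).
  by apply: eq_cexpect => z _; rewrite mul_conjc.
have h : 0 <= W * W * Ex (fun z => nc (g z) ^+ 2) - W * B.
  have cd : @cbm _ (RT * RT)%type R (fun z => W%:C * g z + (-1) * S z).
    exact: (cbmD (cbmM (cbm_cst _ _) cg) (cbmM (cbm_cst _ _) cS)).
  suff <- : Ex (fun z => nc (W%:C * g z + (-1) * S z) ^+ 2) =
     W * W * Ex (fun z => nc (g z) ^+ 2) - W * B.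
    by apply: expect_ge0 => z _; exact: sqr_ge0.
  suff h : CEx (fun z => (W%:C * g z + (-1) * S z) * conjc (W%:C * g z + (-1) * S z)) =
     (W * W * Ex (fun z => nc (g z) ^+ 2) - W * B)%:C.
    by move: h; rewrite (sq _ cd) => /(congr1 (@complex.Re R)).
  pose F1 z := g z * conjc (g z); pose F2 z := g z * conjc (S z).
  pose F3 z := S z * conjc (g z); pose F4 z := S z * conjc (S z).
  have b1 := cbmM cg cgc; have b2 := cbmM cg cSc.
  have b3 := cbmM cS cgc; have b4 := cbmM cS cSc.
  have z1 c f := @cbmM _ (RT * RT)%type R _ f (cbm_cst _ c).
  transitivity (CEx (fun z => ((W * W)%:C * F1 z + (- W%:C) * F2 z) +
      ((- W%:C) * F3 z + 1 * F4 z))).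
    apply: eq_cexpect => z _; rewrite conjcD !conjcM conjc_real /F1 /F2 /F3 /F4.
    have -> : conjc (-1) = -1 :> R[i] by rewrite -[-1]/(- 1) rmorphN rmorph1.
    rewrite realcM; ring.
  rewrite (cexpectD mD fD (cbmD (z1 _ _ b1) (z1 _ _ b2)) (cbmD (z1 _ _ b3) (z1 _ _ b4))).
  rewrite (cexpectD mD fD (z1 _ _ b1) (z1 _ _ b2)) (cexpectD mD fD (z1 _ _ b3) (z1 _ _ b4)).
  rewrite (cexpectZl mD fD _ b1) (cexpectZl mD fD _ b2).
  rewrite (cexpectZl mD fD _ b3) (cexpectZl mD fD _ b4).
  have -> : CEx F3 = B%:C.
    transitivity (conjc (CEx F2)); last by rewrite /F2 gS conjc_real.
    rewrite -(cexpect_conj mD fD b2); apply: eq_cexpect => z _.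
    by rewrite /F3 /F2 conjcM conjcK mulrC.
  rewrite /F2 gS /F4 SS /F1 (sq _ cg).
  by apply: complex_ext; rewrite !(ReD, ImD, ReM, ImM)/=; ring.
rewrite -(ler_pM2l W0) -subr_ge0 mulrA; exact: h.
Qed.

End Torus.

(** * Strichartz estimate on a frequency box *)

Section Box.
Implicit Types (m n : int) (N : nat).

Definition zrange N : seq int := [seq i%:Z - N%:Z | i <- iota 0 N.*2.+1].

Lemma mem_zrange N m : (m \in zrange N) = (`|m|%N <= N)%N.
Proof.
apply/mapP/idP => [[i hi ->]|mN].
  by move: hi; rewrite mem_iota; lia.
exists (absz (m + N%:Z)); last by lia.
by rewrite mem_iota; lia.
Qed.

Lemma uniq_zrange N : uniq (zrange N).
Proof. by rewrite map_inj_uniq ?iota_uniq// => i j /addIr[]. Qed.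

Definition box N : seq (int * int) := [seq (m, n) | m <- zrange N, n <- zrange N].

Lemma uniq_box N : uniq (box N).
Proof.
by apply: allpairs_uniq; [exact: uniq_zrange|exact: uniq_zrange|move=> [? ?] [? ?]].
Qed.

Lemma mem_box N (k : int * int) : (k \in box N) = (`|k.1|%N <= N)%N && (`|k.2|%N <= N)%N.
Proof.
rewrite -!mem_zrange; case: k => m n; apply/allpairsP/andP => /=.
  by move=> [[a b] /= [ha hb [-> ->]]].
by move=> [hm hn]; exists (m, n).
Qed.

End Box.

Section BoxKernel.
Context {R : realType}.
Implicit Types (t x y : R) (N : nat).

(** Translating the index by [N] makes the sum start at [0]; it replaces [x] by [x - 2 t N] and
    brings out a unimodular factor. *)
Lemma zrange_weyl t x N : t != 0 -> `|t| * N.*2.+1%:R <= 1 ->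
  nc (\sum_(m <- zrange N) cis (m%:~R * x + t * m%:~R ^+ 2)) <=
  weyl_const / Num.sqrt `|t|.
Proof.
move=> t0 tN; have := weyl_sum (x - 2 * t * N%:R) t0 tN.
rewrite /zrange big_map.
have -> : \sum_(i <- iota 0 N.*2.+1) cis ((i%:Z - N%:Z)%:~R * x + t * (i%:Z - N%:Z)%:~R ^+ 2) =
    cis (t * N%:R ^+ 2 - N%:R * x) *
    \sum_(0 <= j < N.*2.+1) cis (j%:R * (x - 2 * t * N%:R) + t * j%:R ^+ 2).
  rewrite /index_iota subn0 mulr_sumr; apply: eq_bigr => i _.
  rewrite -cisD; congr cis; rewrite intrB; ring.
by rewrite Normc.normcM normc_cis mul1r.
Qed.

Definition schr_phase (k : int * int) (t : R) : R[i] := cis (- (t * symbolP k.1 k.2)).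

Lemma box_kernel_factor N t s (x y : R * R) :
  \sum_(k <- box N) schr_phase k t * conjc (schr_phase k s) * wave k x * conjc (wave k y) =
  (\sum_(m <- zrange N) cis (m%:~R * (x.1 - y.1) + (- (t - s)) * m%:~R ^+ 2)) *
  (\sum_(n <- zrange N) cis (n%:~R * (x.2 - y.2) + (t - s) * n%:~R ^+ 2)).
Proof.
rewrite /box big_allpairs mulr_suml; apply: eq_bigr => m _.
rewrite mulr_sumr; apply: eq_bigr => n _.
rewrite /schr_phase /wave /symbolP -!cisN -!cisD; congr cis => /=; ring.
Qed.

Definition weyl_sqr : R := weyl_const ^+ 2.

Lemma weyl_sqr_gt0 : 0 < weyl_sqr.
Proof.
by rewrite exprn_gt0// ltr_wpDl// divr_ge0// ltW// cos1_gt0.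
Qed.

(** The distance in time at which the trivial bound, the number [(2 N + 1) ^ 2] of frequencies,
    equals the dispersive bound [weyl_sqr / |t - s|]. *)
Definition box_cutoff N : R := weyl_sqr / N.*2.+1%:R ^+ 2.

Lemma box_cutoff_gt0 N : 0 < box_cutoff N.
Proof. by rewrite divr_gt0 ?weyl_sqr_gt0// exprn_gt0. Qed.

Lemma box_dispersive N t s (x y : R * R) : `|t - s| * N.*2.+1%:R <= 1 ->
  nc (\sum_(k <- box N) schr_phase k t * conjc (schr_phase k s) * wave k x * conjc (wave k y))
  <= weyl_sqr / Num.max `|t - s| (box_cutoff N).
Proof.
move=> tsN; rewrite box_kernel_factor Normc.normcM.
have M0 : 0 < N.*2.+1%:R ^+ 2 :> R by rewrite exprn_gt0.
case: (leP `|t - s| (box_cutoff N)) => h.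
  have -> : weyl_sqr / box_cutoff N = N.*2.+1%:R * N.*2.+1%:R.
    rewrite /box_cutoff; set M : R := N.*2.+1%:R.
    have Mn : M != 0 by rewrite pnatr_eq0.
    have Wn : weyl_sqr != 0 :> R by rewrite gt_eqF// weyl_sqr_gt0.
    by rewrite invf_div mulrCA divff// mulr1 expr2.
  have tr (a b : R) : nc (\sum_(m <- zrange N) cis (m%:~R * a + b * m%:~R ^+ 2)) <= N.*2.+1%:R.
    apply: (le_trans (nc_sum _ _ _)); under eq_bigr do rewrite normc_cis.
    by rewrite big_const_seq count_predT iter_addr_0 size_map size_iota.
  by apply: ler_pM; rewrite ?nc_ge0.
have ts0 : t - s != 0 by rewrite -normr_gt0 (lt_trans (box_cutoff_gt0 N)).
have -> : weyl_sqr / `|t - s| = weyl_const / Num.sqrt `|- (t - s)| * (weyl_const / Num.sqrt `|t - s|).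
  rewrite normrN mulrACA -expr2 -invfM -expr2 sqr_sqrtr//.
by apply: ler_pM; rewrite ?nc_ge0// zrange_weyl ?oppr_eq0// normrN.
Qed.

End BoxKernel.

(** * From short time intervals to the unit interval *)

Section BlockStrichartz.
Context {R : realType}.
Variables (p q : R).
Hypotheses (pq : p^-1 + q^-1 = 2^-1) (p2 : 2 < p).
Local Notation RT := (measurableTypeR R).
Local Notation leb := (@lebesgue_measure R).
Local Notation area := (torus_measure R).

Let measurable_dist : @measurable_fun _ _ (RT * RT)%type R setT (fun x : R * R => x.1 - x.2).
Proof.
apply: measurable_funB; apply: (measurableT_comp measurable_idR).
  exact: measurable_fst.
exact: measurable_snd.
Qed.

Let dist_segment (a l t s : R) :
  a <= t -> t <= a + l -> a <= s -> s <= a + l -> `|t - s| <= l.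
Proof. by move=> *; rewrite ler_norml; apply/andP; split; lra. Qed.

Definition block_const : R :=
  interp_const q (torus_area (R:=R)) * (weyl_sqr `^ (2 / p) * hls_const p).

Definition blockQ N (c : int * int -> R[i]) (t : R) : R :=
  evolQ (S := RT) area torus_square (box N) wave schr_phase q c t.

Let mD := @measurable_torus_square R.
Let fD := @finite_torus_square R.

Lemma cbm_schr_phase k : @cbm _ RT R (schr_phase k).
Proof.
apply: cbm_cis.
have -> : (fun t : R => - (t * symbolP k.1 k.2)) = (fun t : R => (- symbolP k.1 k.2) * t).
  by apply/funext => t; ring.
exact: measurable_mulR.
Qed.

Lemma block_const_ge0 : 0 <= block_const.
Proof.
rewrite mulr_ge0 ?(interp_const_ge0 pq p2 (ltW (torus_area_gt0)))//.
by rewrite mulr_ge0 ?powR_ge0 ?hls_const_ge0.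
Qed.

Lemma bmf_blockQ N c : @bmf _ RT R (blockQ N c).
Proof. exact: (bmf_evolQ mD fD (box N) pq p2 cbm_wave cbm_schr_phase c). Qed.

Lemma blockQ_ge0 N c t : 0 <= blockQ N c t.
Proof. exact: evolQ_ge0. Qed.

Lemma block_strichartz_short N (a : R) (c : int * int -> R[i]) :
  Rintegral leb `[a, a + N.*2.+1%:R^-1]%classic (fun t => blockQ N c t `^ (p / q)) <=
  (block_const * \sum_(k <- box N) nc (c k) ^+ 2) `^ (p / 2).
Proof.
set M : R := N.*2.+1%:R; have M0 : 0 < M by [].
have aM : a <= a + M^-1 by rewrite lerDl invr_ge0.
pose b (z : R * R) : R := weyl_sqr / Num.max `|z.1 - z.2| (box_cutoff N).
have mx0 (tau : R) : 0 < Num.max `|tau| (box_cutoff N) by rewrite lt_max box_cutoff_gt0 orbT.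
have b0 z : 0 < b z by rewrite divr_gt0 ?weyl_sqr_gt0.
(* The power [2 / p] of the dispersive bound is a constant multiple of the Hardy-Littlewood-Sobolev
   kernel capped at [box_cutoff N]. *)
have bE t s : b (t, s) `^ (2 / p) =
    weyl_sqr `^ (2 / p) * hls_kernel p (box_cutoff N) (t - s).
  rewrite /b powRM ?(ltW weyl_sqr_gt0) ?invr_ge0 ?(ltW (mx0 _))//; congr (_ * _).
  by rewrite -(powR_inv1 (ltW (mx0 _))) -powRrM mulN1r.
have bb : @bmf _ (RT * RT)%type R (fun z : R * R => b z `^ (2 / p)).
  have bk : @bmf _ (RT * RT)%type R (fun z : R * R => hls_kernel p (box_cutoff N) (z.1 - z.2)).
    apply: (bmf_comp _ (bmf_hls_kernel p2 (box_cutoff_gt0 N))).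
    exact: measurable_dist.
  apply: (eq_bmf _ (bmfM (bmf_cst _ (weyl_sqr `^ (2 / p))) bk)) => -[t s].
  by rewrite bE.
rewrite /block_const.
apply: (abstract_strichartz (S := RT) (b := b) (@measurable_timeI R a (a + M^-1))
  (finite_timeI aM) mD fD pq p2 (ltW torus_area_gt0) cbm_wave cbm_schr_phase).
- by move=> k t; exact: normc_cis.
- by move=> g; apply: bessel_torus; exact: uniq_box.
- exact: b0.
- exact: bb.
- move=> t s x y; rewrite /= !in_itv/= => /andP[t1 t2] /andP[s1 s2].
  apply: box_dispersive; rewrite -/M -ler_pdivlMr// div1r.
  exact: (dist_segment t1 t2 s1 s2).
- move=> phi L phi0 bphi L0 hL.
  have := hardy_littlewood_sobolev p2 aM (box_cutoff_gt0 N) phi0 bphi L0 hL.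
  move/(ler_wpM2l (powR_ge0 weyl_sqr (2 / p))); rewrite mulrA; apply: le_trans.
  have bks t : @bmf _ RT R (fun s : R => hls_kernel p (box_cutoff N) (t - s) * phi s).
    apply: bmfM bphi.
    apply: (bmf_comp _ (bmf_hls_kernel p2 (box_cutoff_gt0 N))).
    by apply: measurable_funB; [exact: measurable_cst|exact: measurable_idR].
  have mI := @measurable_timeI R a (a + M^-1); have fI := finite_timeI aM.
  rewrite -(expectZl mI fI).
    rewrite le_eqVlt; apply/orP; left; apply/eqP; apply: eq_expect => t _.
    rewrite mulrCA; congr (_ * _); rewrite -(expectZl mI fI _ (bks t)).
    by apply: eq_expect => s _; rewrite bE mulrA.
  apply: (bmfM bphi).
  apply: (@bmf_expect2 _ _ RT RT R leb _ mI fI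
    (fun z : R * R => hls_kernel p (box_cutoff N) (z.1 - z.2) * phi z.2)).
  apply: bmfM; last exact: (bmf_comp measurable_snd bphi).
  apply: (bmf_comp _ (bmf_hls_kernel p2 (box_cutoff_gt0 N))).
  exact: measurable_dist.
Qed.

Lemma expect_chain (f : R -> R) (l X : R) (n : nat) : 0 <= l ->
  @bmf _ RT R f -> (forall t, 0 <= f t) ->
  (forall a, Rintegral leb `[a, a + l]%classic f <= X) ->
  Rintegral leb `[0, n%:R * l]%classic f <= n%:R * X.
Proof.
move=> l0 bf f0 hX; elim: n => [|n ih].
  rewrite !mul0r set_itv1.
  by rewrite /Rintegral integral_set1.
have nl0 : 0 <= n%:R * l by rewrite mulr_ge0.
have h1 : 0 <= n.+1%:R * l by rewrite mulr_ge0.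
have m1 := @measurable_timeI R 0 (n.+1%:R * l).
have mA := @measurable_timeI R 0 (n%:R * l).
have mB := @measurable_timeI R (n%:R * l) (n%:R * l + l).
have iE (c d : R) : c <= d -> (\int[leb]_(t in `[c, d]) (f t)%:E)%E = (Rintegral leb `[c, d] f)%:E.
  by move=> cd; rewrite -(EFin_expect (@measurable_timeI R c d) (finite_timeI cd) bf).
rewrite -lee_fin -(iE _ _ h1) -[n.+1%:R in leRHS]natr1 mulrDl mul1r EFinD.
apply: (@le_trans _ _ (\int[leb]_(t in `[0%R, (n%:R * l)%R]) (f t)%:E +
   \int[leb]_(t in `[(n%:R * l)%R, (n%:R * l + l)%R]) (f t)%:E)%E); last first.
  rewrite (iE _ _ nl0) (iE (n%:R * l)) ?lerDl// -!EFinD lee_fin lerD//.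
have mf (A : set RT) : measurable_fun A (EFin \o f).
  by apply/measurable_EFinP; apply: measurable_funTS; case: bf.
have sub : `[0, n.+1%:R * l]%classic `<=` `[0, (n%:R * l)]%classic `|` `[(n%:R * l), (n%:R * l + l)]%classic.
  move=> t /=; rewrite !in_itv/= => /andP[t0 tn].
  case: (leP t (n%:R * l)) => h; [left|right]; rewrite ?t0//.
  by rewrite (ltW h)/= (le_trans tn)// -natr1 mulrDl mul1r.
apply: le_trans (ge0_subset_integral _ m1 (measurableU _ _ mA mB) (mf _) _ sub) _.
  by move=> t _; rewrite lee_fin.
set A := `[0, _]%classic; set B := `[n%:R * l, _]%classic.
have AB : A `|` B = A `|` (B `\` A) by rewrite setUDr setDv setD0.
rewrite AB ge0_integral_setU//.
- rewrite leeD2l//; apply: ge0_subset_integral => //.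
  + exact: measurableD.
  + by move=> t _; rewrite lee_fin.
- exact: measurableD.
- by move=> t _; rewrite lee_fin.
- by apply/disj_setPS => t [At [_]].
Qed.

Lemma block_strichartz N (c : int * int -> R[i]) :
  Rintegral leb `[0, 1]%classic (fun t => blockQ N c t `^ (p / q)) <=
  N.*2.+1%:R * (block_const * \sum_(k <- box N) nc (c k) ^+ 2) `^ (p / 2).
Proof.
have qV : q^-1 = 2^-1 - p^-1 by rewrite -pq; ring.
have p0 : 0 < p by apply: lt_trans p2.
have q0 : 0 < q by rewrite -invr_gt0 qV subr_gt0 ltf_pV2 ?posrE.
have := @expect_chain (fun t => blockQ N c t `^ (p / q)) N.*2.+1%:R^-1
  ((block_const * \sum_(k <- box N) nc (c k) ^+ 2) `^ (p / 2)) N.*2.+1.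
rewrite mulfV// ?pnatr_eq0//; apply.
- by rewrite invr_ge0.
- by apply: (bmf_powR (blockQ_ge0 N c) _ (bmf_blockQ N c)); rewrite divr_ge0// ltW.
- by move=> t; exact: powR_ge0.
- by move=> a; exact: block_strichartz_short.
Qed.

End BlockStrichartz.

(** * Summation of dyadic blocks *)

Section PowerMean.
Context {R : realType}.

(** The convex function [y ^ r] lies above its tangent at [m]; this is Young's inequality for [y]
    and [m ^ (r - 1)]. *)
Lemma powR_tangent (r y m : R) : 1 < r -> 0 <= y -> 0 <= m ->
  r * (y * m `^ (r - 1)) - (r - 1) * m `^ r <= y `^ r.
Proof.
move=> r1 y0 m0; have r0 : 0 < r by apply: lt_trans r1.
have rm : 0 < r - 1 by rewrite subr_gt0.
have rr : r^-1 + (r / (r - 1))^-1 = 1 by field; rewrite !gt_eqF.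
have := conjugate_powR y0 (powR_ge0 m (r - 1)) r0 (divr_gt0 r0 rm) rr.
rewrite -powRrM (_ : (r - 1) * (r / (r - 1)) = r); last by field; rewrite gt_eqF.
move=> /(ler_wpM2l (ltW r0)).
have -> : r * (y `^ r / r + m `^ r / (r / (r - 1))) = y `^ r + (r - 1) * m `^ r.
  by field; rewrite !gt_eqF.
by rewrite lerBlDr.
Qed.

(** The tangent inequality at the mean is averaged with the weights [c]. *)
Lemma powR_jensen (K : Type) (ks : seq K) (c y : K -> R) (r : R) : 1 < r ->
  (forall k, 0 <= c k) -> (forall k, 0 <= y k) -> \sum_(k <- ks) c k = 1 ->
  (\sum_(k <- ks) c k * y k) `^ r <= \sum_(k <- ks) c k * y k `^ r.
Proof.
move=> r1 c0 y0 c1; set m := \sum_(k <- ks) c k * y k.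
have m0 : 0 <= m by apply: sumr_ge0 => k _; rewrite mulr_ge0.
have -> : m `^ r = \sum_(k <- ks) c k * (r * (y k * m `^ (r - 1)) - (r - 1) * m `^ r).
  transitivity (r * m * m `^ (r - 1) - (r - 1) * m `^ r).
    by rewrite -mulrA mulr_powRB1//; [ring|exact: lt_trans r1].
  rewrite -[in X in _ - X](mulr1 ((r - 1) * m `^ r)) -c1 mulr_sumr /m mulr_sumr mulr_suml -sumrB.
  by apply: eq_bigr => k _; ring.
by apply: ler_sum => k _; rewrite ler_wpM2l// powR_tangent.
Qed.

Lemma powR_le_limit (r X s : R) : 0 < r -> 0 <= X -> 0 <= s ->
  (forall del, 0 < del -> X <= (s + del) `^ r) -> X <= s `^ r.
Proof.
move=> r0 X0 s0 h.
have rE (z : R) : 0 <= z -> z = (z `^ r^-1) `^ r.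
  by move=> z0; rewrite -powRrM mulVf ?gt_eqF// powRr1.
have hs : X `^ r^-1 <= s.
  apply/ler_addgt0Pl => del d0; rewrite addrC.
  have sd : 0 <= s + del by rewrite addr_ge0// ltW.
  have -> : s + del = ((s + del) `^ r) `^ r^-1.
    by rewrite -powRrM mulfV ?gt_eqF// powRr1.
  by apply: ge0_ler_powR; rewrite ?nnegrE ?invr_ge0 ?powR_ge0 ?h// ltW.
by rewrite (rE X)//; apply: ge0_ler_powR; rewrite ?nnegrE ?powR_ge0// ltW.
Qed.

End PowerMean.

Section NormSumProd.
Context d (T : measurableType d) (R : realType)
  (mu : {measure set T -> \bar R}) (D : set T).
Hypotheses (mD : measurable D) (fD : (mu D < +oo)%E).
Local Notation E f := (Rintegral mu D f).
Context (K : Type) (ks : seq K) (v w : K -> T -> R) (r x y : R).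
Hypotheses (r1 : 1 < r) (x0 : 0 < x) (y0 : 0 < y) (rxy : x^-1 + y^-1 = r^-1).
Hypotheses (v0 : forall k z, 0 <= v k z) (w0 : forall k z, 0 <= w k z).
Hypotheses (bv : forall k, bmf (v k)) (bw : forall k, bmf (w k)).

Let r0 : 0 < r. Proof. exact: lt_trans r1. Qed.
Let bvw k : bmf (fun z => v k z * w k z). Proof. exact: (bmfM (bv k) (bw k)). Qed.
Let vw0 k z : 0 <= v k z * w k z. Proof. by rewrite mulr_ge0. Qed.
Let bvwr k : bmf (fun z => (v k z * w k z) `^ r).
Proof. exact: (bmf_powR (vw0 k) (ltW r0) (bvw k)). Qed.

Let norm_prod (A B : R) k : 0 < A -> 0 < B ->
  E (fun z => v k z `^ x) <= A `^ x -> E (fun z => w k z `^ y) <= B `^ y ->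
  E (fun z => (v k z * w k z) `^ r) <= (A * B) `^ r.
Proof.
move=> A0 B0 hA hB.
have pr (f : T -> R) (e : R) : E (fun z => (f z `^ r) `^ (e / r)) = E (fun z => f z `^ e).
  by apply: eq_expect => z _; rewrite -powRrM mulrCA divff ?gt_eqF// mulr1.
have pA (C e : R) : (C `^ r) `^ (e / r) = C `^ e.
  by rewrite -powRrM mulrCA divff ?gt_eqF// mulr1.
rewrite powRM ?(ltW A0) ?(ltW B0)//.
have -> : E (fun z => (v k z * w k z) `^ r) = E (fun z => v k z `^ r * w k z `^ r).
  by apply: eq_expect => z _; rewrite powRM.
apply: (@hoelder_le _ _ _ mu D mD fD _ _ (x / r) (y / r)).
- by move=> z; exact: powR_ge0.
- by move=> z; exact: powR_ge0.
- exact: (bmf_powR (v0 k) (ltW r0) (bv k)).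
- exact: (bmf_powR (w0 k) (ltW r0) (bw k)).
- exact: divr_gt0.
- exact: divr_gt0.
- by rewrite !invf_div -mulrDr rxy divff// gt_eqF.
- exact: powR_gt0.
- exact: powR_gt0.
- by rewrite pr pA.
- by rewrite pr pA.
Qed.

Let norm_sum_prod_pos (A B : K -> R) : (forall k, 0 < A k) -> (forall k, 0 < B k) ->
  (forall k, E (fun z => v k z `^ x) <= A k `^ x) ->
  (forall k, E (fun z => w k z `^ y) <= B k `^ y) ->
  E (fun z => (\sum_(k <- ks) v k z * w k z) `^ r) <= (\sum_(k <- ks) A k * B k) `^ r.
Proof.
move=> A0 B0 hA hB; set P := \sum_(k <- ks) A k * B k.
have AB0 k : 0 < A k * B k by rewrite mulr_gt0.
have P0 : 0 <= P by apply: sumr_ge0 => k _; exact: ltW.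
have bS : bmf (fun z => (\sum_(k <- ks) v k z * w k z) `^ r).
  apply: (bmf_powR _ (ltW r0)); last by apply: bmf_sum => k _.
  by move=> z; apply: sumr_ge0 => k _.
have [Pz|Pn] := eqVneq P 0.
  rewrite Pz powR0 ?gt_eqF//.
  have -> : E (fun z => (\sum_(k <- ks) v k z * w k z) `^ r) = E (fun=> 0).
    apply: eq_expect => z _.
    suff nil (l : seq K) : \sum_(k <- l) A k * B k = 0 -> l = [::].
      by rewrite (nil _ Pz) big_nil powR0// gt_eqF.
    case: l => // k l; rewrite big_cons => /eqP; rewrite gt_eqF//.
    by rewrite ltr_wpDr//; apply: sumr_ge0 => ? _; exact: ltW.
  by rewrite (expect_cst _ mD) mul0r.
have Pp : 0 < P by rewrite lt_neqAle eq_sym Pn.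
(* Minkowski's inequality from Jensen's: each product is divided by its bound [A k * B k], and the
   weights are proportional to these bounds, so that every normalised term has norm at most [1]. *)
pose c k := A k * B k / P.
have c0 k : 0 <= c k by rewrite divr_ge0// ltW.
have c1 : \sum_(k <- ks) c k = 1 by rewrite -mulr_suml divff.
have cw k : 0 <= c k / (A k * B k) `^ r by rewrite divr_ge0// powR_ge0.
have bR : bmf (fun z => P `^ r * \sum_(k <- ks) c k / (A k * B k) `^ r * (v k z * w k z) `^ r).
  apply: (bmfM (bmf_cst _ _)); apply: bmf_sum => k _.
  exact: (bmfM (bmf_cst _ _) (bvwr k)).
apply: (@le_trans _ _ (E (fun z => P `^ r * \sum_(k <- ks) c k / (A k * B k) `^ r * (v k z * w k z) `^ r))).
  apply: (le_expect mD fD bS bR) => z _.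
  have -> : \sum_(k <- ks) v k z * w k z = P * \sum_(k <- ks) c k * (v k z * w k z / (A k * B k)).
    rewrite mulr_sumr; apply: eq_bigr => k _; rewrite /c.
    by field; rewrite Pn !gt_eqF.
  rewrite powRM//; last first.
    by apply: sumr_ge0 => k _; rewrite mulr_ge0// divr_ge0// ltW.
  rewrite ler_wpM2l ?powR_ge0//.
  have yk k : 0 <= v k z * w k z / (A k * B k) by rewrite divr_ge0// ltW.
  apply: (le_trans (powR_jensen r1 c0 yk c1)).
  apply: ler_sum => k _; rewrite powRM ?invr_ge0 ?(ltW (AB0 k))//.
  rewrite -(powR_inv1 (ltW (AB0 k))) -powRrM mulN1r powRN.
  by rewrite mulrA mulrAC.
have bsum k : bmf (fun z => c k / (A k * B k) `^ r * (v k z * w k z) `^ r).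
  exact: (bmfM (bmf_cst _ _) (bvwr k)).
have bbsum : bmf (fun z => \sum_(k <- ks) c k / (A k * B k) `^ r * (v k z * w k z) `^ r).
  by apply: bmf_sum => k _; exact: bsum.
rewrite (expectZl mD fD _ bbsum) -[leRHS]mulr1 ler_wpM2l ?powR_ge0//.
rewrite (expect_sum mD fD); last by move=> k _; exact: bsum.
rewrite -c1; apply: ler_sum => k _; rewrite (expectZl mD fD _ (bvwr k)).
rewrite -[leRHS]mulr1 -mulrA ler_wpM2l// mulrC ler_pdivrMr ?powR_gt0// mul1r.
exact: norm_prod.
Qed.

(** Hoelder's inequality for each product and Minkowski's for the sum. Bounds that may vanish are
    enlarged by [e], which tends to [0]. *)
Lemma norm_sum_prod (A B : K -> R) : (forall k, 0 <= A k) -> (forall k, 0 <= B k) ->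
  (forall k, E (fun z => v k z `^ x) <= A k `^ x) ->
  (forall k, E (fun z => w k z `^ y) <= B k `^ y) ->
  E (fun z => (\sum_(k <- ks) v k z * w k z) `^ r) <= (\sum_(k <- ks) A k * B k) `^ r.
Proof.
move=> A0 B0 hA hB.
have P0 : 0 <= \sum_(k <- ks) A k * B k by apply: sumr_ge0 => k _; rewrite mulr_ge0.
have E0 : 0 <= E (fun z => (\sum_(k <- ks) v k z * w k z) `^ r).
  by apply: expect_ge0 => z _; exact: powR_ge0.
apply: powR_le_limit => // del d0.
set C := \sum_(k <- ks) (A k + B k + 1).
have C0 : 0 <= C by apply: sumr_ge0 => k _; rewrite !addr_ge0.
have C1 : 0 < C + 1 by rewrite ltr_wpDl.
(* As [e <= 1], the product [(A k + e) * (B k + e)] exceeds [A k * B k] by at most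
   [e * (A k + B k + 1)], in total by [e * C <= del]. *)
pose e := Num.min 1 (del / (C + 1)).
have e0 : 0 < e by rewrite lt_min ltr01 divr_gt0.
have e1 : e <= 1 by rewrite ge_min lexx.
have eC : e * C <= del.
  apply: (@le_trans _ _ (del / (C + 1) * C)); first by rewrite ler_wpM2r// ge_min lexx orbT.
  by rewrite mulrAC ler_pdivrMr// ler_pM2l// lerDl.
have mono (u : K -> R) (s : R) k : 0 < s -> 0 <= u k -> u k `^ s <= (u k + e) `^ s.
  move=> s0 u0; apply: ge0_ler_powR; rewrite ?nnegrE ?addr_ge0 ?(ltW e0) ?(ltW s0)//.
  by rewrite lerDl ltW.
apply: (@le_trans _ _ ((\sum_(k <- ks) (A k + e) * (B k + e)) `^ r)).
  apply: norm_sum_prod_pos.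
  - by move=> k; rewrite ltr_wpDl.
  - by move=> k; rewrite ltr_wpDl.
  - by move=> k; apply: (le_trans (hA k)); exact: mono.
  - by move=> k; apply: (le_trans (hB k)); exact: mono.
have S0 : 0 <= \sum_(k <- ks) (A k + e) * (B k + e).
  by apply: sumr_ge0 => k _; rewrite mulr_ge0// addr_ge0// ltW.
apply: ge0_ler_powR; rewrite ?nnegrE ?addr_ge0 ?(ltW r0) ?(ltW d0)//.
apply: (@le_trans _ _ (\sum_(k <- ks) A k * B k + e * C)); last by rewrite lerD2l.
rewrite /C mulr_sumr -big_split; apply: ler_sum => k _ /=.
have := A0 k; have := B0 k; nra.
Qed.

End NormSumProd.

Section Schur.
Context {R : realType}.
Variable rho : R.
Hypotheses (rho0 : 0 < rho) (rho1 : rho < 1).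

(** With truncated subtraction this is [|i - j|]. *)
Let dist (i j : nat) := ((i - j) + (j - i))%N.

Let row_sum_low i n : (n <= i.+1)%N ->
  (1 - rho) * \sum_(0 <= j < n) rho ^+ dist i j <= rho ^+ (i.+1 - n).
Proof.
elim: n => [|n ih] ni; first by rewrite big_geq// mulr0 exprn_ge0// ltW.
rewrite big_nat_recr// mulrDr.
have -> : dist i n = (i - n)%N by rewrite /dist; lia.
have := ih (ltnW ni); rewrite (subSn (n := i) (m := n))// exprS subSS.
by move: (\sum_(_ <= _ < _) _) => S h /=; nra.
Qed.

Let row_sum i n : \sum_(0 <= j < n) rho ^+ dist i j <= 2 / (1 - rho).
Proof.
have d0 : 0 < 1 - rho by rewrite subr_gt0.
rewrite ler_pdivlMr// mulrC.
have [ni|] := leqP n i.+1.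
  apply: (le_trans (row_sum_low ni)).
  by rewrite (le_trans (exprn_ile1 _ _ _))// ?ltW// ltr1n.
move=> /ltnW/subnKC <-; move: (n - i.+1)%N => m.
(* The sharper bound [2 - rho ^ (m + 1)] is the one that passes through the induction on the number
   of terms beyond the diagonal. *)
apply: (@le_trans _ _ (2 - rho ^+ m.+1)); last by rewrite gerBl exprn_ge0// ltW.
elim: m => [|m ih].
  rewrite addn0 expr1; have := row_sum_low (leqnn i.+1); rewrite subnn expr0.
  by move=> /le_trans; apply; lra.
have sumS : \sum_(0 <= j < i.+1 + m.+1) rho ^+ dist i j =
    \sum_(0 <= j < i.+1 + m) rho ^+ dist i j + rho ^+ m.+1.
  by rewrite addnS big_nat_recr//; congr (_ + rho ^+ _); rewrite /dist; lia.
rewrite sumS mulrDr [rho ^+ m.+2]exprS.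
by move: ih; move: (\sum_(_ <= _ < _) _) (rho ^+ m.+1) => S z; lra.
Qed.

(** Schur's test: [b i * b j] is at most the mean of the two squares, and the symmetric matrix
    [rho ^ |i - j|] has row sums at most [2 / (1 - rho)]. *)
Lemma schur_sum (b : nat -> R) n :
  \sum_(0 <= i < n) \sum_(0 <= j < n) rho ^+ ((i - j) + (j - i)) * (b i * b j) <=
  2 / (1 - rho) * \sum_(0 <= i < n) b i ^+ 2.
Proof.
set X := \sum_(0 <= i < n) \sum_(0 <= j < n) rho ^+ dist i j * b i ^+ 2.
have XE : X = \sum_(0 <= i < n) \sum_(0 <= j < n) rho ^+ dist i j * b j ^+ 2.
  rewrite /X exchange_big; apply: eq_bigr => i _; apply: eq_bigr => j _.
  by rewrite /dist addnC.
apply: (@le_trans _ _ X).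
  have -> : X = \sum_(0 <= i < n) \sum_(0 <= j < n) rho ^+ dist i j * ((b i ^+ 2 + b j ^+ 2) / 2).
    transitivity ((X + X) / 2); first by field.
    rewrite [in X in (_ + X) / 2]XE /X -big_split/= mulr_suml; apply: eq_bigr => i _.
    by rewrite -big_split/= mulr_suml; apply: eq_bigr => j _; rewrite -mulrDr mulrA.
  apply: ler_sum => i _; apply: ler_sum => j _; rewrite ler_wpM2l ?exprn_ge0 ?(ltW rho0)//.
  have := sqr_ge0 (b i - b j); rewrite sqrrB; lra.
rewrite /X mulr_sumr; apply: ler_sum => i _.
by rewrite -mulr_suml ler_wpM2r ?sqr_ge0//; exact: row_sum.
Qed.

End Schur.

Section DyadicSum.
Context dS (S : measurableType dS) dT (T : measurableType dT) (R : realType)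
  (nu : {sigma_finite_measure set S -> \bar R}) (I : set S)
  (mu : {sigma_finite_measure set T -> \bar R}) (D : set T).
Hypotheses (mI : measurable I) (fI : (nu I < +oo)%E).
Hypotheses (mD : measurable D) (fD : (mu D < +oo)%E).
Local Notation Et f := (Rintegral nu I f).
Local Notation Ex f := (Rintegral mu D f).
Variables (p q p1 q1 p2 q2 eps : R).
Hypotheses (p_gt2 : 2 < p) (q_gt2 : 2 < q) (eps0 : 0 < eps).
Hypotheses (p10 : 0 < p1) (p20 : 0 < p2) (q10 : 0 < q1) (q20 : 0 < q2).
Hypotheses (p1E : p1^-1 = p^-1 + eps) (p2E : p2^-1 = p^-1 - eps).
Hypotheses (q1E : q1^-1 = q^-1 - eps) (q2E : q2^-1 = q^-1 + eps).
Variables (v : nat -> S * T -> R) (C : R) (a : nat -> R).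
Hypotheses (v0 : forall i z, 0 <= v i z) (bv : forall i, bmf (v i)).
Hypotheses (C0 : 0 <= C) (a0 : forall i, 0 <= a i).
Hypothesis bound1 : forall i,
  Et (fun t => Ex (fun x => v i (t, x) `^ q1) `^ (p1 / q1)) <= (C * 2 `^ (i%:R / p1) * a i) `^ p1.
Hypothesis bound2 : forall i,
  Et (fun t => Ex (fun x => v i (t, x) `^ q2) `^ (p2 / q2)) <= (C * 2 `^ (i%:R / p2) * a i) `^ p2.

Definition dyadic_const : R := C ^+ 2 * (2 / (1 - 2 `^ (- eps))).

Let p0 : 0 < p. Proof. exact: lt_trans p_gt2. Qed.
Let q0 : 0 < q. Proof. exact: lt_trans q_gt2. Qed.

Let bvp i s : 0 < s -> bmf (fun z => v i z `^ s).
Proof. by move=> s0; exact: (bmf_powR (v0 i) (ltW s0) (bv i)). Qed.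

Let A1 i t := Ex (fun x => v i (t, x) `^ q1) `^ q1^-1.
Let A2 i t := Ex (fun x => v i (t, x) `^ q2) `^ q2^-1.

Let bEx i s : 0 < s -> bmf (fun t => Ex (fun x => v i (t, x) `^ s)).
Proof. by move=> s0; exact: (bmf_expect2 mD fD (bvp i s0)). Qed.

Let Ex_ge0 i s t : 0 <= Ex (fun x => v i (t, x) `^ s).
Proof. by apply: expect_ge0 => x _; exact: powR_ge0. Qed.

Let bA1 i : bmf (A1 i).
Proof.
by apply: (bmf_powR (Ex_ge0 i q1) _ (bEx i q10)); rewrite invr_ge0 ltW.
Qed.

Let bA2 i : bmf (A2 i).
Proof.
by apply: (bmf_powR (Ex_ge0 i q2) _ (bEx i q20)); rewrite invr_ge0 ltW.
Qed.

Let half_sum (x x1 x2 : R) : x1^-1 + x2^-1 = x^-1 + x^-1 -> 0 < x -> x1^-1 + x2^-1 = (x / 2)^-1.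
Proof. by move=> -> x0; field; rewrite gt_eqF. Qed.

(* Bourgain-type bilinear summation: in [v_i v_j] the lower frequency is put in
   [L^p1 L^q1] and the higher one in [L^p2 L^q2], which gains [2^(- eps |i - j|)]
   over the diagonal estimate. *)
Theorem dyadic_sum n :
  Et (fun t => Ex (fun x => (\sum_(0 <= i < n) v i (t, x)) `^ q) `^ (p / q)) <=
  (dyadic_const * \sum_(0 <= i < n) (2 `^ (i%:R / p) * a i) ^+ 2) `^ (p / 2).
Proof.
pose ks := [seq (i, j) | i <- index_iota 0 n, j <- index_iota 0 n].
pose mn (k : nat * nat) := minn k.1 k.2; pose mx (k : nat * nat) := maxn k.1 k.2.
have sumks (F : nat * nat -> R) : \sum_(k <- ks) F k =
    \sum_(0 <= i < n) \sum_(0 <= j < n) F (i, j) by rewrite big_allpairs.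
have r1 : 1 < p / 2 by rewrite ltr_pdivlMr// mul1r.
have r2 : 1 < q / 2 by rewrite ltr_pdivlMr// mul1r.
(* The square of the sum is a sum of products, measured in [L^(q / 2)]; since
   [1 / q1 + 1 / q2 = 2 / q], Hoelder's inequality fits each product. The same is done in time below
   with [p / 2], [p1] and [p2]. *)
have space t : Ex (fun x => (\sum_(0 <= i < n) v i (t, x)) `^ q) <=
    (\sum_(k <- ks) A1 (mn k) t * A2 (mx k) t) `^ (q / 2).
  have -> : Ex (fun x => (\sum_(0 <= i < n) v i (t, x)) `^ q) =
      Ex (fun x => (\sum_(k <- ks) v (mn k) (t, x) * v (mx k) (t, x)) `^ (q / 2)).
    apply: eq_expect => x _.
    have -> : \sum_(k <- ks) v (mn k) (t, x) * v (mx k) (t, x) =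
        (\sum_(0 <= i < n) v i (t, x)) ^+ 2.
      rewrite sumks expr2 mulr_suml; apply: eq_bigr => i _.
      rewrite mulr_sumr; apply: eq_bigr => j _; rewrite /mn /mx /=.
      by case: (leqP i j) => // _; rewrite mulrC.
    rewrite -powR_mulrn; last by apply: sumr_ge0 => i _.
    by rewrite -powRrM mulrC divfK.
  have qq : q1^-1 + q2^-1 = (q / 2)^-1.
    by apply: half_sum => //; rewrite q1E q2E; ring.
  apply: (@norm_sum_prod _ _ _ mu D mD fD _ ks (fun k x => v (mn k) (t, x))
    (fun k x => v (mx k) (t, x)) (q / 2) q1 q2 r2 q10 q20 qq
    (fun k x => v0 _ _) (fun k x => v0 _ _)
    (fun k => bmf_pair1 t (bv _)) (fun k => bmf_pair1 t (bv _))
    (fun k => A1 (mn k) t) (fun k => A2 (mx k) t)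
    (fun k => powR_ge0 _ _) (fun k => powR_ge0 _ _)).
  - by move=> k; rewrite /A1 -powRrM mulVf ?gt_eqF// powRr1.
  - by move=> k; rewrite /A2 -powRrM mulVf ?gt_eqF// powRr1.
have bsum : bmf (fun z => (\sum_(0 <= i < n) v i z) `^ q).
  apply: (bmf_powR _ (ltW q0)); first by move=> z; apply: sumr_ge0 => i _.
  by apply: bmf_sum => i _.
have bL : bmf (fun t => Ex (fun x => (\sum_(0 <= i < n) v i (t, x)) `^ q) `^ (p / q)).
  apply: (bmf_powR _ _ (bmf_expect2 mD fD bsum)); last by rewrite divr_ge0// ltW.
  by move=> t; apply: expect_ge0 => x _; exact: powR_ge0.
have AA0 t : 0 <= \sum_(k <- ks) A1 (mn k) t * A2 (mx k) t.
  by apply: sumr_ge0 => k _; rewrite mulr_ge0 ?powR_ge0.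
have bR : bmf (fun t => (\sum_(k <- ks) A1 (mn k) t * A2 (mx k) t) `^ (p / 2)).
  apply: (bmf_powR AA0); first by rewrite divr_ge0// ltW.
  by apply: bmf_sum => k _; exact: (bmfM (bA1 _) (bA2 _)).
apply: (@le_trans _ _ (Et (fun t => (\sum_(k <- ks) A1 (mn k) t * A2 (mx k) t) `^ (p / 2)))).
  apply: (le_expect mI fI bL bR) => t _.
  have -> : (\sum_(k <- ks) A1 (mn k) t * A2 (mx k) t) `^ (p / 2) =
      ((\sum_(k <- ks) A1 (mn k) t * A2 (mx k) t) `^ (q / 2)) `^ (p / q).
    by rewrite -powRrM; congr (_ `^ _); field; rewrite gt_eqF.
  apply: ge0_ler_powR; rewrite ?nnegrE ?powR_ge0 ?space//.
    by rewrite divr_ge0// ltW.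
  by apply: expect_ge0 => x _; exact: powR_ge0.
pose al k := C * 2 `^ ((mn k)%:R / p1) * a (mn k).
pose be k := C * 2 `^ ((mx k)%:R / p2) * a (mx k).
apply: (@le_trans _ _ ((\sum_(k <- ks) al k * be k) `^ (p / 2))).
  have pp : p1^-1 + p2^-1 = (p / 2)^-1.
    by apply: half_sum => //; rewrite p1E p2E; ring.
  have al0 k : 0 <= al k by rewrite !mulr_ge0 ?powR_ge0.
  have be0 k : 0 <= be k by rewrite !mulr_ge0 ?powR_ge0.
  apply: (@norm_sum_prod _ _ _ nu I mI fI _ ks (fun k => A1 (mn k))
    (fun k => A2 (mx k)) (p / 2) p1 p2 r1 p10 p20 pp
    (fun k x => powR_ge0 _ _) (fun k x => powR_ge0 _ _)
    (fun k => bA1 _) (fun k => bA2 _) al be al0 be0).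
  - move=> k; apply: le_trans (bound1 (mn k)).
    rewrite le_eqVlt; apply/orP; left; apply/eqP; apply: eq_expect => t _.
    by rewrite /A1 -powRrM mulrC.
  - move=> k; apply: le_trans (bound2 (mx k)).
    rewrite le_eqVlt; apply/orP; left; apply/eqP; apply: eq_expect => t _.
    by rewrite /A2 -powRrM mulrC.
pose rho : R := 2 `^ (- eps).
have rho0 : 0 < rho by exact: powR_gt0.
have rho1 : rho < 1.
  by rewrite -[ltRHS](powRr0 2) /rho /powR gt_eqF// ltr_expR mul0r nmulr_rlt0 ?oppr_lt0// ln_gt0 ?ltr1n.
pose b i := 2 `^ (i%:R / p) * a i.
(* For [m <= l] one has [m / p1 + l / p2 = (m + l) / p - eps (l - m)], whence the off-diagonal
   decay. *)
have abE (i j : nat) : al (i, j) * be (i, j) = C ^+ 2 * (rho ^+ ((i - j) + (j - i)) * (b i * b j)).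
  have e (m l : nat) : (m <= l)%N ->
      2 `^ (m%:R / p1) * 2 `^ (l%:R / p2) =
      rho ^+ ((m - l) + (l - m)) * (2 `^ (m%:R / p) * 2 `^ (l%:R / p)) :> R.
    move=> ml; rewrite -powR_mulrn ?(ltW rho0)// /rho -powRrM -!powRD ?pnatr_eq0 ?implybT//.
    congr (_ `^ _); rewrite p1E p2E.
    by move/eqP: (ml) => ->; rewrite add0n natrB//; ring.
  rewrite /al /be /b /mn /mx /=; case: (leqP i j) => ij.
    have -> : C * 2 `^ (i%:R / p1) * a i * (C * 2 `^ (j%:R / p2) * a j) =
      C ^+ 2 * ((2 `^ (i%:R / p1) * 2 `^ (j%:R / p2)) * (a i * a j)) by ring.
    by rewrite e//; ring.
  have -> : C * 2 `^ (j%:R / p1) * a j * (C * 2 `^ (i%:R / p2) * a i) =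
    C ^+ 2 * ((2 `^ (j%:R / p1) * 2 `^ (i%:R / p2)) * (a j * a i)) by ring.
  by rewrite e 1?ltnW// [(j - i + _)%N]addnC; ring.
have sumE : \sum_(k <- ks) al k * be k = C ^+ 2 *
    \sum_(0 <= i < n) \sum_(0 <= j < n) rho ^+ ((i - j) + (j - i)) * (b i * b j).
  rewrite sumks mulr_sumr; apply: eq_bigr => i _; rewrite mulr_sumr.
  by apply: eq_bigr => j _; exact: abE.
have S0 : 0 <= \sum_(k <- ks) al k * be k.
  by apply: sumr_ge0 => k _; rewrite !mulr_ge0 ?powR_ge0.
have rhs0 : 0 <= dyadic_const * \sum_(0 <= i < n) b i ^+ 2.
  rewrite mulr_ge0//; last by apply: sumr_ge0 => i _; exact: sqr_ge0.
  by rewrite mulr_ge0 ?sqr_ge0// divr_ge0// subr_ge0 ltW.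
apply: ge0_ler_powR; rewrite ?nnegrE ?divr_ge0 ?(ltW p0)//.
rewrite sumE /dyadic_const -mulrA ler_wpM2l ?sqr_ge0//.
exact: (schur_sum rho0 rho1).
Qed.

End DyadicSum.

(** * Limits of series of functions *)

(** No measurability is assumed: the integral of a nonnegative function is a supremum over the
    simple functions below it. This serves for the norm of a distribution as a function of time,
    which is defined by an infimum. *)
Lemma le_ge0_integral d (T : measurableType d) (R : realType)
    (mu : {measure set T -> \bar R}) (D : set T) (f g : T -> \bar R) :
  (forall x, D x -> 0 <= f x)%E -> (forall x, D x -> f x <= g x)%E ->
  (\int[mu]_(x in D) f x <= \int[mu]_(x in D) g x)%E.
Proof.
move=> f0 fg; have g0 x : D x -> (0 <= g x)%E by move=> Dx; exact: le_trans (f0 x Dx) (fg x Dx).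
rewrite !ge0_integralE//; apply: ereal_sup_le => _ [h hf <-].
exists h => // x; apply: (le_trans (hf x)).
by rewrite !patchE; case: ifPn => // /set_mem; exact: fg.
Qed.

Section SeriesDefinitions.
Context (T : Type) (R : realType).
Variables (e : nat -> T -> R[i]) (q : R).

Definition norm_series n x : R := \sum_(0 <= i < n) nc (e i x).
Definition part_series n x : R[i] := \sum_(0 <= i < n) e i x.
(** The limit of the powers [q] of the absolute partial sums; it is finite exactly where the series
    converges absolutely. *)
Definition norm_series_sup x : \bar R := limn (fun n => (norm_series n x `^ q)%:E).

(* Junk value [0] where the series does not converge absolutely. *)
Definition sum_series x : R[i] :=
  if (norm_series_sup x < +oo)%E then
    limn (fun n => complex.Re (part_series n x)) +i*
    limn (fun n => complex.Im (part_series n x))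
  else 0.

(** The sum depends only on the values of the terms, also where it is given a default value, so
    periodicity of the terms carries over at every point. *)
Lemma eq_sum_series x y : (forall i, e i x = e i y) -> sum_series x = sum_series y.
Proof.
move=> exy; have pE n : part_series n x = part_series n y by apply: eq_bigr => i _.
have nE n : norm_series n x = norm_series n y by apply: eq_bigr => i _; rewrite exy.
have sE : norm_series_sup x = norm_series_sup y.
  by rewrite /norm_series_sup; under eq_fun do rewrite nE.
rewrite /sum_series sE; case: ifP => // _.
by congr Complex; under eq_fun do rewrite pE.
Qed.

End SeriesDefinitions.

Section SeriesLimit.
Context d (T : measurableType d) (R : realType)
  (mu : {measure set T -> \bar R}) (D : set T).
Hypotheses (mD : measurable D) (fD : (mu D < +oo)%E).
Variables (e : nat -> T -> R[i]) (q X : R).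
Hypotheses (ce : forall i, cbm (e i)) (q1 : 1 < q).
Local Notation norm_series := (norm_series e).
Local Notation part_series := (part_series e).
Local Notation norm_series_sup := (norm_series_sup e q).
Local Notation sum_series := (sum_series e q).

Let q0 : 0 < q. Proof. exact: lt_trans q1. Qed.

Hypothesis hX : forall n, Rintegral mu D (fun x => norm_series n x `^ q) <= X.

Lemma norm_series_ge0 n x : 0 <= norm_series n x.
Proof. by apply: sumr_ge0 => i _; exact: nc_ge0. Qed.

Lemma norm_series_nd x : nondecreasing_seq (norm_series ^~ x).
Proof.
apply/nondecreasing_seqP => n.
by rewrite /norm_series big_nat_recr//= lerDl nc_ge0.
Qed.

Lemma part_series_le n x : nc (part_series n x) <= norm_series n x.
Proof. exact: nc_sum. Qed.

Lemma cbm_part_series n : cbm (part_series n).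
Proof. by apply: cbm_sum => i _. Qed.

Lemma bmf_norm_series n : bmf (norm_series n).
Proof. by apply: bmf_sum => i _; exact: bmf_nc. Qed.

Let bgq n : bmf (fun x => norm_series n x `^ q).
Proof. exact: (bmf_powR (norm_series_ge0 n) (ltW q0) (bmf_norm_series n)). Qed.

Let ndq x : nondecreasing_seq (fun n => (norm_series n x `^ q)%:E).
Proof.
move=> m n mn; rewrite lee_fin ge0_ler_powR ?nnegrE ?norm_series_ge0 ?(ltW q0)//.
exact: norm_series_nd.
Qed.

Let cvq x : (fun n => (norm_series n x `^ q)%:E) @ \oo --> norm_series_sup x.
Proof. exact: (ereal_nondecreasing_is_cvgn (ndq x)). Qed.

Lemma norm_series_sup_ge n x : ((norm_series n x `^ q)%:E <= norm_series_sup x)%E.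
Proof.
rewrite /norm_series_sup (cvg_lim _ (ereal_nondecreasing_cvgn (ndq x)))//.
by apply: ereal_sup_ubound; exists n.
Qed.

Lemma norm_series_sup_ge0 x : (0 <= norm_series_sup x)%E.
Proof. by apply: le_trans (norm_series_sup_ge 0 x); rewrite lee_fin powR_ge0. Qed.

Lemma measurable_norm_series_sup : measurable_fun setT norm_series_sup.
Proof.
apply: (emeasurable_fun_cvg (fun n x => (norm_series n x `^ q)%:E)).
  by move=> n; apply/measurable_EFinP; case: (bgq n).
by move=> x _; exact: cvq.
Qed.

Lemma integral_norm_series_sup : (\int[mu]_(x in D) norm_series_sup x <= X%:E)%E.
Proof.
rewrite /norm_series_sup monotone_convergence//.
- apply: lime_le.
    apply: ereal_nondecreasing_is_cvgn => m n mn.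
    apply: le_ge0_integral => x _; first by rewrite lee_fin powR_ge0.
    exact: ndq.
  by apply: nearW => n; rewrite (EFin_expect mD fD (bgq n)) lee_fin.
- by move=> n; apply: measurable_funTS; apply/measurable_EFinP; case: (bgq n).
- by move=> n x _; rewrite lee_fin powR_ge0.
Qed.

Let bounded x : (norm_series_sup x < +oo)%E ->
  forall n, norm_series n x <= fine (norm_series_sup x) `^ q^-1.
Proof.
move=> xfin n; have gf : norm_series_sup x \is a fin_num.
  by rewrite ge0_fin_numE// norm_series_sup_ge0.
have := norm_series_sup_ge n x; rewrite -(fineK gf) lee_fin => h.
rewrite -[leLHS](@powRr1 _ _ (norm_series_ge0 n x)) -(mulfV (lt0r_neq0 q0)) powRrM.
rewrite ge0_ler_powR ?nnegrE ?powR_ge0 ?invr_ge0 ?(ltW q0)//.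
by rewrite (le_trans _ h)// powR_ge0.
Qed.

Let cv_part (F : nat -> R) x : (norm_series_sup x < +oo)%E ->
  (forall i, `|F i| <= nc (e i x)) ->
  cvgn (fun n => \sum_(0 <= i < n) F i).
Proof.
move=> xfin hF; apply: normed_cvg.
apply: (@series_le_cvg _ _ (fun i => nc (e i x))) => //.
  by move=> i; exact: normr_ge0.
  by move=> i; exact: nc_ge0.
apply: nondecreasing_is_cvgn; first exact: norm_series_nd.
exists (fine (norm_series_sup x) `^ q^-1) => _ [n _ <-]; exact: bounded.
Qed.

Let Re_part n x : complex.Re (part_series n x) = \sum_(0 <= i < n) complex.Re (e i x).
Proof. by rewrite /part_series; apply: (big_morph _ (@ReD R)). Qed.

Let Im_part n x : complex.Im (part_series n x) = \sum_(0 <= i < n) complex.Im (e i x).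
Proof. by rewrite /part_series; apply: (big_morph _ (@ImD R)). Qed.

Lemma cvg_Re_part x : (norm_series_sup x < +oo)%E ->
  (fun n => complex.Re (part_series n x)) @ \oo --> complex.Re (sum_series x).
Proof.
move=> xfin; rewrite /sum_series xfin /=.
have -> : (fun n => complex.Re (part_series n x)) = fun n => \sum_(0 <= i < n) complex.Re (e i x).
  by apply/funext => n; exact: Re_part.
by apply: (cv_part xfin) => i; exact: Re_le_nc.
Qed.

Lemma cvg_Im_part x : (norm_series_sup x < +oo)%E ->
  (fun n => complex.Im (part_series n x)) @ \oo --> complex.Im (sum_series x).
Proof.
move=> xfin; rewrite /sum_series xfin /=.
have -> : (fun n => complex.Im (part_series n x)) = fun n => \sum_(0 <= i < n) complex.Im (e i x).
  by apply/funext => n; exact: Im_part.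
by apply: (cv_part xfin) => i; exact: Im_le_nc.
Qed.

Let measurable_lim (h : nat -> T -> R) (f : T -> R) :
  (forall n, bmf (h n)) ->
  (forall x, (norm_series_sup x < +oo)%E -> h ^~ x @ \oo --> f x) ->
  (forall x, ~~ (norm_series_sup x < +oo)%E -> f x = 0) ->
  measurable_fun setT f.
Proof.
move=> bh hf f0.
apply: (measurable_fun_cvg (h := fun n x => if (norm_series_sup x < +oo)%E then h n x else 0)).
  move=> n; apply: measurable_fun_ifT; last exact: measurable_cst.
    apply: measurable_fun_lte; first exact: measurable_norm_series_sup.
    exact: measurable_cst.
  by case: (bh n).
move=> x _; have [h0|h0] := boolP (norm_series_sup x < +oo)%E; first exact: hf.
by rewrite (f0 _ h0); exact: cvg_cst.
Qed.

Lemma measurable_Re_sum : measurable_fun setT (fun x => complex.Re (sum_series x)).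
Proof.
apply: (measurable_lim (fun n => proj1 (cbm_part_series n))); first exact: cvg_Re_part.
by move=> x; rewrite /sum_series => /negbTE ->.
Qed.

Lemma measurable_Im_sum : measurable_fun setT (fun x => complex.Im (sum_series x)).
Proof.
apply: (measurable_lim (fun n => proj2 (cbm_part_series n))); first exact: cvg_Im_part.
by move=> x; rewrite /sum_series => /negbTE ->.
Qed.

Lemma sum_series_le x : ((nc (sum_series x) `^ q)%:E <= norm_series_sup x)%E.
Proof.
have [xfin|xoo] := boolP (norm_series_sup x < +oo)%E; last first.
  by rewrite /sum_series (negbTE xoo) Normc.normc0 powR0 ?gt_eqF// norm_series_sup_ge0.
have gf : norm_series_sup x \is a fin_num.
  by rewrite ge0_fin_numE// norm_series_sup_ge0.
have G0 : 0 <= fine (norm_series_sup x) by rewrite fine_ge0// norm_series_sup_ge0.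
set B := fine (norm_series_sup x) `^ q^-1.
have B0 : 0 <= B by exact: powR_ge0.
have hB : nc (sum_series x) <= B.
  rewrite -(@ler_pXn2r _ 2)// ?nnegrE ?nc_ge0// sqr_nc.
  have c1 := cvg_Re_part xfin; have c2 := cvg_Im_part xfin.
  have cv : (fun n => complex.Re (part_series n x) * complex.Re (part_series n x) +
      complex.Im (part_series n x) * complex.Im (part_series n x)) @ \oo -->
      complex.Re (sum_series x) ^+ 2 + complex.Im (sum_series x) ^+ 2.
    by rewrite !expr2; apply: cvgD; apply: cvgM.
  rewrite -(cvg_lim _ cv)//; apply: limr_le.
    by apply/cvg_ex; eexists; exact: cv.
  apply: nearW => n; rewrite /= -!expr2 -sqr_nc.
  rewrite ler_pXn2r ?nnegrE ?nc_ge0//.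
  exact: le_trans (part_series_le n x) (bounded xfin n).
rewrite -(fineK gf) lee_fin.
apply: (@le_trans _ _ (B `^ q)).
  by rewrite ge0_ler_powR ?nnegrE ?nc_ge0 ?(ltW q0).
by rewrite /B -powRrM mulVf ?gt_eqF// powRr1.
Qed.

(** Since [a <= 1 + a ^ q], this function dominates all partial sums; the constant is integrable
    because the measure of [D] is finite. *)
Lemma integrable_dominant : mu.-integrable D (fun x => 1 + norm_series_sup x)%E.
Proof.
have ns : mu.-integrable D norm_series_sup.
  apply/integrableP; split; first by apply: measurable_funTS; exact: measurable_norm_series_sup.
  under eq_integral do rewrite gee0_abs ?norm_series_sup_ge0//.
  by apply: le_lt_trans integral_norm_series_sup _; rewrite ltry.
apply: (integrableD mD _ ns).
exact: (bmf_integrable mD fD (bmf_cst _ 1)).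
Qed.

Let le_1D (a : R) (y : \bar R) : 0 <= a -> ((a `^ q)%:E <= y)%E -> (a%:E <= 1 + y)%E.
Proof.
move=> a0 ay; apply: (@le_trans _ _ (1 + (a `^ q)%:E)%E); last exact: leeD2l.
rewrite -EFinD lee_fin; have [a1|a1] := leP a 1.
  by rewrite (le_trans a1)// lerDl powR_ge0.
apply: (@le_trans _ _ (a `^ q)); last by rewrite lerDr.
by rewrite -[leLHS](powRr1 a0) ler_powR// ltW.
Qed.

Lemma nc_sum_le_dominant x : ((nc (sum_series x))%:E <= 1 + norm_series_sup x)%E.
Proof. by apply: le_1D; [exact: nc_ge0|exact: sum_series_le]. Qed.

Lemma integral_nc_sum_lt : (\int[mu]_(x in D) (nc (sum_series x))%:E < +oo)%E.
Proof.
have /integrableP[_ h] := integrable_dominant.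
apply: le_lt_trans h; apply: le_ge0_integral => x _; first by rewrite lee_fin nc_ge0.
by apply: (le_trans (nc_sum_le_dominant x)); exact: lee_abs.
Qed.

Lemma integral_nc_sum_powR : (\int[mu]_(x in D) (nc (sum_series x) `^ q)%:E <= X%:E)%E.
Proof.
apply: le_trans integral_norm_series_sup; apply: le_ge0_integral => x _.
  by rewrite lee_fin powR_ge0.
exact: sum_series_le.
Qed.

Let Rintegral_lim (h : nat -> T -> R) (f : T -> R) (k : R) (n0 : nat) :
  (forall n, bmf (h n)) -> measurable_fun setT f ->
  (forall n x, `|h n x| <= norm_series n x) ->
  (forall x, (norm_series_sup x < +oo)%E -> h ^~ x @ \oo --> f x) ->
  (forall n, (n0 <= n)%N -> Rintegral mu D (h n) = k) ->
  Rintegral mu D f = k.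
Proof.
move=> bh mf hle hf hk.
have [] := @dominated_convergence _ _ _ mu D mD (fun n x => (h n x)%:E) (fun x => (f x)%:E)
  (fun x => 1 + norm_series_sup x)%E.
- by move=> n; apply: measurable_funTS; apply/measurable_EFinP; case: (bh n).
- by apply: measurable_funTS; exact/measurable_EFinP.
- have := integrable_ae mD integrable_dominant; apply: filterS => x xfin Dx.
  apply: cvg_EFin; first by near=> n.
  apply: hf; move: (xfin Dx); rewrite ge0_fin_numE.
    by move: (norm_series_sup_ge0 x); case: (norm_series_sup x) => [r| |]; rewrite ?ltry.
  by rewrite adde_ge0// norm_series_sup_ge0.
- exact: integrable_dominant.
- apply: aeW => x n _; rewrite abse_EFin; apply: le_1D; first exact: normr_ge0.
  apply: le_trans (norm_series_sup_ge n x).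
  by rewrite lee_fin ge0_ler_powR ?nnegrE ?normr_ge0 ?norm_series_ge0 ?(ltW q0).
move=> _ _ cv; rewrite /Rintegral.
suff -> : (\int[mu]_(x in D) (f x)%:E)%E = k%:E by [].
apply: (cvg_unique _ cv) => //.
apply: cvg_near_cst; exists n0 => // n /= nn.
by rewrite (EFin_expect mD fD (bh n)) hk.
Unshelve. all: by end_near. Qed.

(** Dominated convergence for the pairing with [w]. When [w] is a conjugate plane wave, the pairings
    of the partial sums become constant in [n], so the limit is identified at once. *)
Lemma cexpect_sum_series (w : T -> R[i]) (k : R[i]) (n0 : nat) :
  cbm w -> (forall x, nc (w x) <= 1) ->
  (forall n, (n0 <= n)%N -> cexpect mu D (fun x => part_series n x * w x) = k) ->
  cexpect mu D (fun x => sum_series x * w x) = k.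
Proof.
move=> cw w1 hk.
have c n := cbmM (cbm_part_series n) cw.
have le n x : nc (part_series n x * w x) <= norm_series n x.
  rewrite Normc.normcM -[leRHS]mulr1 ler_pM ?nc_ge0// part_series_le//.
have mRw : measurable_fun setT (fun x => complex.Re (w x)) by case: cw => -[].
have mIw : measurable_fun setT (fun x => complex.Im (w x)) by case: cw => _ [].
apply: complex_ext => /=.
- apply: (Rintegral_lim (fun n => proj1 (c n)) _ _ _ (n0 := n0)).
  + have -> : (fun x => complex.Re (sum_series x * w x)) = fun x =>
        complex.Re (sum_series x) * complex.Re (w x) - complex.Im (sum_series x) * complex.Im (w x).
      by apply/funext => x; rewrite ReM.
    apply: measurable_funB; apply: measurable_funM => //.
      exact: measurable_Re_sum.
    exact: measurable_Im_sum.
  + by move=> n x; exact: le_trans (Re_le_nc _) (le n x).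
  + move=> x xfin; rewrite ReM.
    have -> : (fun n => complex.Re (part_series n x * w x)) = fun n =>
        complex.Re (part_series n x) * complex.Re (w x) - complex.Im (part_series n x) * complex.Im (w x).
      by apply/funext => n; rewrite ReM.
    apply: cvgB; apply: cvgM; try exact: cvg_cst.
      exact: cvg_Re_part.
    exact: cvg_Im_part.
  + by move=> n nn; rewrite -(hk n nn).
- apply: (Rintegral_lim (fun n => proj2 (c n)) _ _ _ (n0 := n0)).
  + have -> : (fun x => complex.Im (sum_series x * w x)) = fun x =>
        complex.Re (sum_series x) * complex.Im (w x) + complex.Im (sum_series x) * complex.Re (w x).
      by apply/funext => x; rewrite ImM.
    apply: measurable_funD; apply: measurable_funM => //.
      exact: measurable_Re_sum.
    exact: measurable_Im_sum.
  + by move=> n x; exact: le_trans (Im_le_nc _) (le n x).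
  + move=> x xfin; rewrite ImM.
    have -> : (fun n => complex.Im (part_series n x * w x)) = fun n =>
        complex.Re (part_series n x) * complex.Im (w x) + complex.Im (part_series n x) * complex.Re (w x).
      by apply/funext => n; rewrite ImM.
    apply: cvgD; apply: cvgM; try exact: cvg_cst.
      exact: cvg_Re_part.
    exact: cvg_Im_part.
  + by move=> n nn; rewrite -(hk n nn).
Qed.

End SeriesLimit.

(** * The estimate for all data *)

Section DyadicLevel.
Implicit Types k : int * int.

(** The least [i] for which both components have absolute value below [2 ^ i]; the zero frequency
    has level [0]. *)
Definition level k : nat := up_log 2 (maxn `|k.1|%N `|k.2|%N).+1.

Definition level_radius (i : nat) : nat := (2 ^ i).-1.

Lemma level_radius_size i : ((level_radius i).*2.+1 <= 2 * 2 ^ i)%N.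
Proof.
by rewrite /level_radius; have := expn_gt0 2 i; move: (2 ^ i)%N => N; lia.
Qed.

Lemma mem_box_level k : k \in box (level_radius (level k)).
Proof.
have := @up_logP 2 (maxn `|k.1| `|k.2|).+1 isT.
rewrite -/(level k) mem_box /level_radius; move: (2 ^ level k)%N => N.
by move=> h; apply/andP; split; lia.
Qed.

Lemma mem_box_mono k i j : (i <= j)%N ->
  k \in box (level_radius i) -> k \in box (level_radius j).
Proof.
move=> ij; rewrite !mem_box /level_radius => /andP[h1 h2].
have := leq_pexp2l (isT : 0 < 2)%N ij; move: h1 h2; have := expn_gt0 2 i.
by move: (2 ^ i)%N (2 ^ j)%N => A B *; apply/andP; split; lia.
Qed.

(** By minimality of the level, [2 ^ (level k - 1)] is at most the larger component of a nonzero
    frequency; squaring produces the factor [4]. *)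
Lemma level_le k : (4 ^ level k <= 4 * (1 + `|k.1| ^ 2 + `|k.2| ^ 2))%N.
Proof.
have -> : (4 ^ level k = (2 ^ level k) ^ 2)%N by rewrite -expnM mulnC expnM.
rewrite /level; set M := maxn _ _.
have [->|M0] := posnP M; first by rewrite up_log1; lia.
have := @up_log_gtn 2 M.+1 isT; rewrite ltnS M0 => /(_ isT).
have : (0 < up_log 2 M.+1)%N by rewrite up_log_gt0 !ltnS M0.
case: (up_log 2 M.+1) => // l _ /=; rewrite ltnS (expnS 2 l).
move: (2 ^ l)%N => A AM.
have : (M ^ 2 <= `|k.1| ^ 2 + `|k.2| ^ 2)%N.
  rewrite /M /maxn; case: ifP => _; [exact: leq_addl|exact: leq_addr].
have : (A ^ 2 <= M ^ 2)%N by rewrite leq_sqr.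
by rewrite expnMn; lia.
Qed.

Lemma level_japanese2 (R : realType) k :
  2 `^ (level k)%:R ^+ 2 <= 4 * japanese2 k.1 k.2 :> R.
Proof.
rewrite powR_mulrn// -exprM mulnC exprM.
have -> : (2 ^+ 2 : R) = 4 by rewrite -natrX.
have sq (m : int) : (m%:~R ^+ 2 : R) = (`|m| ^ 2)%N%:R.
  by case: m => n; rewrite ?NegzE ?mulrNz ?sqrrN natrX.
rewrite /japanese2 !sq -natrX -(natrD _ 1) -natrD -natrM ler_nat.
exact: level_le.
Qed.

End DyadicLevel.

Lemma big_seq_le_sub (K : eqType) (R : realType) (s1 s2 : seq K) (F : K -> R) :
  uniq s1 -> uniq s2 -> {subset s1 <= s2} -> (forall k, 0 <= F k) ->
  \sum_(k <- s1) F k <= \sum_(k <- s2) F k.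
Proof.
move=> u1 u2 s12 F0; rewrite [leRHS](bigID (mem s1))/=.
rewrite -[X in _ <= X + _]big_filter.
have -> : \sum_(k <- [seq k <- s2 | k \in s1]) F k = \sum_(k <- s1) F k.
  apply: perm_big; apply: uniq_perm => //; first exact: filter_uniq.
  by move=> k; rewrite mem_filter; case: (boolP (k \in s1)) => // /s12 ->.
by rewrite lerDl; apply: sumr_ge0.
Qed.

Lemma sum_seq_le_esum (K : choiceType) (R : realType) (s : seq K) (F : K -> R) :
  uniq s -> (forall k, 0 <= F k) ->
  ((\sum_(k <- s) F k)%:E <= \esum_(k in [set: K]) (F k)%:E)%E.
Proof.
move=> us F0; apply: esum_ge; exists [set` s]; first by split.
by rewrite -sumEFin fsbig_seq.
Qed.

Section Blocks.
Context {R : realType}.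
Local Notation RT := (measurableTypeR R).
Local Notation leb := (@lebesgue_measure R).
Local Notation area := (torus_measure R).
Variable u : int -> int -> R[i].

(** The boxes are full squares, which is what the estimate on a box requires; the restriction to the
    dyadic shell is put into the coefficients. *)
Definition block_coef i (k : int * int) : R[i] :=
  if level k == i then u k.1 k.2 else 0.

Definition block i (z : R * (R * R)) : R[i] :=
  evol (box (level_radius i)) wave schr_phase (block_coef i) z.

Definition block_norm i : R :=
  Num.sqrt (\sum_(k <- box (level_radius i)) nc (block_coef i k) ^+ 2).

Let mD := @measurable_torus_square R.
Let fD := @finite_torus_square R.

Lemma cbm_block i : @cbm _ (RT * (RT * RT))%type R (block i).
Proof. exact: (cbm_evol (S := RT) (T := (RT * RT)%type) _ cbm_wave cbm_schr_phase). Qed.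

Lemma cbm_block_pair i t : @cbm _ (RT * RT)%type R (fun x => block i (t, x)).
Proof. exact: (cbm_comp (@pair1_measurable _ _ RT (RT * RT)%type t) (cbm_block i)). Qed.

Lemma block_biperiodic i t : biperiodic (fun x => block i (t, x)).
Proof.
move=> x y; have per (k : int * int) (a b : R) :
    wave k (a + 2 * pi, b) = wave k (a, b) /\ wave k (a, b + 2 * pi) = wave k (a, b).
  rewrite /wave /=; split.
    have -> : k.1%:~R * (a + 2 * pi) + k.2%:~R * b =
      (k.1%:~R * a + k.2%:~R * b) + 2 * pi * k.1%:~R by ring.
    by rewrite cisD cis_2pi_int mulr1.
  have -> : k.1%:~R * a + k.2%:~R * (b + 2 * pi) =
    (k.1%:~R * a + k.2%:~R * b) + 2 * pi * k.2%:~R by ring.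
  by rewrite cisD cis_2pi_int mulr1.
by split; apply: eq_bigr => k _; congr (_ * _); case: (per k x y).
Qed.

Lemma block_norm_ge0 i : 0 <= block_norm i. Proof. exact: sqrtr_ge0. Qed.

Lemma sqr_block_norm i :
  block_norm i ^+ 2 = \sum_(k <- box (level_radius i)) nc (block_coef i k) ^+ 2.
Proof. by rewrite sqr_sqrtr// sumr_ge0// => k _; exact: sqr_ge0. Qed.

(** Each frequency belongs to one level only, and [4 ^ level] is at most [4 * japanese2]; raised to
    the power [s <= 1] this costs at most a factor [4]. *)
Lemma sum_block_norm (s : R) n : 0 <= s <= 1 ->
  ((\sum_(0 <= i < n) (2 `^ (i%:R * s) * block_norm i) ^+ 2)%:E <=
   4%:E * \esum_(k in [set: int * int])
     (japanese2 k.1 k.2 `^ s * nc (u k.1 k.2) ^+ 2)%:E)%E.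
Proof.
move=> /andP[s0 s1].
pose F k : R := japanese2 k.1 k.2 `^ s * nc (u k.1 k.2) ^+ 2.
have F0 k : 0 <= F k by rewrite mulr_ge0 ?powR_ge0 ?sqr_ge0.
pose N := level_radius n.
have hi i : (i < n)%N -> (2 `^ (i%:R * s) * block_norm i) ^+ 2 <=
    4 * \sum_(k <- box N) (if level k == i then F k else 0).
  move=> ni; rewrite exprMn sqr_block_norm !mulr_sumr.
  apply: le_trans (big_seq_le_sub (uniq_box (level_radius i)) (uniq_box N) _ _); last 2 first.
  - by move=> k; exact: (mem_box_mono (ltnW ni)).
  - by move=> k; case: ifP => _; rewrite ?mulr0// mulr_ge0.
  apply: ler_sum => k _; rewrite /block_coef; case: eqP => [<-|_]; last first.
    by rewrite Normc.normc0 expr0n/= !mulr0.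
  rewrite /F mulrA ler_wpM2r ?sqr_ge0// powRrM -powR_mulrn ?powR_ge0// -powRrM mulrC powRrM.
  rewrite powR_mulrn ?powR_ge0//.
  have J0 : 0 <= japanese2 k.1 k.2 :> R by rewrite !addr_ge0 ?sqr_ge0.
  apply: (@le_trans _ _ ((4 * japanese2 k.1 k.2) `^ s)).
    rewrite ge0_ler_powR ?nnegrE ?sqr_ge0 ?mulr_ge0//; exact: level_japanese2.
  rewrite powRM// ler_wpM2r ?powR_ge0// -[leRHS]powRr1// ler_powR// ler1n//.
apply: (@le_trans _ _ (4 * \sum_(k <- box N) F k)%:E); last first.
  by rewrite EFinM lee_wpmul2l ?lee_fin//; exact: (sum_seq_le_esum (uniq_box N) F0).
rewrite lee_fin.
apply: (@le_trans _ _ (\sum_(0 <= i < n) 4 * \sum_(k <- box N) (if level k == i then F k else 0))).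
  by rewrite big_seq [leRHS]big_seq; apply: ler_sum => i; rewrite mem_index_iota => /andP[_]; exact: hi.
rewrite -mulr_sumr ler_wpM2l// exchange_big; apply: ler_sum => k _ /=.
rewrite -big_mkcond/=; have [kn|nk] := ltnP (level k) n; last first.
  rewrite big_nat_cond big_pred0// => i; apply/negbTE/negP => /andP[/= h /eqP e].
  by move: nk; rewrite e leqNgt h.
rewrite (big_nat_widenl _ 0)// big_mkcond (bigD1_seq (level k))//= ?iota_uniq//; last first.
  by rewrite mem_index_iota.
rewrite eqxx big1 ?addr0// => i /negbTE; rewrite eq_sym => ->.
by [].
Qed.

(** By orthogonality only the block at the level of [l] contributes, so the coefficient of the
    partial sums no longer changes once that level has been passed. *)
Lemma cexpect_block (l : int * int) t n : (level l < n)%N ->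
  cexpect area torus_square
    (fun x => part_series (fun i x => block i (t, x)) n x * conjc (wave l x)) =
  (torus_area)%:C * (schr_phase l t * u l.1 l.2).
Proof.
move=> ln.
have cw k : @cbm _ (RT * RT)%type R (fun x => wave k x * conjc (wave l x)).
  exact: (cbmM (cbm_wave k) (cbm_conj (cbm_wave l))).
have cb i : @cbm _ (RT * RT)%type R (fun x => block i (t, x) * conjc (wave l x)).
  exact: (cbmM (cbm_block_pair i t) (cbm_conj (cbm_wave l))).
transitivity (cexpect area torus_square
    (fun x => \sum_(0 <= i < n) block i (t, x) * conjc (wave l x))).
  by apply: eq_cexpect => x _; rewrite mulr_suml.
rewrite (cexpect_sum mD fD); last by move=> i _; exact: cb.
transitivity (\sum_(0 <= i < n) (torus_area)%:C * (schr_phase l t * block_coef i l)).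
  apply: eq_bigr => i _.
  transitivity (cexpect area torus_square (fun x => \sum_(k <- box (level_radius i))
      (block_coef i k * schr_phase k t) * (wave k x * conjc (wave l x)))).
    apply: eq_cexpect => x _; rewrite mulr_suml; apply: eq_bigr => k _.
    by rewrite -!mulrA.
  rewrite (cexpect_sum mD fD); last by move=> k _; exact: (cbmM (cbm_cst _ _) (cw k)).
  have E k : cexpect area torus_square
      (fun x => (block_coef i k * schr_phase k t) * (wave k x * conjc (wave l x))) =
      if k == l then (torus_area)%:C * (schr_phase l t * block_coef i l) else 0.
    rewrite (cexpectZl mD fD _ (cw k)) cexpect_wave2.
    by case: eqP => [->|_]; [rewrite mulrC [block_coef i l * _]mulrC|rewrite mulr0].
  rewrite (eq_bigr _ (fun k _ => E k)).
  have [lb|lb] := boolP (l \in box (level_radius i)).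
    rewrite (bigD1_seq l)// ?uniq_box// eqxx big1_seq; first exact: addr0.
    by move=> k /andP[/negbTE ->].
  have -> : block_coef i l = 0.
    rewrite /block_coef; case: eqP => // e.
    by move: lb; rewrite -e mem_box_level.
  by rewrite !mulr0 big1// => k _; rewrite if_same.
rewrite -mulr_sumr -mulr_sumr; congr (_ * (_ * _)).
rewrite (bigD1_seq (level l))//= ?iota_uniq//; last by rewrite mem_index_iota.
rewrite {1}/block_coef eqxx big1 ?addr0// => i /negbTE.
by rewrite /block_coef eq_sym => ->.
Qed.

End Blocks.

Section Limit.
Context {R : realType}.
Local Notation RT := (measurableTypeR R).
Local Notation leb := (@lebesgue_measure R).
Local Notation area := (torus_measure R).
Variable u : @torus_distr R.

Let mD := @measurable_torus_square R.
Let fD := @finite_torus_square R.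

Let measurable_pairR (f : R * R -> R) :
  @measurable_fun _ _ (RT * RT)%type R setT f -> measurable_fun setT f.
Proof.
move=> mf; have mid : @measurable_fun _ _ (R * R)%type (RT * RT)%type setT id.
  apply/measurable_fun_pairP; split.
    exact: (measurableT_comp measurable_idRT measurable_fst).
  exact: (measurableT_comp measurable_idRT measurable_snd).
exact: (measurableT_comp mf mid).
Qed.

(** The sum of the blocks is integrable, periodic and has the Fourier coefficients of the evolved
    distribution, so it competes in the infimum defining the norm. *)
Lemma distr_Lnorm_blocks (q t X : R) : 1 < q ->
  (forall n, Rintegral area torus_square
    (fun x => norm_series (fun i x => block u i (t, x)) n x `^ q) <= X) ->
  (distr_Lnorm q (expitP t u) <= (X `^ q^-1)%:E)%E.
Proof.
move=> q1 hX; set e := fun i x => block u i (t, x).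
have ce i : @cbm _ (RT * RT)%type R (e i) by exact: cbm_block_pair.
have X0 : 0 <= X by apply: le_trans (hX 0); apply: expect_ge0 => x _; exact: powR_ge0.
pose f := sum_series e q.
apply: (@le_trans _ _ (torus_Lnorm q f)).
  apply: ereal_inf_lbound; exists f => //; split; first split.
  - by move=> x y; split; apply: eq_sum_series => i; case: (@block_biperiodic _ u i t x y).
  - by apply: measurable_pairR; exact: measurable_Re_sum.
  - by apply: measurable_pairR; exact: measurable_Im_sum.
  - exact: (integral_nc_sum_lt mD fD ce q1 hX).
  - move=> m n.
    have h := cexpect_sum_series mD fD ce q1 hX (cbm_conj (cbm_wave (m, n))) _
      (fun k => @cexpect_block _ u (m, n) t k).
    rewrite /fourier_coef.
    have -> : integral_torus (fun z => f z * cis (- (m%:~R * z.1 + n%:~R * z.2))) =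
       cexpect area torus_square (fun z => f z * conjc (wave (m, n) z)).
      by apply: eq_cexpect => z _; rewrite /wave cisN.
    rewrite h; last by move=> x; rewrite nc_conjc nc_wave.
    by rewrite mulrA -realcM /torus_area mulVf ?mul1r// expf_neq0// mulf_neq0 ?gt_eqF ?pi_gt0.
rewrite /torus_Lnorm -poweR_EFin gt0_ler_poweR ?invr_ge0 ?(ltW (lt_trans ltr01 q1))//.
- rewrite in_itv/= leey andbT; apply: integral_ge0 => x _; by rewrite lee_fin powR_ge0.
- by rewrite in_itv/= lee_fin X0 leey.
exact: (integral_nc_sum_powR mD fD ce q1 hX).
Qed.

End Limit.

Section Conclusion.
Context {R : realType}.
Local Notation RT := (measurableTypeR R).
Local Notation leb := (@lebesgue_measure R).
Local Notation area := (torus_measure R).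
Variables (p q : R).
Hypotheses (pq : p^-1 + q^-1 = 2^-1) (p2 : 2 < p).

Let mD := @measurable_torus_square R.
Let fD := @finite_torus_square R.
Let mI := @measurable_timeI R 0 1.
Let fI := finite_timeI (@ler01 R).

Let p0 : 0 < p. Proof. exact: lt_trans p2. Qed.
Let qV : q^-1 = 2^-1 - p^-1. Proof. by rewrite -pq; ring. Qed.
Let pV : p^-1 < 2^-1. Proof. by rewrite ltf_pV2 ?posrE. Qed.
Let q0 : 0 < q. Proof. by rewrite -invr_gt0 qV subr_gt0. Qed.
Let q_gt2 : 2 < q. Proof. by rewrite -ltf_pV2 ?posrE// qV gtrBl invr_gt0. Qed.

(** Staying below [1 / q] keeps [p_1 > 2], staying below [1 / p] keeps [p_2] positive; both shifted
    pairs are then admissible. *)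
Let eps : R := Num.min p^-1 q^-1 / 2.
Let eps0 : 0 < eps. Proof. by rewrite divr_gt0// lt_min !invr_gt0 p0. Qed.
Let epsp : eps < p^-1.
Proof.
rewrite /eps ltr_pdivrMr// (@le_lt_trans _ _ p^-1) ?ge_min ?lexx//.
by rewrite ltr_pMr ?invr_gt0// ltr1n.
Qed.
Let epsq : eps < q^-1.
Proof.
rewrite /eps ltr_pdivrMr// (@le_lt_trans _ _ q^-1) ?ge_min ?lexx ?orbT//.
by rewrite ltr_pMr ?invr_gt0// ltr1n.
Qed.

Let p_1 := (p^-1 + eps)^-1.
Let p_2 := (p^-1 - eps)^-1.
Let q_1 := (q^-1 - eps)^-1.
Let q_2 := (q^-1 + eps)^-1.

Let p_1_gt2 : 2 < p_1.
Proof.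
have h : 0 < p^-1 + eps by rewrite addr_gt0// invr_gt0.
by rewrite -ltf_pV2 ?posrE ?invr_gt0// /p_1 invrK -pq ltrD2l.
Qed.
Let p_2_gt2 : 2 < p_2.
Proof.
have h : 0 < p^-1 - eps by rewrite subr_gt0.
by rewrite -ltf_pV2 ?posrE ?invr_gt0// /p_2 invrK (lt_trans _ pV)// gtrBl.
Qed.
Let pq1 : p_1^-1 + q_1^-1 = 2^-1. Proof. by rewrite !invrK -pq; ring. Qed.
Let pq2 : p_2^-1 + q_2^-1 = 2^-1. Proof. by rewrite !invrK -pq; ring. Qed.
Let q_1_gt0 : 0 < q_1. Proof. by rewrite invr_gt0 subr_gt0. Qed.
Let q_2_gt0 : 0 < q_2. Proof. by rewrite invr_gt0 addr_gt0// invr_gt0. Qed.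

(** The two square roots let one constant serve both shifted pairs; the factor [2] absorbs the size
    of a box, at most [2 * 2 ^ i]. *)
Definition blocks_const : R :=
  2 * (Num.sqrt (block_const p_1 q_1) + Num.sqrt (block_const p_2 q_2)).

Let blocks_const_ge0 : 0 <= blocks_const.
Proof. by rewrite mulr_ge0// addr_ge0// sqrtr_ge0. Qed.

Let block_bound (u : int -> int -> R[i]) i (a b : R) :
  a^-1 + b^-1 = 2^-1 -> 2 < a -> 2 * Num.sqrt (block_const a b) <= blocks_const ->
  Rintegral leb `[0, 1]%classic
    (fun t => blockQ b (level_radius i) (block_coef u i) t `^ (a / b)) <=
  (blocks_const * 2 `^ (i%:R / a) * block_norm u i) `^ a.
Proof.
move=> ab a2 hC; apply: (le_trans (block_strichartz ab a2 (level_radius i) (block_coef u i))).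
have a0 : 0 < a by exact: lt_trans a2.
set B := block_const a b.
have B0 : 0 <= B by exact: block_const_ge0.
rewrite -sqr_block_norm; move: (block_norm u i) (block_norm_ge0 u i) => s s0.
have -> : (B * s ^+ 2) `^ (a / 2) = (Num.sqrt B * s) `^ a.
  have -> : B * s ^+ 2 = (Num.sqrt B * s) `^ 2%:R.
    have Bs0 : 0 <= Num.sqrt B * s by rewrite mulr_ge0// sqrtr_ge0.
    by rewrite (powR_mulrn 2 Bs0) exprMn sqr_sqrtr.
  by rewrite -powRrM [2 * _]mulrC divfK.
have h : ((level_radius i).*2.+1)%:R <= (2 * 2 `^ (i%:R / a)) `^ a :> R.
  rewrite powRM ?powR_ge0// -powRrM divfK ?gt_eqF// powR_mulrn//.
  apply: (@le_trans _ _ (2 * 2 ^+ i)).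
    by rewrite -natrX -natrM ler_nat level_radius_size.
  rewrite ler_wpM2r ?exprn_ge0// -[leLHS]powRr1// ler_powR ?ler1n//.
  by rewrite (le_trans _ (ltW a2))// ler1n.
apply: (le_trans (ler_wpM2r (powR_ge0 _ _) h)).
rewrite -powRM ?mulr_ge0 ?sqrtr_ge0 ?powR_ge0//.
rewrite ge0_ler_powR ?nnegrE ?mulr_ge0 ?sqrtr_ge0 ?powR_ge0 ?(ltW a0)//.
rewrite mulrA ler_wpM2r// mulrAC ler_wpM2r// powR_ge0//.
Qed.

Lemma strichartz_blocks (u : int -> int -> R[i]) n :
  Rintegral leb `[0, 1]%classic (fun t => Rintegral area torus_square
    (fun x => norm_series (fun i x => block u i (t, x)) n x `^ q) `^ (p / q)) <=
  (dyadic_const eps blocks_const *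
   \sum_(0 <= i < n) (2 `^ (i%:R / p) * block_norm u i) ^+ 2) `^ (p / 2).
Proof.
have p10 : 0 < p_1 by exact: lt_trans p_1_gt2.
have p20 : 0 < p_2 by exact: lt_trans p_2_gt2.
have v0 (i : nat) (z : R * (R * R)) : 0 <= nc (block u i z) by exact: nc_ge0.
apply: (@dyadic_sum _ RT _ (RT * RT)%type R leb `[0, 1]%classic area torus_square mI fI mD fD
  p q p_1 q_1 p_2 q_2 eps p2 q_gt2 eps0 p10 p20 q_1_gt0 q_2_gt0 (invrK _) (invrK _)
  (invrK _) (invrK _) (fun i z => nc (block u i z)) blocks_const (block_norm u) v0
  (fun i => bmf_nc (cbm_block u i)) blocks_const_ge0 (block_norm_ge0 u) _ _ n).
- move=> i; apply: block_bound => //.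
  by rewrite /blocks_const mulrDr lerDl mulr_ge0// sqrtr_ge0.
- move=> i; apply: block_bound => //.
  by rewrite /blocks_const mulrDr lerDr mulr_ge0// sqrtr_ge0.
Qed.

Let dyadic_const_ge0 : 0 <= dyadic_const eps blocks_const.
Proof.
rewrite mulr_ge0 ?sqr_ge0// divr_ge0// subr_ge0.
by rewrite -[leRHS](powRr0 2) ler_powR ?ler1n// oppr_le0 ltW.
Qed.

Let sqrt_const_le (c s : R) : 0 <= c -> 0 <= s ->
  (c * (4 * s)) `^ 2^-1 <= (2 * Num.sqrt c + 1) * s `^ 2^-1.
Proof.
move=> c0 s0; have cs0 : 0 <= 4 * s by rewrite mulr_ge0.
rewrite !powR12_sqrt// ?mulr_ge0// sqrtrM// sqrtrM//.
have -> : Num.sqrt 4 = 2 :> R.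
  by rewrite (_ : 4 = 2 ^+ 2) ?sqrtr_sqr ?ger0_norm// -natrX.
by rewrite mulrA ler_wpM2r ?sqrtr_ge0// mulrC lerDl.
Qed.

Section Datum.
Variable u : @torus_distr R.

Let qnorm n t : R := Rintegral area torus_square
  (fun x => norm_series (fun i x => block u i (t, x)) n x `^ q).
Let L n t : R := qnorm n t `^ (p / q).

Let qnorm_ge0 n t : 0 <= qnorm n t.
Proof. by apply: expect_ge0 => x _; exact: powR_ge0. Qed.

Let bns n t : @bmf _ (RT * RT)%type R
  (fun x => norm_series (fun i x => block u i (t, x)) n x `^ q).
Proof.
apply: (bmf_powR _ (ltW q0)); first by move=> x; exact: norm_series_ge0.
by apply: bmf_norm_series => i; exact: cbm_block_pair.
Qed.

Let bL n : @bmf _ RT R (L n).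
Proof.
apply: bmf_powR; [by []|by rewrite divr_ge0// ltW|].
apply: (@bmf_expect2 _ _ RT (RT * RT)%type R area _ mD fD
  (fun z => norm_series (block u) n z `^ q)).
apply: (bmf_powR _ (ltW q0)); first by move=> x; exact: norm_series_ge0.
by apply: bmf_norm_series => i; exact: cbm_block.
Qed.

Let qnorm_nd t : nondecreasing_seq (qnorm ^~ t).
Proof.
move=> m n mn; apply: (le_expect mD fD (bns m t) (bns n t)) => x _.
rewrite ge0_ler_powR ?nnegrE ?norm_series_ge0 ?(ltW q0)//.
exact: norm_series_nd.
Qed.

Let ndL t : nondecreasing_seq (fun n => (L n t)%:E).
Proof.
move=> m n mn; rewrite lee_fin.
have pq0 : 0 <= p / q by rewrite divr_ge0// ltW.
exact: (ge0_ler_powR pq0 (qnorm_ge0 m t) (qnorm_ge0 n t) (qnorm_nd t mn)).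
Qed.

Let M t : \bar R := limn (fun n => (L n t)%:E).

Let L_le_M n t : ((L n t)%:E <= M t)%E.
Proof.
rewrite /M (cvg_lim _ (ereal_nondecreasing_cvgn (ndL t)))//.
by apply: ereal_sup_ubound; exists n.
Qed.

Let M_ge0 t : (0 <= M t)%E.
Proof. by apply: le_trans (L_le_M 0 t); rewrite lee_fin powR_ge0. Qed.

(** Where [M t] is infinite there is nothing to prove; elsewhere the partial norms are bounded and
    the sum of the blocks is a function in [L^q]. *)
Let distr_le_M t : (distr_Lnorm q (expitP t u) `^ p <= M t)%E.
Proof.
have [Mfin|] := boolP (M t < +oo)%E; last by rewrite -leNgt leye_eq => /eqP ->; rewrite leey.
have Mf : M t \is a fin_num by rewrite ge0_fin_numE.
set m := fine (M t); have m0 : 0 <= m by exact: fine_ge0.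
have q1 : 1 < q by rewrite (lt_trans _ q_gt2)// ltr1n.
have hq n : qnorm n t <= m `^ (q / p).
  have : L n t <= m by rewrite -lee_fin fineK.
  move=> h; have -> : qnorm n t = L n t `^ (q / p).
    rewrite /L -powRrM (_ : p / q * (q / p) = 1) ?powRr1//.
    by field; rewrite !gt_eqF.
  by rewrite ge0_ler_powR ?nnegrE ?powR_ge0 ?divr_ge0 ?(ltW q0) ?(ltW p0).
have h := distr_Lnorm_blocks q1 hq.
have d0 : (0 <= distr_Lnorm q (expitP t u))%E.
  by apply: le_ereal_inf_tmp => _ [f _ <-]; exact: poweR_ge0.
apply: (@le_trans _ _ (((m `^ (q / p)) `^ q^-1)%:E `^ p)%E).
  by apply: gt0_ler_poweR; rewrite ?in_itv/= ?leey ?andbT ?lee_fin ?powR_ge0 ?(ltW p0).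
rewrite poweR_EFin -!powRrM (_ : q / p * (q^-1 * p) = 1).
  by rewrite powRr1// fineK.
by field; rewrite !gt_eqF.
Qed.

Lemma LpLq_norm_le_Hnorm : in_H p^-1 u ->
  (LpLq_norm p q (fun t => expitP t u) <=
   (2 * Num.sqrt (dyadic_const eps blocks_const) + 1)%:E * Hnorm p^-1 u)%E.
Proof.
rewrite /in_H /Hnorm; set S := (X in (X `^ _)%E).
have S0 : (0 <= S)%E.
  by apply: esum_ge0 => k _; rewrite lee_fin mulr_ge0 ?powR_ge0 ?sqr_ge0.
move=> /lty_poweRy; rewrite invr_eq0 pnatr_eq0 => /(_ isT) Sfin.
have Sf : S \is a fin_num by rewrite ge0_fin_numE.
set s := fine S; have s0 : 0 <= s by exact: fine_ge0.
have SE : S = s%:E by rewrite fineK.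
set dc := dyadic_const eps blocks_const; pose K := dc * (4 * s).
have dc0 : 0 <= dc by exact: dyadic_const_ge0.
have K0 : 0 <= K by apply: (mulr_ge0 dc0); rewrite mulr_ge0.
have hL n : Rintegral leb `[0, 1]%classic (L n) <= K `^ (p / 2).
  apply: (le_trans (strichartz_blocks u n)).
  have p1 : 0 <= p^-1 <= 1.
    by rewrite invr_ge0 ltW//= invf_le1// ltW// (lt_trans _ p2)// ltr1n.
  have := sum_block_norm u n p1; rewrite -/S SE -EFinM lee_fin => h.
  rewrite ge0_ler_powR ?nnegrE ?divr_ge0 ?(ltW p0)//.
    by rewrite mulr_ge0// sumr_ge0// => i _; exact: sqr_ge0.
  by rewrite ler_wpM2l.
have hM : (\int[leb]_(t in `[0%R, 1%R]) M t <= (K `^ (p / 2))%:E)%E.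
  rewrite /M monotone_convergence//.
  - apply: lime_le.
      apply: ereal_nondecreasing_is_cvgn => m n mn.
      apply: le_ge0_integral => t _; first by rewrite lee_fin powR_ge0.
      exact: ndL.
    by apply: nearW => n; rewrite (EFin_expect mI fI (bL n)) lee_fin.
  - by move=> n; apply: measurable_funTS; apply/measurable_EFinP; case: (bL n).
  - by move=> n t _; rewrite lee_fin powR_ge0.
apply: (@le_trans _ _ ((K `^ (p / 2))%:E `^ p^-1)%E).
  apply: gt0_ler_poweR; rewrite ?invr_ge0 ?(ltW p0)//.
  - by rewrite in_itv/= leey andbT; apply: integral_ge0 => t _; exact: poweR_ge0.
  - by rewrite in_itv/= leey andbT lee_fin powR_ge0.
  apply: le_trans hM; apply: le_ge0_integral => t _; first exact: poweR_ge0.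
  exact: distr_le_M.
rewrite SE !poweR_EFin -powRrM -EFinM lee_fin (_ : p / 2 * p^-1 = 2^-1); last first.
  by field; rewrite gt_eqF.
exact: sqrt_const_le.
Qed.

End Datum.

Theorem strichartz_torus : exists C : R, 0 < C /\
  forall u0 : @torus_distr R, in_H p^-1 u0 ->
    (LpLq_norm p q (fun t => expitP t u0) <= C%:E * Hnorm p^-1 u0)%E.
Proof.
exists (2 * Num.sqrt (dyadic_const eps blocks_const) + 1); split.
  by rewrite ltr_wpDl// mulr_ge0// sqrtr_ge0.
exact: LpLq_norm_le_Hnorm.
Qed.

End Conclusion.

(** * Sharpness *)

Section ComplexIntegrable.
Context d (T : measurableType d) (R : realType)
  (mu : {measure set T -> \bar R}) (D : set T).
Hypotheses (mD : measurable D) (fD : (mu D < +oo)%E).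
Implicit Types f g : T -> R[i].

Definition cintegrable f :=
  mu.-integrable D (fun x => (complex.Re (f x))%:E) /\
  mu.-integrable D (fun x => (complex.Im (f x))%:E).

Lemma cintegrableD f g : cintegrable f -> cintegrable g -> cintegrable (fun x => f x + g x).
Proof.
move=> [f1 f2] [g1 g2]; split.
  by have := integrableD mD f1 g1; apply: eq_integrable => // x _; rewrite ReD.
by have := integrableD mD f2 g2; apply: eq_integrable => // x _; rewrite ImD.
Qed.

Lemma cintegrable0 : cintegrable (fun=> 0).
Proof. by split; exact: (bmf_integrable mD fD (bmf_cst _ 0)). Qed.

Let integrableM (a : T -> R) (b : T -> R) : mu.-integrable D (fun x => (a x)%:E) -> bmf b ->
  mu.-integrable D (fun x => (a x * b x)%:E).
Proof.
move=> ia [mb [M bM]].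
have ma : measurable_fun D a by apply/measurable_EFinP; exact: measurable_int ia.
apply: (le_integrable mD _ _ (integrableZl mD M ia)).
  by apply/measurable_EFinP/measurable_funM => //; exact: measurable_funTS.
move=> x _; rewrite -EFinM !abse_EFin lee_fin !normrM mulrC ler_wpM2r//.
exact: le_trans (bM x) (ler_norm _).
Qed.

Lemma cintegrableM f g : cintegrable f -> cbm g -> cintegrable (fun x => f x * g x).
Proof.
move=> [f1 f2] [g1 g2]; split.
  have := integrableB mD (integrableM f1 g1) (integrableM f2 g2).
  by apply: eq_integrable => // x _; rewrite ReM.
have := integrableD mD (integrableM f1 g2) (integrableM f2 g1).
by apply: eq_integrable => // x _; rewrite ImM.
Qed.

Lemma cintegrable_expectD f g : cintegrable f -> cintegrable g ->
  cexpect mu D (fun x => f x + g x) = cexpect mu D f + cexpect mu D g.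
Proof.
move=> [f1 f2] [g1 g2]; apply: complex_ext; rewrite ?ReD ?ImD/=.
  by rewrite -RintegralD//; apply: eq_expect => x _; rewrite ReD.
by rewrite -RintegralD//; apply: eq_expect => x _; rewrite ImD.
Qed.

Lemma cintegrable_expect_sum (I : Type) (s : seq I) (F : I -> T -> R[i]) :
  (forall i, cintegrable (F i)) ->
  cintegrable (fun x => \sum_(i <- s) F i x) /\
  cexpect mu D (fun x => \sum_(i <- s) F i x) = \sum_(i <- s) cexpect mu D (F i).
Proof.
move=> iF; elim: s => [|i s [ih1 ih2]].
  have -> : (fun x => \sum_(i <- [::]) F i x) = fun=> 0.
    by apply/funext => x; rewrite big_nil.
  by rewrite big_nil (cexpect0 _ mD); split => //; exact: cintegrable0.
have -> : (fun x => \sum_(j <- i :: s) F j x) = fun x => F i x + \sum_(j <- s) F j x.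
  by apply/funext => x; rewrite big_cons.
split; first exact: cintegrableD.
by rewrite big_cons -ih2; exact: cintegrable_expectD.
Qed.

End ComplexIntegrable.

(** * The diagonal datum and the Fejer kernel *)

Section Fejer.
Context {R : realType}.
Local Notation RT := (measurableTypeR R).
Local Notation area := (torus_measure R).
Variable N : nat.

Let mD := @measurable_torus_square R.
Let fD := @finite_torus_square R.

Definition diag_hat (m n : int) : R[i] :=
  if (m == n) && (0 <= m < N%:Z) then 1 else 0.

Lemma diag_hat_tempered : exists (C : R) (k : nat),
  forall m n, nc (diag_hat m n) <= C * japanese2 m n ^+ k.
Proof.
exists 1, 0%N => m n; rewrite expr0 mulr1 /diag_hat.
by case: ifP => _; rewrite ?Normc.normc1// Normc.normc0.
Qed.

Definition diag_distr : @torus_distr R := TorusDistr diag_hat_tempered.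

Lemma expitP_diag t m n : expitP t diag_distr m n = diag_hat m n.
Proof.
rewrite /= /diag_hat; case: (eqVneq m n) => [->|_] /=; last by rewrite mulr0.
by rewrite /symbolP subrr mulr0 oppr0 cis0 mul1r.
Qed.

Definition dirichlet (z : R * R) : R[i] := \sum_(0 <= j < N) wave (j%:Z, j%:Z) z.

(** This is [N] times the usual Fejer kernel in the variable [x + y]. *)
Definition fejer (z : R * R) : R := nc (dirichlet z) ^+ 2.

Let ks : seq (nat * nat) := [seq (a, b) | a <- index_iota 0 N, b <- index_iota 0 N].

Let fejerE z : (fejer z)%:C =
  \sum_(k <- ks) conjc (wave (k.2%:Z - k.1%:Z, k.2%:Z - k.1%:Z) z).
Proof.
rewrite /fejer -mul_conjc /dirichlet mulr_suml big_allpairs; apply: eq_bigr => a _.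
rewrite conjc_sum mulr_sumr; apply: eq_bigr => b _.
by rewrite wave_conjM /wave -cisN; congr cis => /=; rewrite !intrB; ring.
Qed.

Lemma fejer_ge0 z : 0 <= fejer z. Proof. exact: sqr_ge0. Qed.

Lemma fejer_le z : fejer z <= N%:R ^+ 2.
Proof.
rewrite /fejer ler_pXn2r ?nnegrE ?nc_ge0//.
apply: (le_trans (nc_sum _ _ _)); under eq_bigr do rewrite nc_wave.
by rewrite big_const_nat iter_addr_0 subn0.
Qed.

Lemma cbm_dirichlet : @cbm _ (RT * RT)%type R dirichlet.
Proof. by apply: cbm_sum => j _; exact: cbm_wave. Qed.

Lemma bmf_fejer : @bmf _ (RT * RT)%type R fejer.
Proof. exact: (bmfX 2 (bmf_nc cbm_dirichlet)). Qed.

Let cww k : @cbm _ (RT * RT)%type R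
  (fun z => conjc (wave (k.2%:Z - k.1%:Z, k.2%:Z - k.1%:Z) z)).
Proof. exact: (cbm_conj (cbm_wave _)). Qed.

Lemma expect_fejer : Rintegral area torus_square fejer = torus_area * N%:R.
Proof.
suff : (Rintegral area torus_square fejer)%:C = (torus_area * N%:R)%:C.
  by move/(congr1 (@complex.Re R)).
rewrite -(cexpect_real _ mD).
transitivity (cexpect area torus_square (fun z => \sum_(k <- ks)
    conjc (wave (k.2%:Z - k.1%:Z, k.2%:Z - k.1%:Z) z))).
  by apply: eq_cexpect => z _; exact: fejerE.
rewrite (cexpect_sum mD fD); last by move=> k _; exact: cww.
transitivity (\sum_(k <- ks) (if k.1 == k.2 then (torus_area : R)%:C else 0)).
  apply: eq_bigr => k _.
  rewrite (cexpect_conj mD fD (cbm_wave _)) cexpect_wave.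
  have -> : ((k.2%:Z - k.1%:Z, k.2%:Z - k.1%:Z) == 0) = (k.1 == k.2).
    rewrite -[LHS]/((k.2%:Z - k.1%:Z == 0) && (k.2%:Z - k.1%:Z == 0)).
    by rewrite andbb subr_eq0 eq_sym eqz_nat.
  by case: ifP => _; rewrite ?conjc0 ?conjc_real.
rewrite big_allpairs.
transitivity (\sum_(0 <= a < N) (torus_area : R)%:C).
  rewrite big_seq [RHS]big_seq; apply: eq_bigr => a aN.
  rewrite (bigD1_seq a)//= ?iota_uniq// eqxx big1 ?addr0// => b /negbTE.
  by rewrite eq_sym => ->.
by rewrite big_const_nat iter_addr_0 subn0 mulr_natr rmorphMn.
Qed.

(** The pairing counts the pairs [a, b < N] whose difference [b - a] is again a frequency of the
    datum, that is [a <= b]; by symmetry these are at least half of the [N ^ 2] pairs. *)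
Lemma cexpect_fejer (f : R * R -> R[i]) : cintegrable area torus_square f ->
  (forall m n, fourier_coef f m n = diag_hat m n) ->
  Rintegral area torus_square (fun z => complex.Re (f z) * fejer z) >=
  torus_area * (N%:R ^+ 2 / 2).
Proof.
move=> cf fc.
have cfE m n : cexpect area torus_square (fun z => f z * conjc (wave (m, n) z)) =
    (torus_area)%:C * diag_hat m n.
  rewrite -fc /fourier_coef mulrA -realcM /torus_area mulfV ?mul1r; last first.
    by rewrite expf_neq0// mulf_neq0 ?gt_eqF ?pi_gt0.
  by apply: eq_cexpect => z _; rewrite /wave cisN.
have [_ sumE] := cintegrable_expect_sum mD fD ks (fun k => cintegrableM mD cf (cww k)).
have E : cexpect area torus_square (fun z => f z * (fejer z)%:C) =
    (torus_area * (\sum_(k <- ks) ((k.1 <= k.2)%N)%:R))%:C.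
  transitivity (cexpect area torus_square (fun z => \sum_(k <- ks)
      f z * conjc (wave (k.2%:Z - k.1%:Z, k.2%:Z - k.1%:Z) z))).
    by apply: eq_cexpect => z _; rewrite fejerE mulr_sumr.
  rewrite sumE realcM rmorph_sum mulr_sumr big_seq [RHS]big_seq.
  apply: eq_bigr => -[a b] /allpairsP[[a' b'] /= [ha hb [-> ->]]].
  rewrite cfE /diag_hat eqxx/=; congr (_ * _).
  have -> : (0 <= b'%:Z - a'%:Z < N%:Z) = (a' <= b')%N.
    by move: hb; rewrite mem_index_iota; lia.
  by case: leqP => _.
have := congr1 (@complex.Re R) E; rewrite [X in _ = X -> _]/=.
have -> : complex.Re (cexpect area torus_square (fun z => f z * (fejer z)%:C)) =
    Rintegral area torus_square (fun z => complex.Re (f z) * fejer z).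
  by apply: eq_expect => z _; rewrite ReM/= mulr0 subr0.
move=> ->; rewrite ler_wpM2l ?(ltW torus_area_gt0)//.
have sym : \sum_(k <- ks) ((k.1 <= k.2)%N)%:R = \sum_(k <- ks) ((k.2 <= k.1)%N)%:R :> R.
  by rewrite !big_allpairs exchange_big.
have : \sum_(k <- ks) 1 <= \sum_(k <- ks) ((k.1 <= k.2)%N)%:R + \sum_(k <- ks) ((k.2 <= k.1)%N)%:R :> R.
  rewrite -big_split; apply: ler_sum => k _ /=.
  by case: (leqP k.1 k.2) => [_|/ltnW ->]; rewrite ?lerDl ?lerDr.
rewrite -sym big_const_seq count_predT iter_addr_0 size_allpairs size_iota subn0 natrM -expr2.
lra.
Qed.

End Fejer.

(** * Growth of the two norms of the diagonal datum *)

Section LowerBound.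
Context {R : realType}.
Local Notation RT := (measurableTypeR R).
Local Notation leb := (@lebesgue_measure R).
Local Notation area := (torus_measure R).

Let mD := @measurable_torus_square R.
Let fD := @finite_torus_square R.

Let measurable_pairRT (f : R * R -> R) : measurable_fun setT f ->
  @measurable_fun _ _ (RT * RT)%type R setT f.
Proof.
move=> mf; have mid : @measurable_fun _ _ (RT * RT)%type (R * R)%type setT id.
  apply/measurable_fun_pairP; split.
    exact: (measurableT_comp measurable_idR measurable_fst).
  exact: (measurableT_comp measurable_idR measurable_snd).
exact: (measurableT_comp mf mid).
Qed.

Let measurable_nc (f : R * R -> R[i]) : torus_integrable f ->
  @measurable_fun _ _ (RT * RT)%type R setT (fun z => nc (f z)).
Proof.
move=> [_ /measurable_pairRT m1 /measurable_pairRT m2 _].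
have -> : (fun z => nc (f z)) =
    fun z => Num.sqrt (complex.Re (f z) ^+ 2 + complex.Im (f z) ^+ 2).
  by apply/funext => z; rewrite -sqr_nc sqrtr_sqr ger0_norm ?nc_ge0.
apply: (measurableT_comp (continuous_measurable_fun (@sqrt_continuous R))).
by apply: measurable_funD; exact: measurable_funX.
Qed.

Let torus_cintegrable (f : R * R -> R[i]) : torus_integrable f ->
  cintegrable area torus_square f.
Proof.
move=> tf; have mnc := measurable_nc tf; move: tf.
move=> [_ /measurable_pairRT m1 /measurable_pairRT m2 fin].
have inc : area.-integrable torus_square (fun z => (nc (f z))%:E).
  apply/integrableP; split; first by apply/measurable_EFinP; exact: measurable_funTS.
  apply: le_lt_trans fin; apply: le_ge0_integral => z _; first exact: abse_ge0.
  by rewrite abse_EFin ger0_norm ?nc_ge0.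
split; apply: (le_integrable mD _ _ inc).
- by apply/measurable_EFinP; exact: measurable_funTS.
- by move=> z _; rewrite !abse_EFin lee_fin [leRHS]ger0_norm ?nc_ge0// Re_le_nc.
- by apply/measurable_EFinP; exact: measurable_funTS.
- by move=> z _; rewrite !abse_EFin lee_fin [leRHS]ger0_norm ?nc_ge0// Im_le_nc.
Qed.

(* Replaces Hoelder's inequality by a splitting at the level [A = m]. *)
Let le_level (q m K A b : R) : 1 < q -> 0 < m -> 0 <= A -> 0 <= b -> b <= K ->
  A * b <= m * b + m `^ (1 - q) * K * A `^ q.
Proof.
move=> q1 m0 A0 b0 bK; have K0 := le_trans b0 bK.
have [Am|mA] := leP A m.
  apply: (@le_trans _ _ (m * b)); first by rewrite ler_wpM2r.
  by rewrite lerDl !mulr_ge0 ?powR_ge0.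
have Ap : 0 < A by exact: lt_trans mA.
apply: (@le_trans _ _ (m `^ (1 - q) * K * A `^ q)); last by rewrite lerDr mulr_ge0// ltW.
have -> : m `^ (1 - q) * K * A `^ q = A * K * (A / m) `^ (q - 1).
  rewrite powRM ?invr_ge0 ?(ltW m0)// -(powR_inv1 (ltW m0)) -powRrM mulN1r opprB.
  by rewrite -(mulr_powRB1 A0 (lt_trans ltr01 q1)); ring.
rewrite -mulrA ler_wpM2l//.
apply: (le_trans bK); rewrite -[leLHS]mulr1 ler_wpM2l//.
rewrite -[leLHS](powRr0 (A / m)) ler_powR//.
  by rewrite ler_pdivlMr// mul1r ltW.
by rewrite subr_ge0 ltW.
Qed.

Lemma diag_Lnorm_ge (N : nat) (q : R) (f : R * R -> R[i]) : (0 < N)%N -> 1 < q ->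
  torus_integrable f -> (forall m n, fourier_coef f m n = diag_hat N m n) ->
  (((torus_area / 4 * (N%:R / 4) `^ (q - 1)) `^ q^-1)%:E <= torus_Lnorm q f)%E.
Proof.
move=> N0 q1 tf fc; have q0 : 0 < q by exact: lt_trans q1.
have cf := torus_cintegrable tf; have mnc := measurable_nc tf.
have NR : 0 < N%:R :> R by rewrite ltr0n.
set W := torus_area; have W0 : 0 < W by exact: torus_area_gt0.
set F := (\int[area]_(z in torus_square) (nc (f z) `^ q)%:E)%E.
have F0 : (0 <= F)%E by apply: integral_ge0 => z _; rewrite lee_fin powR_ge0.
suff : ((W / 4 * (N%:R / 4) `^ (q - 1))%:E <= F)%E.
  move=> h; rewrite /torus_Lnorm -poweR_EFin gt0_ler_poweR ?invr_ge0 ?(ltW q0)//.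
    by rewrite in_itv/= leey andbT lee_fin mulr_ge0 ?powR_ge0// divr_ge0// ltW.
  by rewrite in_itv/= leey andbT.
have [Ffin|] := boolP (F < +oo)%E; last by rewrite -leNgt leye_eq => /eqP ->; rewrite leey.
have Ff : F \is a fin_num by rewrite ge0_fin_numE.
(* At this level the term [m * (W * N)] is half of the lower bound [W * N ^ 2 / 2], so the other
   half must come from the [L^q] integral. *)
set m : R := N%:R / 4; have m0 : 0 < m by rewrite divr_gt0.
have bf := bmf_fejer (R := R) N.
have iRe : area.-integrable torus_square (fun z => (complex.Re (f z) * fejer N z)%:E).
  have [h _] := cintegrableM mD cf (cbm_real bf).
  by apply: eq_integrable h => // z _; rewrite ReM/= mulr0 subr0.
have h1 := cexpect_fejer cf fc.
have h2 : ((W * (N%:R ^+ 2 / 2))%:E <=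
    m%:E * (W * N%:R)%:E + (m `^ (1 - q) * N%:R ^+ 2)%:E * F)%E.
  apply: (@le_trans _ _ (\int[area]_(z in torus_square) (complex.Re (f z) * fejer N z)%:E)%E).
    by rewrite -(fineK (integrable_fin_num mD iRe)) lee_fin.
  apply: le_trans (lee_abs _) _.
  apply: le_trans (le_abse_integral _ mD (measurable_int _ iRe)) _.
  have mfj : @measurable_fun _ _ (RT * RT)%type _ torus_square (fun z => (fejer (R := R) N z)%:E).
    by apply/measurable_EFinP; apply: measurable_funTS; case: bf.
  have mF : @measurable_fun _ _ (RT * RT)%type _ torus_square (fun z => (nc (f z) `^ q)%:E).
    apply/measurable_EFinP; apply: measurable_funTS.
    exact: (measurableT_comp (measurable_powR q) mnc).
  rewrite -(expect_fejer N) -(EFin_expect mD fD bf) /F.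
  rewrite -ge0_integralZl//; last 2 first.
  - by move=> z _; rewrite lee_fin fejer_ge0.
  - by rewrite lee_fin ltW.
  rewrite -ge0_integralZl//; last 2 first.
  - by move=> z _; rewrite lee_fin powR_ge0.
  - by rewrite lee_fin mulr_ge0 ?powR_ge0 ?sqr_ge0.
  rewrite -ge0_integralD//; last 4 first.
  - by move=> z _; rewrite -EFinM lee_fin mulr_ge0 ?fejer_ge0// ltW.
  - by apply: emeasurable_funM => //; exact: measurable_cst.
  - by move=> z _; rewrite -EFinM lee_fin !mulr_ge0 ?powR_ge0 ?sqr_ge0.
  - by apply: emeasurable_funM => //; exact: measurable_cst.
  apply: le_ge0_integral => z _; first exact: abse_ge0.
  rewrite -!EFinM -EFinD abse_EFin lee_fin normrM (ger0_norm (fejer_ge0 _ _)).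
  apply: (@le_trans _ _ (nc (f z) * fejer N z)).
    by rewrite ler_wpM2r ?fejer_ge0// Re_le_nc.
  by apply: le_level; rewrite ?nc_ge0 ?fejer_ge0 ?fejer_le.
move: h2; rewrite -(fineK Ff) -!EFinM -EFinD !lee_fin; set x := fine F => h2.
have mE : m `^ (1 - q) * m `^ (q - 1) = 1.
  by rewrite -opprB powRN mulVf// gt_eqF// powR_gt0.
have M0 : 0 < m `^ (q - 1) by exact: powR_gt0.
have N20 : 0 < N%:R ^+ 2 :> R by rewrite exprn_gt0.
have h3 : W * N%:R ^+ 2 / 4 <= m `^ (1 - q) * N%:R ^+ 2 * x.
  have -> : W * N%:R ^+ 2 / 4 = W * (N%:R ^+ 2 / 2) - m * (W * N%:R) by rewrite /m; field.
  by rewrite lerBlDl.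
rewrite -(ler_pM2r N20).
have -> : W / 4 * m `^ (q - 1) * N%:R ^+ 2 = (W * N%:R ^+ 2 / 4) * m `^ (q - 1) by ring.
have -> : x * N%:R ^+ 2 = m `^ (1 - q) * N%:R ^+ 2 * x * m `^ (q - 1).
  transitivity (x * N%:R ^+ 2 * (m `^ (1 - q) * m `^ (q - 1))); last by ring.
  by rewrite mE mulr1.
by rewrite ler_pM2r.
Qed.

Lemma diag_LpLq_ge (N : nat) (p q : R) : (0 < N)%N -> 1 < q -> 0 < p ->
  (((torus_area / 4 * (N%:R / 4) `^ (q - 1)) `^ q^-1)%:E <=
   LpLq_norm p q (fun t => expitP t (@diag_distr R N)))%E.
Proof.
move=> N0 q1 p0; set l := (_ `^ q^-1); have l0 : 0 <= l by exact: powR_ge0.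
have h t : (l%:E <= distr_Lnorm q (expitP t (@diag_distr R N)))%E.
  apply: le_ereal_inf_tmp => _ [f [tf fc] <-]; apply: diag_Lnorm_ge => // m n.
  by rewrite fc expitP_diag.
have mI := @measurable_timeI R 0 1.
apply: (@le_trans _ _ (((l `^ p)%:E) `^ p^-1)%E).
  by rewrite poweR_EFin -powRrM mulfV ?gt_eqF// powRr1.
apply: gt0_ler_poweR; rewrite ?invr_ge0 ?(ltW p0)//.
- by rewrite in_itv/= leey andbT lee_fin powR_ge0.
- by rewrite in_itv/= leey andbT; apply: integral_ge0 => t _; exact: poweR_ge0.
apply: (@le_trans _ _ (\int[leb]_(t in `[0%R, 1%R]) (l `^ p)%:E)%E).
  have e : leb `[0, 1]%classic = 1%E by rewrite (lebesgue_segment ler01) subr0.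
  by rewrite integral_cst// [X in (_ * X)%E]e mule1.
apply: le_ge0_integral => t _; first by rewrite lee_fin powR_ge0.
rewrite -poweR_EFin; apply: gt0_ler_poweR; rewrite ?(ltW p0)//.
  by rewrite in_itv/= leey andbT lee_fin.
by rewrite in_itv/= leey andbT (le_trans _ (h t)).
Qed.

(** The weights are at least [1], so the exponent may be raised to a nonnegative [sg], for which all
    [N] weights are at most [(2 N ^ 2) ^ sg]. *)
Lemma diag_Hnorm_le (N : nat) (s sg : R) : (0 < N)%N -> s <= sg -> 0 <= sg ->
  (Hnorm s (@diag_distr R N) <= ((N%:R * (2 * N%:R ^+ 2) `^ sg) `^ 2^-1)%:E)%E.
Proof.
move=> N0 ssg sg0; rewrite /Hnorm -poweR_EFin.
have S0 : (0 <= \esum_(k in [set: int * int])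
    (japanese2 k.1 k.2 `^ s * nc (diag_distr (R := R) N k.1 k.2) ^+ 2)%:E)%E.
  by apply: esum_ge0 => k _; rewrite lee_fin mulr_ge0 ?powR_ge0 ?sqr_ge0.
apply: gt0_ler_poweR; rewrite ?invr_ge0//.
- by rewrite in_itv/= leey andbT.
- by rewrite in_itv/= leey andbT lee_fin mulr_ge0 ?powR_ge0.
pose ks : seq (int * int) := [seq (j%:Z, j%:Z) | j <- iota 0 N].
have uks : uniq ks by rewrite map_inj_uniq ?iota_uniq// => i j [].
apply: (@le_trans _ _ (\esum_(k in [set` ks]) ((2 * N%:R ^+ 2) `^ sg)%:E)%E).
  rewrite [leRHS]esum_mkcond; apply: le_esum => -[m n] _ /=.
  rewrite /diag_hat; case: ifPn => [/andP[/eqP <- mN]|_]; last first.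
    rewrite Normc.normc0 expr0n/= mulr0; case: ifP => _ //.
    by rewrite lee_fin powR_ge0.
  have [j jN ->] : exists2 j : nat, (j < N)%N & m = j%:Z by exists `|m|%N; lia.
  rewrite ifT; last by rewrite inE/=; apply/mapP; exists j; rewrite ?mem_iota.
  rewrite Normc.normc1 expr1n mulr1 lee_fin.
  have J1 : 1 <= japanese2 j%:Z j%:Z :> R.
    by rewrite /japanese2 -addrA lerDl addr_ge0// sqr_ge0.
  apply: (@le_trans _ _ (japanese2 j%:Z j%:Z `^ sg)); first by rewrite ler_powR.
  rewrite ge0_ler_powR ?nnegrE ?mulr_ge0 ?sqr_ge0 ?(le_trans _ J1)//.
  rewrite /japanese2 -[(j%:Z)%:~R]/(j%:R) -!natrX -(natrD _ 1) -natrD -natrM ler_nat.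
  by nia.
rewrite esum_fset; last 2 first.
- exact: finite_seq.
- by move=> k _; rewrite lee_fin powR_ge0.
rewrite -fsbig_seq// sumEFin lee_fin big_const_seq count_predT iter_addr_0 size_map size_iota.
by rewrite [leRHS]mulr_natl.
Qed.

End LowerBound.

Section Sharpness.
Context {R : realType}.
Variables (p q : R).
Hypotheses (pq : p^-1 + q^-1 = 2^-1) (p2 : 2 < p).

Theorem strichartz_sharp (s : R) : s < p^-1 ->
  ~ exists C : R, 0 < C /\ forall u0 : @torus_distr R, in_H s u0 ->
    (LpLq_norm p q (fun t => expitP t u0) <= C%:E * Hnorm s u0)%E.
Proof.
move=> sp [C [C0 hC]].
have p0 : 0 < p by exact: lt_trans p2.
have qV : q^-1 = 2^-1 - p^-1 by rewrite -pq; ring.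
have q0 : 0 < q by rewrite -invr_gt0 qV subr_gt0 ltf_pV2 ?posrE.
have q1 : 1 < q.
  rewrite -ltf_pV2 ?posrE// invr1 qV ltrBlDr (@lt_le_trans _ _ 1)//.
    by rewrite invf_lt1// ltr1n.
  by rewrite lerDl invr_ge0 ltW.
(* A negative [s] is replaced by [0], which is still below [1 / p]. *)
set sg := Num.max s 0.
have sg0 : 0 <= sg by rewrite le_max lexx orbT.
have ssg : s <= sg by rewrite le_max lexx.
have sgp : sg < p^-1 by rewrite gt_max sp invr_gt0.
set del := p^-1 - sg; have del0 : 0 < del by rewrite subr_gt0.
pose W : R := torus_area.
have W0 : 0 < W by exact: torus_area_gt0.
pose A : R := (W / 4) `^ q^-1 * 4^-1 `^ (1 - q^-1); pose B : R := C * 2 `^ (sg / 2).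
have A0 : 0 < A by rewrite mulr_gt0// powR_gt0// ?divr_gt0// invr_gt0.
(* The norms grow like [N ^ (1 - 1 / q)] and at most [N ^ (1 / 2 + sg)], and the exponents differ by
   [del]; the assumed estimate would keep [N ^ del] bounded. *)
have key N : (0 < N)%N -> A * N%:R `^ del <= B.
  move=> N0; have NR : 0 < N%:R :> R by rewrite ltr0n.
  have hH := diag_Hnorm_le N0 ssg sg0.
  have inH : in_H s (@diag_distr R N) by apply: le_lt_trans hH _; rewrite ltry.
  have := le_trans (diag_LpLq_ge N0 q1 p0) (hC _ inH).
  move=> /le_trans/(_ (lee_wpmul2l _ hH)); rewrite lee_fin => /(_ (ltW C0)).
  rewrite -EFinM lee_fin -/W.
  have -> : (W / 4 * (N%:R / 4) `^ (q - 1)) `^ q^-1 = A * N%:R `^ (1 - q^-1).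
    rewrite powRM ?powR_ge0 ?divr_ge0 ?(ltW W0)// -powRrM (_ : (q - 1) * q^-1 = 1 - q^-1); last first.
      by field; rewrite gt_eqF.
    by rewrite [(N%:R / 4) `^ _]powRM// /A; ring.
  have -> : C * (N%:R * (2 * N%:R ^+ 2) `^ sg) `^ 2^-1 = B * N%:R `^ (2^-1 + sg).
    rewrite powRM ?powR_ge0// -powRrM powRM ?sqr_ge0// -powR_mulrn// -powRrM.
    have -> : 2%:R * (sg * 2^-1) = sg by field.
    rewrite powRD ?(gt_eqF NR) ?implybT//.
    by rewrite /B; ring.
  have -> : 1 - q^-1 = del + (2^-1 + sg) by rewrite qV /del; field; rewrite gt_eqF.
  have -> : N%:R `^ (del + (2^-1 + sg)) = N%:R `^ del * N%:R `^ (2^-1 + sg).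
    by rewrite [LHS]powRD// (gt_eqF NR) implybT.
  rewrite mulrA ler_pM2r//.
  exact: powR_gt0.
pose x := (B / A + 1) `^ del^-1.
have B0 : 0 <= B by rewrite mulr_ge0 ?powR_ge0// ltW.
have BA0 : 0 < B / A + 1 by rewrite ltr_wpDl// divr_ge0// ltW.
have x0 : 0 <= x by exact: powR_ge0.
have := key (Num.bound x) _; rewrite -(ltr_nat R).
have xb : x < (Num.bound x)%:R by apply: le_lt_trans (archi_boundP x0); rewrite ?ler_norm.
move=> /(_ (le_lt_trans x0 xb)).
apply/negP; rewrite -ltNge mulrC -ltr_pdivrMr//.
apply: (@lt_le_trans _ _ (B / A + 1)); first by rewrite ltrDl.
have -> : B / A + 1 = x `^ del.
  by rewrite /x -powRrM mulVf ?gt_eqF// powRr1// ltW.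
by rewrite ge0_ler_powR ?nnegrE ?(ltW del0)// ltW.
Qed.

End Sharpness.

Theorem theorem1p1 (R : realType) (p q : R) (hpq : admissible p q) :
  (exists C : R, 0 < C /\
     forall u0 : @torus_distr R, in_H p^-1 u0 ->
       (LpLq_norm p q (fun t => expitP t u0) <= C%:E * Hnorm p^-1 u0)%E) /\
  (forall s : R, s < p^-1 ->
     ~ exists C : R, 0 < C /\
       forall u0 : @torus_distr R, in_H s u0 ->
         (LpLq_norm p q (fun t => expitP t u0) <= C%:E * Hnorm s u0)%E).
Proof.
by have [pq p2] := hpq; split; [exact: strichartz_torus|move=> s; exact: strichartz_sharp].
Qed.
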